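(* Let $k\ge 2$, let $\mathbb{S}$ be a marked surface, and let $\mathcal{M}$ be either $\mathcal{A}_{{\rm SL}_k,\mathbb{S}}$ or $\mathcal{A}'_{{\rm SL}_k,\mathbb{S}}$. Then any pseudotagged diagram invariant $[(T,\varphi)]$ (a rational function on $\mathcal{M}$, where $T$ is an $\mathcal{M}$-tensor diagram and $\varphi$ is a pseudotagging of $T$) is a linear combination of tagged diagram invariants.
   Context: **Marked surfaces.** $\mathbb{S}=(\mathbf{S},\mathbb{M})$ is an oriented marked surface (in the sense of Fomin–Shapiro–Thurston): $\mathbf S$ is a compact oriented surface, possibly with boundary, and $\mathbb{M}$ is a finite nonempty set of marked points with at least one on each boundary component. $\mathbb{M}_\circ$ denotes the marked points in the interior (the punctures) and $\mathbb{M}_\partial$ those on the boundary. Excluded throughout: spheres with at most $2$ punctures, the unpunctured monogon and digon, and the once-punctured monogon. **Moduli spaces.** $V$ is a $k$-dimensional complex vector space with volume form $\xi$, identifying $\bigwedge^k V\cong\mathbb{C}$; $G={\rm SL}(V)={\rm SL}_k$. An affine flag $F$ is a choice of tensors $F_{(i)}\in\bigwedge^i V$ with $F_{(k)}=\xi$ and such that for each $i\in[k-1]$ there is $v\in V$ with $F_{(i)}\wedge v=F_{(i+1)}$. A $G$-local system on $\mathbb{S}$ is a copy $V_x$ of $(V,\xi)$ at each point $x$ and, for each path $x\to y$, a $\xi$-preserving transport isomorphism $V_x\to V_y$ depending only on the isotopy class of the path (for $k$ even one uses twisted local systems, i.e. local systems on the punctured tangent bundle with fiber monodromy $-{\rm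 Id}$; this only affects signs). A point of $\mathcal{A}_{{\rm SL}_k,\mathbb{S}}$ is such a local system with an affine flag $F_p$ in $V_p$ at every marked point $p$, such that at each puncture $p$ the monodromy $u_p$ of a simple loop contractible to $p$ stabilizes $F_p$; such data are considered up to simultaneous $G$-action. $\mathcal{A}'_{{\rm SL}_k,\mathbb{S}}$ is defined in the same way, except that each boundary point $p$ is decorated by a vector $v_p\in V_p$ instead of an affine flag. **Weyl group action on affine flags.** Let $u$ be unipotent and stabilize $F$. For $i\in[k-1]$ choose $v$ with $F_{(i+1)}=F_{(i)}\wedge v$; then $s_i\cdot F$ is the affine flag whose $i$th step is $F_{(i-1)}\wedge(u(v)-v)$ and whose other steps agree with those of $F$ (defined when $u(v)-v\notin{\rm span}\,F_{(i-1)}$). These satisfy the relations of the simple transpositions and define a rational action of the symmetric group $W=S_k$. Convention: if the one-line notation of $w$ is obtained from that of the identity by successively swapping the entries in adjacent positions $(i_1,i_1+1),\dots,(i_\ell,i_\ell+1)$, then $w\cdot F=s_{i_\ell}\cdot(\cdots(s_{i_1}\cdot F))$. The tensor $(w\cdot F)_{(a)}$ depends only on the set $w([a])$. **Tensor diagrams.** An $\mathcal{M}$-tensor diagram is an immersed, edge-labeled, acyclic directed graph $T\subset\mathbf{S}$ (up to isotopy fixing marked points) such that: every marked point is a source vertex of $T$ and the other vertices lie in ${\rm int}\,\mathbf S\setminus\mathbb{M}_\circ$; edges have endpoints at vertices and otherwise avoid $\mathbb{M}$ and $\partial\mathbf S$; there are finitely many self-crossings, each a transverse crossing of two edges; each edge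 $e$ has a label ${\rm wt}(e)\in[k]$, with ${\rm wt}(e)=1$ for edges incident to boundary points when $\mathcal{M}=\mathcal{A}'_{{\rm SL}_k,\mathbb{S}}$; each vertex which is not a marked point is one of: a white vertex (incoming labels $a_1,\dots,a_m$, one outgoing edge labeled $a_1+\cdots+a_m$), a black vertex (one incoming edge labeled $a_1+\cdots+a_m$, outgoing labels $a_1,\dots,a_m$), a coevaluation leaf (a single outgoing edge labeled $k$), or an evaluation leaf (a single incoming edge labeled $k$). A leg is an edge incident to a puncture; ${\rm Legs}_p(T)$ is the set of legs at $p$ and ${\rm Legs}(T)$ the set of all legs. **Evaluation.** White vertices encode the exterior product $\bigotimes_j\bigwedge^{a_j}V\to\bigwedge^{\sum a_j}V$; black vertices encode the dual map $\bigwedge^{\sum a_j}V\to\bigotimes_j\bigwedge^{a_j}V$ (the signed sum over all ways of shuffling the vectors of a decomposable tensor into the factors); evaluation (coevaluation) leaves encode $\bigwedge^kV\cong\mathbb{C}$ (its inverse). Given $z\in\mathcal{M}$, assign a tensor in $\bigwedge^{{\rm wt}(e)}V_{s(e)}$ to every edge $e$ whose source $s(e)$ is a marked point or coevaluation leaf: the decoration at the marked point (its vector, or the ${\rm wt}(e)$th step of its affine flag), respectively $\xi$. Transporting along edges and composing the maps at vertices gives a number $[T](z)$; $[T]$ is the (plain) invariant of $T$. **Tagging.** A pseudotagged tensor diagram is a pair $(T,\varphi)$ with $\varphi$ assigning to each leg $e$ a subset $\varphi(e)\subseteq[k]$ with $|\varphi(e)|={\rm wt}(e)$. It is a tagged tensor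 diagram (and $\varphi$ is a tagging) if in addition, for any two legs $e,e'$ at the same puncture, $\varphi(e)\subseteq\varphi(e')$ or $\varphi(e')\subseteq\varphi(e)$. The invariant $[(T,\varphi)]$ is the rational function on $\mathcal{M}$ defined like $[T]$, except that the tensor assigned to a leg $e$ at a puncture $p$ is $(w_e\cdot F_p)_{({\rm wt}(e))}$ (action computed with $u=u_p$), where $w_e\in W$ is any permutation with $w_e([{\rm wt}(e)])=\varphi(e)$. A pseudotagged (resp. tagged) diagram invariant is a function of the form $[(T,\varphi)]$ with $(T,\varphi)$ pseudotagged (resp. tagged). *)

(* Defs.v *)
From HB Require Import structures.
From mathcomp Require Import all_boot all_order all_algebra all_fingroup.
From mathcomp Require Import all_classical all_reals all_analysis.
From mathcomp Require Import complex.

Set Implicit Arguments.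
Unset Strict Implicit.
Unset Printing Implicit Defensive.

Import Order.TTheory GRing.Theory Num.Theory numFieldNormedType.Exports.

Local Open Scope classical_set_scope.
Local Open Scope ring_scope.

(* V is C^k with its standard volume form.  An element of its full exterior
   algebra is given by its coordinates on the basis e_I = e_i1 /\ ... /\ e_ia,
   I = {i1 < ... < ia}.  Vectors are rows, so a linear map is a matrix acting on
   the right. *)
Section ExteriorAlgebra.
Context {R : realType} {k : nat}.

Definition ext := {ffun {set 'I_k} -> R[i]}.

Definition shuffle_sign (I J : {set 'I_k}) : R[i] :=
  (-1) ^+ #|[set ij in finset.setX I J | (ij.2 < ij.1)%N]%SET|.

Definition wedge (x y : ext) : ext :=
  [ffun K : {set 'I_k} => \sum_(I : {set 'I_k} | I \subset K)
     shuffle_sign I (K :\: I)%SET * x I * y (K :\: I)%SET].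

Definition ext_base (I : {set 'I_k}) : ext :=
  [ffun K : {set 'I_k} => (K == I)%:R].

Definition ext_one : ext := ext_base finset.set0.

Definition ext_vol : ext := ext_base [set: 'I_k]%SET.

Definition ext_vec (v : 'rV[R[i]]_k) : ext :=
  [ffun K : {set 'I_k} => \sum_(j : 'I_k | K == [set j]%SET) v ord0 j].

(* The coordinate of e_I1 /\ ... /\ e_Im on e_J, for Is = [:: I1; ...; Im];
   also the coordinate of e_I1 (x) ... (x) e_Im in the signed sum over all
   ways of shuffling the factors of e_J. *)
Definition wedge_coef (Is : seq {set 'I_k}) (J : {set 'I_k}) : R[i] :=
  (\big[wedge/ext_one]_(I <- Is) ext_base I) J.

(* The algebra morphism extending v |-> v *m A. *)
Definition ext_map (A : 'M[R[i]]_k) (x : ext) : ext :=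
  [ffun K : {set 'I_k} => \sum_(I : {set 'I_k})
     x I * (\big[wedge/ext_one]_(i in I) ext_vec (row i A)) K].

Definition homogeneous (a : nat) (x : ext) : Prop :=
  forall I : {set 'I_k}, x I != 0 -> #|I| = a.

(* F_(0) = 1 is added to the steps F_(1), ..., F_(k); the values of F beyond k
   are irrelevant. *)
Record affine_flag (F : nat -> ext) : Prop := {
  aflag0 : F 0%N = ext_one;
  aflag_vol : F k = ext_vol;
  aflag_homog : forall i, (i <= k)%N -> homogeneous i (F i);
  aflag_step : forall i, (0 < i < k)%N ->
    exists v, wedge (F i) (ext_vec v) = F i.+1 }.

(* The index i, with i.+1 < k, stands for the simple transposition s_(i+1) of
   the one-based convention: it exchanges the zero-based positions i and i+1 and
   changes the step F_(i+1).  [simple_defined] says that u(v) - v is not in the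
   span of F_(i). *)

Definition simple_defined (u : 'M[R[i]]_k) (i : nat) (F : nat -> ext) : Prop :=
  forall v, wedge (F i.+1) (ext_vec v) = F i.+2 ->
    wedge (F i) (ext_vec (v *m u - v)) <> 0.

Definition simple_act (u : 'M[R[i]]_k) (i : nat) (F : nat -> ext) : nat -> ext :=
  let v := xget 0 [set v | wedge (F i.+1) (ext_vec v) = F i.+2] in
  fun j => if j == i.+1 then wedge (F i) (ext_vec (v *m u - v)) else F j.

(* The permutation whose one-line notation is obtained from that of the
   identity by swapping successively the positions given by the letters of s.
   Here (tperm i j * w) x = w (tperm i j x), and ordS i is i+1. *)
Definition word_perm (s : seq 'I_k) : 'S_k :=
  foldl (fun w i => tperm i (ordS i) * w)%g 1%g s.

Definition is_word_of (w : 'S_k) (s : seq 'I_k) : Prop :=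
  all (fun i : 'I_k => (i.+1 < k)%N) s /\ word_perm s = w.

Definition weyl_act (u : 'M[R[i]]_k) (w : 'S_k) (F : nat -> ext) : nat -> ext :=
  foldl (fun F' (i : 'I_k) => simple_act u i F') F
        (xget [::] [set s | is_word_of w s]).

Definition initial_set (a : nat) : {set 'I_k} := [set i : 'I_k | (i < a)%N]%SET.

(* (w . F)_(a) for a permutation w with w([a]) = A. *)
Definition tagged_step (u : 'M[R[i]]_k) (F : nat -> ext) (a : nat)
    (A : {set 'I_k}) : ext :=
  weyl_act u (xget 1%g [set w : 'S_k | (w @: initial_set a)%SET = A]) F a.

End ExteriorAlgebra.
Arguments ext R k : clear implicits.

Section Plane.
Context {R : realType}.

Definition half_plane : set 'rV[R]_2 := [set v | 0 <= v ord0 (lift ord0 ord0)].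

Definition rot (a : R) (v : 'rV[R]_2) : 'rV[R]_2 :=
  \row_j (if j == ord0
          then v ord0 ord0 * cos a - v ord0 (lift ord0 ord0) * sin a
          else v ord0 ord0 * sin a + v ord0 (lift ord0 ord0) * cos a).

Definition unit_itv : set R := [set t | 0 <= t <= 1].
Definition unit_square : set (R * R) := [set st | unit_itv st.1 /\ unit_itv st.2].

End Plane.

(* A compact connected oriented surface with boundary, given by an oriented C^1
   atlas with values in the half-plane; dtrans i j x is the differential at
   chart i x of the change of charts from i to j, acting on row vectors. *)
Record surface (R : realType) := Surface {
  pt :> topologicalType;
  chart_ix : Type;
  dom : chart_ix -> set pt;
  chart : chart_ix -> pt -> 'rV[R]_2;
  dtrans : chart_ix -> chart_ix -> pt -> 'M[R]_2;
  surf_compact : compact [set: pt];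
  surf_hausdorff : hausdorff_space pt;
  surf_connected : connected [set: pt];
  dom_open : forall i, open (dom i);
  dom_cover : forall x, exists i, dom i x;
  chart_continuous : forall i x, dom i x -> {for x, continuous (chart i)};
  chart_inj : forall i x y, dom i x -> dom i y -> chart i x = chart i y -> x = y;
  chart_open : forall i (A : set pt), open A -> A `<=` dom i ->
    exists2 B : set 'rV[R]_2, open B & chart i @` A = B `&` half_plane;
  dtrans_diff : forall i j x, dom i x -> dom j x -> forall e : R, 0 < e ->
    \forall y \near x,
      `|chart j y - chart j x - (chart i y - chart i x) *m dtrans i j x|
        <= e * `|chart i y - chart i x|;
  dtrans_continuous : forall i j x, dom i x -> dom j x ->
    {for x, continuous (dtrans i j)};
  dtrans_oriented : forall i j x, dom i x -> dom j x -> 0 < \det (dtrans i j x) }.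

Section Surface.
Context {R : realType} (S : surface R).

Definition bdry : set S :=
  [set x | exists2 i, dom i x & chart i x ord0 (lift ord0 ord0) = 0].

(* As S is compact, such an f is a homeomorphism onto K. *)
Definition homeomorphic_to (Y : topologicalType) (K : set Y) : Prop :=
  exists f : S -> Y, [/\ continuous f, injective f & range f = K].

Definition is_sphere : Prop :=
  homeomorphic_to [set v : 'rV[R]_3 | \sum_j v ord0 j ^+ 2 = 1].
Definition is_disc : Prop :=
  homeomorphic_to [set v : 'rV[R]_2 | \sum_j v ord0 j ^+ 2 <= 1].

(* A tangent vector at x is given by its coordinates in all charts around x;
   the other coordinates are irrelevant, hence the equality [same_vec]. *)
Definition frame := chart_ix S -> 'rV[R]_2.

Definition tangent (x : S) (d : frame) : Prop :=
  forall i j, dom i x -> dom j x -> d j = d i *m dtrans i j x.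

Definition nonzero_tangent (x : S) (d : frame) : Prop :=
  tangent x d /\ forall i, dom i x -> d i <> 0.

Definition same_vec (x : S) (d d' : frame) : Prop :=
  forall i, dom i x -> d i = d' i.

Definition inward (x : S) (d : frame) : Prop :=
  forall i, dom i x -> 0 < d i ord0 (lift ord0 ord0).

End Surface.
Arguments bdry {R} S.

Record marked_surface (R : realType) := MarkedSurface {
  surf :> surface R;
  marked : set surf;
  marked_finite : finite_set marked;
  marked_nonempty : marked !=set0;
  marked_bdry : forall x, bdry surf x ->
    exists2 p, marked p & connected_component (bdry surf) x p;
  not_small_sphere :
    ~ (is_sphere surf /\ exists p q, marked `<=` [set p; q]);
  not_small_disc :
    ~ (is_disc surf /\ marked `<=` bdry surf /\
       exists p q, marked `<=` [set p; q]);
  not_punctured_monogon :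
    ~ (is_disc surf /\ exists p q,
         marked `\` bdry surf = [set p] /\ marked `&` bdry surf = [set q]) }.
Arguments marked {R} _ _.

Section LocalSystem.
Context {R : realType} (S : marked_surface R).

Definition puncture : set S := marked S `\` bdry S.
Definition marked_boundary : set S := marked S `&` bdry S.

(* A continuous family, indexed by s in [0, 1], of paths t |-> (G s t, W s t)
   in the punctured tangent bundle of S minus the punctures.  A path may issue
   from a puncture p: then W s 0 is a tangent vector at p, and the path has to
   leave p in the direction W s 0, uniformly in s, i.e. the family is continuous
   as a family of paths issuing from the circle of directions at p.  (Merely
   continuous families would allow a path to be unwound around p.) *)
Definition framed_family (G : R -> R -> S) (W : R -> R -> frame S) : Prop :=
  [/\ {within unit_square, continuous (fun st : R * R => G st.1 st.2)},
      (forall s t, unit_itv s -> unit_itv t -> nonzero_tangent (G s t) (W s t)),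
      (forall i, {within [set st | unit_square st /\ dom i (G st.1 st.2)],
                  continuous (fun st : R * R => W st.1 st.2 i)}),
      (forall s t, unit_itv s -> unit_itv t -> 0 < t -> ~ puncture (G s t)) &
      (forall s, unit_itv s -> ~ puncture (G s 0)) \/
      (exists2 p, puncture p &
         (forall s, unit_itv s -> G s 0 = p) /\
         forall i, dom i p -> forall e : R, 0 < e ->
           exists2 r : R, 0 < r & forall s t, unit_itv s -> 0 < t < r ->
             t <= 1 -> exists2 c : R, 0 < c &
               `|chart i (G s t) - chart i p - c *: W s 0 i| <= e * c)].

Definition framed_path (g : R -> S) (w : R -> frame S) : Prop :=
  framed_family (fun _ => g) (fun _ => w).

(* Directions in which a path can issue from the marked point p. *)
Definition pointing (p : S) (d : frame S) : Prop :=
  nonzero_tangent p d /\ (bdry S p -> inward p d).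

(* Polar coordinates (s, t) on a disc centred at the puncture p, s being the
   angle: s |-> G s 1 is a simple counterclockwise loop, contractible to p. *)
Definition polar_disc (p : S) (G : R -> R -> S) (W : R -> R -> frame S) : Prop :=
  [/\ framed_family G W,
      (forall s, unit_itv s -> G s 0 = p),
      (forall t, unit_itv t -> G 1 t = G 0 t /\ same_vec (G 0 t) (W 1 t) (W 0 t)),
      (forall s t s' t', 0 <= s < 1 -> 0 < t <= 1 -> 0 <= s' < 1 -> 0 < t' <= 1 ->
         G s t = G s' t' -> s = s' /\ t = t') &
      exists2 i, dom i p &
        forall s, unit_itv s -> W s 0 i = rot (2 * pi * s) (W 0 0 i)].

(* [AFlags] is A_(SL_k, S); [AVectors] is A'_(SL_k, S). *)
Inductive flavour := AFlags | AVectors.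

Definition flagged (K : flavour) (p : S) : Prop :=
  puncture p \/ (K = AFlags /\ marked_boundary p).

(* The fibre over each point of the punctured tangent bundle is a copy of V.
   For k even the local system is twisted; for k odd the sign in [hol_fibre] is
   1, so that the local system comes from S.  The fibre at a puncture p depends
   on a direction d at p, and [mono p d] is the monodromy u_p in this fibre;
   similarly the decoration at a marked point p is a flat section over the
   directions pointing at p. *)
Record moduli_point (K : flavour) (k : nat) := ModuliPoint {
  hol : (R -> S) -> (R -> frame S) -> 'M[R[i]]_k;
  hol_SL : forall g w, framed_path g w -> \det (hol g w) = 1;
  hol_cat : forall g w g' w' h x,
    framed_path g w -> framed_path g' w' -> framed_path h x ->
    (forall t, unit_itv t ->
       h (t / 2) = g t /\ same_vec (g t) (x (t / 2)) (w t)) ->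
    (forall t, unit_itv t ->
       h ((1 + t) / 2) = g' t /\ same_vec (g' t) (x ((1 + t) / 2)) (w' t)) ->
    hol h x = hol g w *m hol g' w';
  hol_homotopy : forall G W, framed_family G W ->
    (forall s, unit_itv s ->
       [/\ G s 0 = G 0 0, same_vec (G 0 0) (W s 0) (W 0 0),
           G s 1 = G 0 1 & same_vec (G 0 1) (W s 1) (W 0 1)]) ->
    hol (G 0) (W 0) = hol (G 1) (W 1);
  hol_fibre : forall (x : S) (w : R -> frame S) i,
    framed_path (fun _ => x) w -> dom i x ->
    (forall t, unit_itv t -> w t i = rot (2 * pi * t) (w 0 i)) ->
    hol (fun _ => x) w = ((-1) ^+ k.-1)%:M;
  mono : S -> frame S -> 'M[R[i]]_k;
  mono_loop : forall p G W, puncture p -> polar_disc p G W ->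
    mono p (W 0 0) *m hol (G 0) (W 0) =
    hol (G 0) (W 0) *m hol (fun s => G s 1) (fun s => W s 1);
  flag : S -> frame S -> nat -> ext R k;
  flag_affine : forall p d, flagged K p -> pointing p d -> affine_flag (flag p d);
  flag_flat : forall p G W, flagged K p -> framed_family G W ->
    (forall s, unit_itv s -> G s 0 = p /\ pointing p (W s 0)) ->
    forall i, (i <= k)%N ->
      ext_map (hol (G 0) (W 0) *m hol (fun s => G s 1) (fun s => W s 1))
              (flag p (W 0 0) i) =
      ext_map (hol (G 1) (W 1)) (flag p (W 1 0) i);
  mono_stab : forall p d, puncture p -> pointing p d ->
    forall i, (i <= k)%N -> ext_map (mono p d) (flag p d i) = flag p d i;
  vect : S -> frame S -> 'rV[R[i]]_k;
  vect_flat : forall p G W, K = AVectors -> marked_boundary p ->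
    framed_family G W ->
    (forall s, unit_itv s -> G s 0 = p /\ pointing p (W s 0)) ->
    vect p (W 0 0) *m (hol (G 0) (W 0) *m hol (fun s => G s 1) (fun s => W s 1)) =
    vect p (W 1 0) *m hol (G 1) (W 1) }.

(* The locus where the Weyl group acts on the flags at all punctures; on it all
   (pseudo)tagged diagram invariants are defined. *)
Definition generic (K : flavour) (k : nat) (z : moduli_point K k) : Prop :=
  forall p d, puncture p -> pointing p d ->
    forall i, (i.+1 < k)%N -> simple_defined (mono z p d) i (flag z p d).

End LocalSystem.

Inductive vertex_kind := Marked | White | Black | Coevaluation | Evaluation.

Section Diagrams.
Context {R : realType} (S : marked_surface R) (K : flavour) (k : nat).

(* [curve e] is a C^1 immersed curve with velocity [vel e].  [ins v] and
   [outs v] list the edges at v in the order of the tensor factors, and [tlift e]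
   is a lift of [curve e] to the punctured tangent bundle, joining the tangent
   vectors [ref v] chosen at the unmarked vertices.  Both only matter for signs. *)
Record diagram := Diagram {
  vertex : finType;
  edge : finType;
  src : edge -> vertex;
  tgt : edge -> vertex;
  wt : edge -> nat;
  kind : vertex -> vertex_kind;
  ins : vertex -> seq edge;
  outs : vertex -> seq edge;
  pos : vertex -> S;
  curve : edge -> R -> S;
  vel : edge -> R -> frame S;
  ref : vertex -> frame S;
  tlift : edge -> R -> frame S;
  acyclic : forall e, ~~ connect
    (fun v v' => [exists f, (src f == v) && (tgt f == v')]) (tgt e) (src e);
  ins_uniq : forall v, uniq (ins v);
  mem_ins : forall v e, (e \in ins v) = (tgt e == v);
  outs_uniq : forall v, uniq (outs v);
  mem_outs : forall v e, (e \in outs v) = (src e == v);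
  wt_range : forall e, (0 < wt e <= k)%N;
  wt_boundary : forall e, K = AVectors -> marked_boundary (pos (src e)) ->
    wt e = 1%N;
  vertex_rule : forall v, match kind v with
    | Marked => ins v = [::]
    | White => exists2 f, outs v = [:: f] & wt f = (\sum_(e <- ins v) wt e)%N
    | Black => exists2 f, ins v = [:: f] & wt f = (\sum_(e <- outs v) wt e)%N
    | Coevaluation => ins v = [::] /\ exists2 f, outs v = [:: f] & wt f = k
    | Evaluation => outs v = [::] /\ exists2 f, ins v = [:: f] & wt f = k
    end;
  pos_inj : injective pos;
  pos_marked : forall v, kind v = Marked -> marked S (pos v);
  pos_unmarked : forall v, kind v <> Marked ->
    ~ bdry S (pos v) /\ ~ marked S (pos v);
  marked_vertex : forall p, marked S p -> exists2 v, kind v = Marked & pos v = p;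
  curve_src : forall e, curve e 0 = pos (src e);
  curve_tgt : forall e, curve e 1 = pos (tgt e);
  curve_interior : forall e (t : R), 0 < t < 1 ->
    ~ bdry S (curve e t) /\ forall v, curve e t <> pos v;
  curve_continuous : forall e, {within unit_itv, continuous (curve e)};
  curve_immersed : forall e t, unit_itv t -> nonzero_tangent (curve e t) (vel e t);
  curve_vel : forall e t i, unit_itv t -> dom i (curve e t) ->
    forall eps : R, 0 < eps -> exists2 r : R, 0 < r & forall t', unit_itv t' ->
      `|t' - t| < r ->
      `|chart i (curve e t') - chart i (curve e t) - (t' - t) *: vel e t i|
        <= eps * `|t' - t|;
  vel_continuous : forall e i,
    {within [set t | unit_itv t /\ dom i (curve e t)],
     continuous (fun t => vel e t i)};
  crossing := fun q : (edge * R) * (edge * R) =>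
    [/\ 0 < q.1.2 < 1, 0 < q.2.2 < 1, q.1 <> q.2 &
        curve q.1.1 q.1.2 = curve q.2.1 q.2.2];
  crossing_finite : finite_set [set q | crossing q];
  crossing_transverse : forall q, crossing q ->
    forall i, dom i (curve q.1.1 q.1.2) ->
      row_free (col_mx (vel q.1.1 q.1.2 i) (vel q.2.1 q.2.2 i));
  crossing_double : forall a b c, crossing (a, b) -> crossing (a, c) -> b = c;
  lift_framed : forall e, framed_path (curve e) (tlift e);
  lift_src : forall e, kind (src e) <> Marked ->
    same_vec (curve e 0) (tlift e 0) (ref (src e));
  lift_marked : forall e, kind (src e) = Marked ->
    pointing (curve e 0) (tlift e 0);
  lift_tgt : forall e, same_vec (curve e 1) (tlift e 1) (ref (tgt e)) }.

Definition leg (T : diagram) (e : edge T) : Prop := puncture (pos (src e)).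

(* The subsets of [k] attached to edges which are not legs are irrelevant. *)
Definition pseudotagging (T : diagram) (phi : edge T -> {set 'I_k}) : Prop :=
  forall e, leg e -> #|phi e| = wt e.

Definition tagging (T : diagram) (phi : edge T -> {set 'I_k}) : Prop :=
  pseudotagging phi /\
  forall e e', leg e -> leg e' -> src e = src e' ->
    (phi e \subset phi e') || (phi e' \subset phi e).

Section Invariant.
Context (T : diagram) (phi : edge T -> {set 'I_k}) (z : moduli_point S K k).

(* The tensor assigned to an edge e issuing from a marked point. *)
Definition source_tensor (e : edge T) : ext R k :=
  let p := pos (src e) in
  let d := tlift e 0 in
  if `[< puncture p >] then
    tagged_step (mono z p d) (flag z p d) (wt e) (phi e)
  else match K with
       | AFlags => flag z p d (wt e)
       | AVectors => ext_vec (vect z p d)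
       end.

(* The composition of the maps at vertices and edges is computed in the basis
   (e_I): a state assigns a basis tensor to both ends of each edge. *)
Definition state := {ffun edge T -> {set 'I_k} * {set 'I_k}}.

Definition state_ok (sigma : state) : bool :=
  [forall e, (#|(sigma e).1| == wt e) && (#|(sigma e).2| == wt e)].

Definition edge_weight (sigma : state) (e : edge T) : R[i] :=
  ext_map (hol z (curve e) (tlift e)) (ext_base (sigma e).1) (sigma e).2.

Definition vertex_weight (sigma : state) (v : vertex T) : R[i] :=
  match kind v with
  | Marked => \prod_(e <- outs v) source_tensor e (sigma e).1
  | White => \prod_(f <- outs v)
               wedge_coef [seq (sigma e).2 | e <- ins v] (sigma f).1
  | Black => \prod_(f <- ins v)
               wedge_coef [seq (sigma e).1 | e <- outs v] (sigma f).2
  | Coevaluation => \prod_(f <- outs v) ext_vol (sigma f).1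
  | Evaluation => \prod_(f <- ins v) ext_vol (sigma f).2
  end.

Definition diagram_invariant : R[i] :=
  \sum_(sigma : state | state_ok sigma)
    (\prod_e edge_weight sigma e) * \prod_v vertex_weight sigma v.

End Invariant.
End Diagrams.

(* Main.v *)
(* Let e and e' be legs at a puncture whose tags A and B are incomparable, with
   #|A| <= #|B|, and let i be in A but not in B.  In a basis adapted to a flag
   fixed by a regular unipotent u, the tensor tagged A is a multiple of the plain
   step #|A| of the flag, and passing from (A, B) to (A - i, B + i) multiplies
   the tensors by superdiagonal entries of u.  On diagrams, detach a vector from
   the leg tagged B + i and wedge it with the leg tagged A - i, after applying
   (u - 1)^n with n = #|B| + 1 - #|A|: only the leading term of the vector
   survives the wedge product, and it acquires exactly the missing entries of u.
   Expanding (u - 1)^n by the binomial formula, the j-th term is the invariant of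
   an honest diagram, in which the edge (the hook) carrying the vector from e' to
   e winds j times around the puncture.  As u is unipotent, (u - 1)^n may be
   multiplied by a power of u: the hook may wind N0 + j times, with N0 so large
   that it is transverse to all the legs.  The sum of w (k - w) over the weights w
   of the legs decreases at each step, so the process ends with tagged diagrams.

   Homotopies near a puncture are computed in polar coordinates: a path is lifted
   to the half-plane of the (r, theta), where the parallel transport depends only
   on the endpoints, and the monodromy becomes the translation of theta by
   2 * pi. *)

Require Import Defs.
From HB Require Import structures.
From mathcomp Require Import all_classical all_reals all_analysis.
From mathcomp Require Import all_boot all_order all_algebra all_fingroup.
From mathcomp Require Import complex.
From mathcomp Require Import ring lra zify.

Set Implicit Arguments.
Unset Strict Implicit.
Unset Printing Implicit Defensive.

Import Order.TTheory GRing.Theory Num.Theory numFieldNormedType.Exports.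

Local Open Scope ring_scope.

(** * The exterior algebra *)

(** The two legs carry their flags in different fibres, one for each direction at the puncture, with
    two different monodromy matrices. They are compared in the fibre at one regular point near the
    puncture: there both flags become the same flag and both monodromies the same unipotent matrix,
    whose superdiagonal entries do not depend on the adapted basis. The hook starts on e', ends on e
    nearer to the puncture, and is a segment in the half-plane of the (r, theta). Its radius
    decreases strictly, so it is embedded, and additional turns only change its slope. Near the
    puncture the legs make an angle of less than 45 degrees with the radius, while a hook with
    enough turns makes an angle of more than 45 degrees with it: hence transversality, finitely many
    crossings, and no triple points, the legs having no crossings there. The exponent n = #|B| + 1 -
    #|A| is the number of basis vectors by which the detached vector has to descend, from the one
    completing the step #|B| to the one completing the step #|A| - 1. The lighter leg has to lose
    the element: then n is positive and the sum of w (k - w) drops. *)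

Section WedgeAlgebra.
Context {R : realType} {k : nat}.
Implicit Types (I J K : {set 'I_k}) (x y z : ext R k) (v w : 'rV[R[i]]_k).

(** As a product over pairs, the sign is multiplicative in each argument over disjoint unions. The
    sign identities below rest on this and on the case of two singletons. *)
Lemma shuffle_signE I J : shuffle_sign I J =
  \prod_(i in I) \prod_(j in J) (if (j < i)%N then -1 else 1) :> R[i].
Proof.
rewrite /shuffle_sign -prodr_const big_mkcond /= pair_big /= big_mkcond /=.
rewrite (big_mkcond (fun p : 'I_k * 'I_k => _ && _)) /=.
apply: eq_bigr => -[i j] _ /=; rewrite !inE /=.
by case: (i \in I); case: (j \in J) => //=; case: (j < i)%N.
Qed.

Lemma shuffle_sign0l I : shuffle_sign set0 I = 1 :> R[i].
Proof. by rewrite shuffle_signE big_set0. Qed.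

Lemma shuffle_sign0r I : shuffle_sign I set0 = 1 :> R[i].
Proof. by rewrite shuffle_signE big1 // => i _; rewrite big_set0. Qed.

Lemma shuffle_signUl I J K : [disjoint I & J] ->
  shuffle_sign (I :|: J) K = shuffle_sign I K * shuffle_sign J K :> R[i].
Proof. by move=> dIJ; rewrite !shuffle_signE -bigU //=; apply: eq_bigl => i; rewrite !inE. Qed.

Lemma shuffle_signUr I J K : [disjoint I & J] ->
  shuffle_sign K (I :|: J) = shuffle_sign K I * shuffle_sign K J :> R[i].
Proof.
move=> dIJ; rewrite !shuffle_signE -big_split /=; apply: eq_bigr => i _.
by rewrite -bigU //=; apply: eq_bigl => j; rewrite !inE.
Qed.

Lemma shuffle_sign11 (i j : 'I_k) :
  shuffle_sign [set i]%SET [set j]%SET = (if (j < i)%N then -1 else 1) :> R[i].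
Proof. by rewrite shuffle_signE !big_set1. Qed.

Lemma shuffle_sign_sqr I J : shuffle_sign I J * shuffle_sign I J = 1 :> R[i].
Proof. by rewrite /shuffle_sign -expr2 sqrr_sign. Qed.

(** The structure constants of the exterior algebra in the basis e_I. With them the product is a
    free double sum, and associativity becomes an exchange of sums. *)
Definition wedge_struct I J K : R[i] :=
  if [disjoint I & J] && (I :|: J == K) then shuffle_sign I J else 0.

Lemma wedgeE x y K :
  wedge x y K = \sum_I \sum_J wedge_struct I J K * x I * y J.
Proof.
rewrite ffunE big_mkcond /=; apply: eq_bigr => I _.
case: ifPn => sIK; last first.
  rewrite big1 // => J _; rewrite /wedge_struct; case: ifPn; rewrite ?mul0r//.
  by case/andP => _ /eqP eK; rewrite -eK subsetUl in sIK.
rewrite (bigD1 (K :\: I)%SET) //= big1 ?addr0.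
  rewrite /wedge_struct ifT //; apply/andP; split.
    by rewrite disjoint_sym disjoints_subset; apply/subsetP => j; rewrite !inE => /andP[].
  by apply/eqP/setP => j; rewrite !inE; case: (boolP (j \in I)) => //= /(subsetP sIK).
move=> J nJ; rewrite /wedge_struct; case: ifPn; rewrite ?mul0r // => /andP[dIJ /eqP eK].
case/negP: nJ; apply/eqP/setP => j; rewrite -eK !inE.
case: (boolP (j \in I)) => //= jI.
by apply/negbTE; rewrite (disjointFr dIJ).
Qed.

(** On each side a single [M] survives, [I :|: J] or [J :|: L], and the two products of signs agree
    by multiplicativity. *)
Lemma wedge_structA I J L K :
  \sum_M wedge_struct I J M * wedge_struct M L K =
  \sum_M wedge_struct J L M * wedge_struct I M K.
Proof.
rewrite (bigD1 (I :|: J)%SET) //= big1 ?addr0; last first.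
  move=> M nM; rewrite {1}/wedge_struct eq_sym (negbTE nM) andbF mul0r//.
rewrite (bigD1 (J :|: L)%SET) //= big1 ?addr0; last first.
  move=> M nM; rewrite {1}/wedge_struct eq_sym (negbTE nM) andbF mul0r//.
have dU (A B C : {set 'I_k}) : [disjoint A :|: B & C] = [disjoint A & C] && [disjoint B & C].
  by rewrite -!setI_eq0 setIUl setU_eq0.
rewrite /wedge_struct !eqxx !andbT dU setUA [X in _ = _ * (if X && _ then _ else _)]disjoint_sym dU.
rewrite ![[disjoint _ & I]]disjoint_sym.
case: (boolP [disjoint I & J]) => dIJ; case: (boolP [disjoint J & L]) => dJL;
  case: (boolP [disjoint I & L]) => dIL; rewrite /= ?mul0r ?mulr0 //.
  case: eqP => _; rewrite ?mulr0 //.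
  by rewrite shuffle_signUl // shuffle_signUr //; ring.
Qed.

Definition ext_scale (a : R[i]) x : ext R k := [ffun K => a * x K].

Lemma ext_scaleE a x K : ext_scale a x K = a * x K.
Proof. by rewrite ffunE. Qed.

Lemma ext_scale_scale a b x : ext_scale a (ext_scale b x) = ext_scale (a * b) x.
Proof. by apply/ffunP => K; rewrite !ffunE mulrA. Qed.

Lemma ext_scale1 x : ext_scale 1 x = x.
Proof. by apply/ffunP => K; rewrite !ffunE mul1r. Qed.

Lemma ext_scale0 x : ext_scale 0 x = 0.
Proof. by apply/ffunP => K; rewrite !ffunE mul0r. Qed.

Lemma ext_scaler0 a : ext_scale a 0 = 0.
Proof. by apply/ffunP => K; rewrite !ffunE mulr0. Qed.

Lemma ext_scaleDl a b x : ext_scale (a + b) x = ext_scale a x + ext_scale b x.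
Proof. by apply/ffunP => K; rewrite !ffunE mulrDl. Qed.

Lemma wedgeDl x y z : wedge (x + y) z = wedge x z + wedge y z.
Proof.
apply/ffunP => K; rewrite [RHS]ffunE !wedgeE -big_split /=; apply: eq_bigr => I _.
by rewrite -big_split /=; apply: eq_bigr => J _; rewrite ffunE; ring.
Qed.

Lemma wedgeDr x y z : wedge x (y + z) = wedge x y + wedge x z.
Proof.
apply/ffunP => K; rewrite [RHS]ffunE !wedgeE -big_split /=; apply: eq_bigr => I _.
by rewrite -big_split /=; apply: eq_bigr => J _; rewrite ffunE; ring.
Qed.

Lemma wedgeZl a x y : wedge (ext_scale a x) y = ext_scale a (wedge x y).
Proof.
apply/ffunP => K; rewrite [RHS]ffunE !wedgeE big_distrr /=; apply: eq_bigr => I _.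
by rewrite big_distrr /=; apply: eq_bigr => J _; rewrite ffunE; ring.
Qed.

Lemma wedgeZr a x y : wedge x (ext_scale a y) = ext_scale a (wedge x y).
Proof.
apply/ffunP => K; rewrite [RHS]ffunE !wedgeE big_distrr /=; apply: eq_bigr => I _.
by rewrite big_distrr /=; apply: eq_bigr => J _; rewrite ffunE; ring.
Qed.

Lemma wedge0l x : wedge 0 x = 0.
Proof. by have := wedgeZl 0 0 x; rewrite !ext_scale0. Qed.

Lemma wedge0r x : wedge x 0 = 0.
Proof. by have := wedgeZr 0 x 0; rewrite !ext_scale0. Qed.

Lemma wedge_suml (T : Type) (r : seq T) (P : pred T) (f : T -> ext R k) y :
  wedge (\sum_(t <- r | P t) f t) y = \sum_(t <- r | P t) wedge (f t) y.
Proof. exact: (big_morph (wedge^~ y) (fun a b => wedgeDl a b y) (wedge0l y)). Qed.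

Lemma wedge_sumr (T : Type) (r : seq T) (P : pred T) (f : T -> ext R k) y :
  wedge y (\sum_(t <- r | P t) f t) = \sum_(t <- r | P t) wedge y (f t).
Proof. exact: (big_morph (wedge y) (wedgeDr y) (wedge0r y)). Qed.

Lemma wedgeA : associative (@wedge R k).
Proof.
move=> x y z; apply/ffunP => K; rewrite !wedgeE.
transitivity (\sum_I \sum_J \sum_L
    (x I * y J * z L) * \sum_M wedge_struct J L M * wedge_struct I M K).
  apply: eq_bigr => I _.
  transitivity (\sum_M \sum_J \sum_L
      (x I * y J * z L) * (wedge_struct J L M * wedge_struct I M K)).
    apply: eq_bigr => M _; rewrite wedgeE big_distrr /=; apply: eq_bigr => J _.
    by rewrite big_distrr /=; apply: eq_bigr => L _; ring.
  rewrite exchange_big /=; apply: eq_bigr => J _.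
  rewrite exchange_big /=; apply: eq_bigr => L _.
  by rewrite big_distrr.
transitivity (\sum_M \sum_L \sum_I \sum_J
    (x I * y J * z L) * (wedge_struct I J M * wedge_struct M L K)); last first.
  apply: eq_bigr => M _; apply: eq_bigr => L _.
  rewrite wedgeE mulrAC big_distrr /=; apply: eq_bigr => I _.
  by rewrite big_distrr /=; apply: eq_bigr => J _; ring.
transitivity (\sum_L \sum_I \sum_J \sum_M
    (x I * y J * z L) * (wedge_struct I J M * wedge_struct M L K)).
  transitivity (\sum_I \sum_L \sum_J \sum_M
      (x I * y J * z L) * (wedge_struct I J M * wedge_struct M L K)).
    apply: eq_bigr => I _; rewrite [RHS]exchange_big /=; apply: eq_bigr => J _.
    apply: eq_bigr => L _; rewrite -[RHS]big_distrr /= wedge_structA //.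
  by rewrite exchange_big.
rewrite [RHS]exchange_big /=; apply: eq_bigr => L _.
rewrite [RHS]exchange_big /=; apply: eq_bigr => I _.
by rewrite [RHS]exchange_big.
Qed.

Lemma wedge_base I J K :
  wedge (ext_base I) (ext_base J) K = wedge_struct I J K.
Proof.
rewrite wedgeE (bigD1 I) //= (bigD1 J) //= !ffunE !eqxx !mulr1 big1 ?addr0.
  rewrite big1 ?addr0 // => L nL; rewrite big1 // => M _.
  by rewrite !ffunE (negbTE nL) mulr0 mul0r.
by move=> L nL; rewrite !ffunE (negbTE nL) mulr0.
Qed.

Lemma ext_sum_base x : x = \sum_I ext_scale (x I) (ext_base I).
Proof.
apply/ffunP => K; rewrite sum_ffunE (bigD1 K) //= !ffunE eqxx mulr1 big1 ?addr0 //.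
by move=> I nI; rewrite !ffunE eq_sym (negbTE nI) mulr0.
Qed.

Lemma wedge1x : left_id (ext_one : ext R k) wedge.
Proof.
move=> x; rewrite [x in LHS]ext_sum_base wedge_sumr [RHS]ext_sum_base.
apply: eq_bigr => I _; rewrite wedgeZr; congr ext_scale; apply/ffunP => K.
rewrite wedge_base /wedge_struct set0U ffunE -setI_eq0 set0I eqxx /= eq_sym.
by rewrite shuffle_sign0l; case: eqP.
Qed.

Lemma wedgex1 : right_id (ext_one : ext R k) wedge.
Proof.
move=> x; rewrite [x in LHS]ext_sum_base wedge_suml [RHS]ext_sum_base.
apply: eq_bigr => I _; rewrite wedgeZl; congr ext_scale; apply/ffunP => K.
rewrite wedge_base /wedge_struct setU0 ffunE -setI_eq0 setI0 eqxx /= eq_sym.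
by rewrite shuffle_sign0r; case: eqP.
Qed.

HB.instance Definition _ := Monoid.isLaw.Build (ext R k) ext_one wedge wedgeA wedge1x wedgex1.

Lemma ext_vecE v K : ext_vec v K = \sum_j v ord0 j * (K == [set j])%:R.
Proof.
rewrite ffunE big_mkcond /=; apply: eq_bigr => j _.
by case: eqP => _; rewrite ?mulr1 ?mulr0.
Qed.

Lemma ext_vec_sum v : ext_vec v = \sum_j ext_scale (v ord0 j) (ext_base [set j]).
Proof.
apply/ffunP => K; rewrite ext_vecE sum_ffunE; apply: eq_bigr => j _.
by rewrite !ffunE.
Qed.

Lemma ext_vecD v w : ext_vec (v + w) = ext_vec v + ext_vec w.
Proof.
apply/ffunP => K; rewrite [RHS]ffunE !ext_vecE -big_split /=.
by apply: eq_bigr => j _; rewrite mxE mulrDl.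
Qed.

Lemma ext_vecZ a v : ext_vec (a *: v) = ext_scale a (ext_vec v).
Proof.
apply/ffunP => K; rewrite ext_scaleE !ext_vecE big_distrr /=.
by apply: eq_bigr => j _; rewrite mxE mulrA.
Qed.

Lemma ext_vec0 : ext_vec 0 = 0 :> ext R k.
Proof. by have := ext_vecZ 0 0; rewrite scale0r ext_scale0. Qed.

Lemma ext_vec_delta j : ext_vec (delta_mx ord0 j) = ext_base [set j] :> ext R k.
Proof.
rewrite ext_vec_sum (bigD1 j) //= mxE !eqxx ext_scale1 big1 ?addr0 // => l nl.
by rewrite mxE eqxx (negbTE nl) ext_scale0.
Qed.

Lemma wedge_vec_baseC (i j : 'I_k) :
  wedge (ext_base [set i]) (ext_base [set j]) =
  ext_scale (-1) (wedge (ext_base [set j]) (ext_base [set i])) :> ext R k.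
Proof.
apply/ffunP => K; rewrite ext_scaleE !wedge_base /wedge_struct !shuffle_sign11.
rewrite setUC -!setI_eq0 setIC; case: ifP => [/andP[d _]|_]; last by rewrite mulr0.
have : i != j by apply: contraTneq d => ->; rewrite setIid -cards_eq0 cards1.
by rewrite -val_eqE /=; case: ltngtP => // _ _; rewrite ?mulr1 ?mulrNN ?mulr1.
Qed.

Lemma wedge_vecC v w :
  wedge (ext_vec v) (ext_vec w) = ext_scale (-1) (wedge (ext_vec w) (ext_vec v)).
Proof.
rewrite !ext_vec_sum !wedge_suml.
transitivity (\sum_i \sum_j ext_scale (v ord0 i * w ord0 j)
   (wedge (ext_base [set i]) (ext_base [set j])) : ext R k).
  apply: eq_bigr => i _; rewrite wedge_sumr; apply: eq_bigr => j _.
  by rewrite wedgeZl wedgeZr ext_scale_scale.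
rewrite exchange_big /=.
rewrite (big_morph (ext_scale (-1)) (id1 := 0) (op1 := +%R)); last 2 first.
- by move=> a b; apply/ffunP => K; rewrite !ffunE mulrDr.
- exact: ext_scaler0.
apply: eq_bigr => i _; rewrite wedge_sumr.
rewrite (big_morph (ext_scale (-1)) (id1 := 0) (op1 := +%R)); last 2 first.
- by move=> a b; apply/ffunP => K; rewrite !ffunE mulrDr.
- exact: ext_scaler0.
apply: eq_bigr => j _; rewrite wedgeZl wedgeZr wedge_vec_baseC !ext_scale_scale.
by congr ext_scale; ring.
Qed.

Lemma wedge_vecv v : wedge (ext_vec v) (ext_vec v) = 0.
Proof.
apply/ffunP => K; suff a0 : wedge (ext_vec v) (ext_vec v) K = 0 by rewrite a0 ffunE.
(* Antisymmetry makes the coordinate equal to its opposite, and the characteristic is 0. *)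
have /ffunP/(_ K) := wedge_vecC v v; rewrite ext_scaleE mulN1r.
by move/eqP; rewrite -subr_eq0 opprK -mulr2n mulrn_eq0 /= => /eqP.
Qed.

Lemma wedge_vecA v w x :
  wedge (wedge x (ext_vec v)) (ext_vec w) =
  ext_scale (-1) (wedge (wedge x (ext_vec w)) (ext_vec v)).
Proof. by rewrite -!wedgeA wedge_vecC wedgeZr. Qed.

Lemma wedge_vecE x v K :
  wedge x (ext_vec v) K =
  \sum_(s in K) shuffle_sign (K :\ s) [set s] * x (K :\ s) * v ord0 s.
Proof.
rewrite ext_vec_sum wedge_sumr sum_ffunE [RHS]big_mkcond /=; apply: eq_bigr => s _.
rewrite wedgeZr ext_scaleE wedgeE.
under eq_bigr => I _.
  rewrite (bigD1 [set s]) //= ffunE eqxx mulr1 big1 ?addr0; last first.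
    by move=> J nJ; rewrite ffunE (negbTE nJ) mulr0.
  over.
case: ifPn => sK.
  rewrite (bigD1 (K :\ s)) //= big1 ?addr0.
    rewrite /wedge_struct ifT; first by ring.
    apply/andP; split; first by rewrite disjoint_sym disjoints1 !inE eqxx.
    by rewrite setUC setD1K.
  move=> I nI; rewrite /wedge_struct ifF ?mul0r //; apply/negbTE; apply: contra nI.
  move=> /andP[]; rewrite disjoint_sym disjoints1 => sI /eqP <-.
  by apply/eqP; rewrite setUC setU1K.
rewrite big1 ?mulr0 // => I _; rewrite /wedge_struct ifF ?mul0r //.
apply/negbTE; apply: contra sK => /andP[_ /eqP <-].
by rewrite !inE eqxx orbT.
Qed.

(** The exterior product is not commutative, so a big product over ['I_k] depends on the order of
    enumeration. This order is increasing, hence [m] separates the smaller indices from the larger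
    ones. *)
Lemma ord_split (m : 'I_k) : exists l1 l2, [/\ index_enum 'I_k = l1 ++ m :: l2,
  m \notin l1, m \notin l2, all (fun i : 'I_k => i < m)%N l1 & all (fun i : 'I_k => m < i)%N l2].
Proof.
have mi : m \in index_enum 'I_k by rewrite mem_index_enum.
have srt : sorted ltn (map val (index_enum 'I_k)).
  by rewrite [index_enum _]unlock -enumT (val_enum_ord k); exact: iota_ltn_sorted.
have unq : uniq (index_enum 'I_k) by exact: index_enum_uniq.
case/splitPr: mi srt unq => l1 l2; rewrite map_cat /= => srt.
rewrite cat_uniq /= => /and3P[_ n1 /andP[n2 _]].
have srt1 : sorted ltn (val m :: map val l2) := (cat_sorted2 srt).2.
have ltt : transitive ltn := @ltn_trans.
exists l1, l2; split => //.
- by apply: contra n1 => ml1; rewrite ml1.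
- move: srt; rewrite -cat_rcons => /cat_sorted2[+ _].
  rewrite -rev_sorted rev_rcons /= (path_sortedE (rev_trans ltt)) => /andP[+ _].
  rewrite all_rev all_map; apply: sub_all => i /=; by [].
- by move: srt1; rewrite /= (path_sortedE ltt) all_map => /andP[].
Qed.

(** * Ordered exterior products of vectors *)

Section BigWedge.
Variable f : 'I_k -> 'rV[R[i]]_k.
Let Y I : ext R k := \big[wedge/ext_one]_(i in I) ext_vec (f i).

(** Only an extreme factor can be split off an ordered product; the indices enumerated after [m] are
    outside [I]. *)
Lemma bigwedge_max I m : m \in I -> (forall i, i \in I -> (i <= m)%N) ->
  Y I = wedge (Y (I :\ m)) (ext_vec (f m)).
Proof.
move=> mI maxm; rewrite /Y; have [l1 [l2 [-> n1 n2 a1 a2]]] := ord_split m.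
rewrite !big_cat /= !big_cons mI !inE eqxx /=.
have e2 : \big[wedge/ext_one]_(j <- l2 | j \in I) ext_vec (f j) = ext_one :> ext R k.
  rewrite big_seq_cond big_pred0 // => j; apply/negbTE/andP => -[jl /maxm].
  by rewrite leqNgt (allP a2 _ jl).
have e2' : \big[wedge/ext_one]_(j <- l2 | j \in I :\ m) ext_vec (f j) = ext_one :> ext R k.
  rewrite big_seq_cond big_pred0 // => j; apply/negbTE/andP => -[jl].
  rewrite !inE => /andP[_ /maxm].
  by rewrite leqNgt (allP a2 _ jl).
rewrite e2 e2' !wedgex1; congr wedge.
rewrite big_seq_cond [RHS]big_seq_cond; apply: eq_bigl => j; rewrite !inE.
case: (boolP (j \in l1)) => //= jl; case: eqP => //= ejm.
by rewrite ejm (negbTE n1) in jl.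
Qed.

Lemma bigwedge0 : Y set0 = ext_one.
Proof. by rewrite /Y big_set0. Qed.

Lemma set_max I : I != set0 -> exists2 m, m \in I & forall i, i \in I -> (i <= m)%N.
Proof.
case/set0Pn => i0 i0I; case: (arg_maxnP (fun i : 'I_k => i : nat) i0I) => m mI mm.
by exists m.
Qed.

(** Induction on the size of [I], comparing [s] with the largest index [m] of [I]: a smaller [s] is
    moved past [f m] at the cost of one sign, a larger one is already in last place, and [s = m]
    repeats a vector. *)
Lemma bigwedge_vec I s :
  wedge (Y I) (ext_vec (f s)) =
  if s \in I then 0 else ext_scale (shuffle_sign I [set s]) (Y (s |: I)).
Proof.
move en : #|I| => n; elim: n I en => [|n IH] I en.
  move/eqP: en; rewrite cards_eq0 => /eqP ->.
  rewrite in_set0 shuffle_sign0l ext_scale1 setU0 bigwedge0 /Y big_set1.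
  by rewrite wedge1x.
have [m mI mm] : exists2 m, m \in I & forall i, i \in I -> (i <= m)%N.
  by apply: set_max; rewrite -cards_eq0 en.
have en' : #|I :\ m| = n by move: en; rewrite (cardsD1 m) mI => -[].
case: (ltngtP s m) => [sm|ms|/val_inj sm].
- have sNm : s != m by apply: contraTneq sm => ->; rewrite ltnn.
  rewrite (bigwedge_max mI mm) wedge_vecA IH // !inE sNm /=.
  case: ifPn => sI; first by rewrite wedge0l ext_scaler0.
  rewrite (@bigwedge_max (s |: I) m); last 2 first.
  + by rewrite !inE mI orbT.
  + by move=> i; rewrite !inE => /orP[/eqP->|/mm//]; exact: ltnW.
  have -> : (s |: I) :\ m = s |: (I :\ m).
    by apply/setP => j; rewrite !inE; case: (j =P s) => //= ->; rewrite sNm.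
  rewrite wedgeZl ext_scale_scale; congr ext_scale.
  rewrite -[in RHS](setD1K mI) shuffle_signUl ?shuffle_sign11 ?sm //.
  by rewrite disjoints1 !inE eqxx.
- have sI : s \notin I by apply/negP => /mm; rewrite leqNgt ms.
  rewrite (negbTE sI) (@bigwedge_max (s |: I) s); last 2 first.
  + by rewrite !inE eqxx.
  + by move=> i; rewrite !inE => /orP[/eqP->//|/mm im]; apply: ltnW; exact: leq_ltn_trans ms.
  rewrite setU1K // shuffle_signE big1 ?ext_scale1 // => i iI.
  by rewrite big_set1 ltnNge (leq_trans (mm _ iI) (ltnW ms)).
- by rewrite sm mI (bigwedge_max mI mm) -wedgeA wedge_vecv wedge0r.
Qed.

Lemma bigwedge_homog I : homogeneous #|I| (Y I).
Proof.
move en : #|I| => n; elim: n I en => [|n IH] I en J.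
  move/eqP: en; rewrite cards_eq0 => /eqP ->; rewrite bigwedge0 ffunE.
  by case: (J =P set0) => [->|]; rewrite ?cards0 ?eqxx.
have [m mI mm] : exists2 m, m \in I & forall i, i \in I -> (i <= m)%N.
  by apply: set_max; rewrite -cards_eq0 en.
have en' : #|I :\ m| = n by move: en; rewrite (cardsD1 m) mI => -[].
rewrite (bigwedge_max mI mm) wedge_vecE => nz.
have [s sJ hs] : exists2 s, s \in J & Y (I :\ m) (J :\ s) != 0.
  apply: contrapT => h; case/negP: nz; rewrite big1 // => s sJ.
  have [->|nY] := eqVneq (Y (I :\ m) (J :\ s)) 0; first by rewrite mulr0 mul0r.
  by case: h; exists s.
by move/(IH _ en'): hs => e; rewrite (cardsD1 s) sJ e.
Qed.
End BigWedge.

Lemma homog0 (a : nat) x K : homogeneous a x -> #|K| != a -> x K = 0.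
Proof. by move=> h; apply: contraNeq => /h ->. Qed.

(** * The action of matrices on the exterior algebra *)

Section ExtMap.
Variable A : 'M[R[i]]_k.
Let Y I : ext R k := \big[wedge/ext_one]_(i in I) ext_vec (row i A).

Lemma ext_map_sum x : ext_map A x = \sum_I ext_scale (x I) (Y I).
Proof. by apply/ffunP => K; rewrite ffunE sum_ffunE; apply: eq_bigr => I _; rewrite ffunE. Qed.

Lemma ext_map_base I : ext_map A (ext_base I) = Y I.
Proof.
rewrite ext_map_sum (bigD1 I) //= ffunE eqxx ext_scale1 big1 ?addr0 // => J nJ.
by rewrite ffunE (negbTE nJ) ext_scale0.
Qed.

Lemma ext_mapD x y : ext_map A (x + y) = ext_map A x + ext_map A y.
Proof.
by rewrite !ext_map_sum -big_split; apply: eq_bigr => I _; rewrite ffunE ext_scaleDl.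
Qed.

Lemma ext_mapZ a x : ext_map A (ext_scale a x) = ext_scale a (ext_map A x).
Proof.
apply/ffunP => K; rewrite ext_scaleE !ffunE big_distrr /=; apply: eq_bigr => I _.
by rewrite ext_scaleE mulrA.
Qed.

Lemma ext_map0 : ext_map A 0 = 0.
Proof. by have := ext_mapZ 0 0; rewrite !ext_scale0. Qed.

Lemma ext_map_suml (T : Type) (r : seq T) (P : pred T) (g : T -> ext R k) :
  ext_map A (\sum_(t <- r | P t) g t) = \sum_(t <- r | P t) ext_map A (g t).
Proof. exact: (big_morph _ ext_mapD ext_map0). Qed.

Lemma ext_map_one : ext_map A ext_one = ext_one.
Proof. by rewrite ext_map_base /Y big_set0. Qed.

Lemma row_mx_sum v : v *m A = \sum_j v ord0 j *: row j A.
Proof. exact: mulmx_sum_row. Qed.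

Lemma ext_vec_sumZ (g : 'I_k -> 'rV[R[i]]_k) v :
  ext_vec (\sum_j v ord0 j *: g j) = \sum_j ext_scale (v ord0 j) (ext_vec (g j)).
Proof.
rewrite (big_morph _ ext_vecD ext_vec0); apply: eq_bigr => j _; exact: ext_vecZ.
Qed.

(** By bilinearity both factors may be basis tensors, and the ordered products of rows of [A] obey,
    by [bigwedge_vec], the same sign rule as the basis tensors themselves. *)
Lemma ext_map_wedge x v :
  ext_map A (wedge x (ext_vec v)) = wedge (ext_map A x) (ext_vec (v *m A)).
Proof.
rewrite row_mx_sum ext_vec_sumZ ext_vec_sum !wedge_sumr ext_map_suml.
apply: eq_bigr => s _; rewrite !wedgeZr ext_mapZ; congr ext_scale.
rewrite [x in LHS]ext_sum_base [x in RHS]ext_sum_base wedge_suml !ext_map_suml wedge_suml.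
apply: eq_bigr => I _; rewrite wedgeZl !ext_mapZ wedgeZl; congr ext_scale.
rewrite ext_map_base bigwedge_vec.
have -> : wedge (ext_base I) (ext_base [set s]) =
    if s \in I then 0 else ext_scale (shuffle_sign I [set s]) (ext_base (s |: I)) :> ext R k.
  apply/ffunP => K; rewrite wedge_base /wedge_struct disjoint_sym disjoints1 setUC.
  case: (s \in I) => /=; first by rewrite ffunE.
  by rewrite !ffunE eq_sym; case: eqP; rewrite ?mulr1 ?mulr0.
by case: ifP => _; rewrite ?ext_map0 // ext_mapZ ext_map_base.
Qed.

Lemma ext_map_homog a x : homogeneous a x -> homogeneous a (ext_map A x).
Proof.
move=> hx J; rewrite ffunE => nz.
have [I hI] : exists I, x I * Y I J != 0.
  apply: contrapT => h; case/negP: nz; rewrite big1 // => I _.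
  by apply/eqP; apply: contrapT => /negP nI; apply: h; exists I.
move: hI; rewrite mulf_eq0 negb_or => /andP[/hx <-] /bigwedge_homog; by [].
Qed.
End ExtMap.

Lemma ext_map_comp A B x : ext_map B (ext_map A x) = ext_map (A *m B) x.
Proof.
rewrite (ext_map_sum A) (ext_map_sum (A *m B)) ext_map_suml; apply: eq_bigr => I _.
rewrite ext_mapZ; congr ext_scale.
elim/last_ind: (index_enum _) => [|l i IH]; first by rewrite !big_nil ext_map_one.
rewrite -cats1 !big_cat !big_cons !big_nil /=; case: (i \in I) => /=; rewrite ?wedgex1 //.
by rewrite ext_map_wedge IH row_mul.
Qed.

Lemma ext_map1 x : ext_map 1%:M x = x.
Proof.
rewrite ext_map_sum [RHS]ext_sum_base; apply: eq_bigr => I _; congr ext_scale.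
move en : #|I| => n; elim: n I en => [|n IH] I en.
  by move/eqP: en; rewrite cards_eq0 => /eqP ->; rewrite big_set0.
have [m mI mm] : exists2 m, m \in I & forall i, i \in I -> (i <= m)%N.
  by apply: set_max; rewrite -cards_eq0 en.
have en' : #|I :\ m| = n by move: en; rewrite (cardsD1 m) mI => -[].
rewrite (bigwedge_max (fun i => row i 1%:M) mI mm) IH // row1 ext_vec_delta.
apply/ffunP => K; rewrite wedge_base /wedge_struct disjoint_sym disjoints1 !inE eqxx /=.
rewrite setUC setD1K // ffunE eq_sym; case: eqP => // _.
rewrite shuffle_signE big1 // => i; rewrite !inE => /andP[_ /mm im].
by rewrite big_set1 ltnNge im.
Qed.

(** Contraction of [x] with the dual of e_I: the vector left on one output of a black vertex when
    the other output carries e_I. The sign is that of the order (I, s), the order of the outputs in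
    the surgery below. *)
Definition iota_vec I x : 'rV[R[i]]_k :=
  \row_s (if s \in I then 0 else shuffle_sign I [set s] * x (s |: I)).

(** The Leibniz rule for contraction: either [v] is the vector left over, or it is absorbed by an
    index [t] of [I], and [x] is contracted with the remaining indices. *)
Lemma iota_vec_wedge I x v :
  iota_vec I (wedge x (ext_vec v)) =
  x I *: v - \sum_(t in I) (shuffle_sign (I :\ t) [set t] * v ord0 t) *: iota_vec (I :\ t) x.
Proof.
apply/rowP => s; rewrite !mxE summxE /=.
case: ifPn => sI.
  rewrite (bigD1 s) //= !mxE !inE eqxx /= setD1K // big1 ?addr0.
    by rewrite mulrACA shuffle_sign_sqr mul1r mulrC subrr.
  by move=> t /andP[tI ts]; rewrite !mxE !inE sI andbT eq_sym ts mulr0.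
rewrite wedge_vecE big_setU1 /= ?sI // setU1K // mulrDr !mulrA shuffle_sign_sqr mul1r.
congr (_ + _); rewrite big_distrr /= -sumrN; apply: eq_bigr => t tI.
have st : s != t by apply: contraNneq sI => ->.
have eU : (s |: I) :\ t = s |: (I :\ t).
  by apply/setP => j; rewrite !inE; case: (j =P s) => //= ->; rewrite st.
have sIt : s \notin I :\ t by rewrite !inE negb_and sI orbT.
rewrite !mxE (negbTE sIt) eU.
rewrite shuffle_signUl ?disjoints1 // shuffle_sign11.
rewrite -[in shuffle_sign I _](setD1K tI) shuffle_signUl ?disjoints1 ?setD11 // shuffle_sign11.
have := shuffle_sign_sqr (I :\ t) [set s]; set A := shuffle_sign _ [set s]; set B := shuffle_sign _ _.
move: st; rewrite -val_eqE /=; case: ltngtP => // _ _ _; ring.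
Qed.

Lemma iota_vecZ I a x : iota_vec I (ext_scale a x) = a *: iota_vec I x.
Proof.
by apply/rowP => s; rewrite !mxE ext_scaleE; case: ifP => _; rewrite ?mulr0 // mulrCA.
Qed.

Lemma iota_vec_one I : iota_vec I ext_one = 0.
Proof.
apply/rowP => s; rewrite !mxE ffunE; case: ifP => // _.
have -> : (s |: I == set0) = false by apply/negbTE/set0Pn; exists s; rewrite !inE eqxx.
by rewrite mulr0.
Qed.

(** By the Leibniz rule a contraction of a product of vectors is a combination of its factors. The
    induction handles all [I] at once, because the rule replaces [I] by [I :\ t]. *)
Lemma iota_vec_span (Phi : nat -> ext R k) (v : nat -> 'rV[R[i]]_k) m :
  Phi 0%N = ext_one -> (forall l, (l < m)%N -> Phi l.+1 = wedge (Phi l) (ext_vec (v l))) ->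
  forall I, exists c : 'I_m -> R[i], iota_vec I (Phi m) = \sum_l c l *: v l.
Proof.
move=> P0; elim: m => [|m IH] Pm I.
  by exists (fun=> 0); rewrite P0 iota_vec_one big_ord0.
have {}IH := IH (fun l lm => Pm l (ltnW lm)).
have [c hc] := choice IH.
exists (fun l => match unlift ord_max l with
  | Some l' => - \sum_(t in I) (shuffle_sign (I :\ t) [set t] * v m ord0 t) * c (I :\ t) l'
  | None => Phi m I end).
rewrite Pm // iota_vec_wedge big_ord_recr /= unlift_none addrC; congr (_ + _).
under eq_bigr do rewrite hc scaler_sumr.
rewrite exchange_big /= -sumrN; apply: eq_bigr => l _.
have -> : widen_ord (leqnSn m) l = lift ord_max l by apply: val_inj; rewrite /= /bump leqNgt ltn_ord.
rewrite liftK scaleNr scaler_suml; congr (- _); apply: eq_bigr => t _.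
exact: scalerA.
Qed.

Lemma wedge_coef2 I J K : wedge_coef [:: I; J] K = wedge_struct I J K.
Proof. by rewrite /wedge_coef !big_cons big_nil wedgex1 wedge_base. Qed.

(** Identifies the contraction with what a state sum computes at a black vertex. *)
Lemma iota_vecE I x s : iota_vec I x ord0 s = \sum_K x K * wedge_coef [:: I; [set s]] K.
Proof.
rewrite mxE (bigD1 (s |: I)) //= big1 ?addr0; last first.
  move=> K nK; rewrite wedge_coef2 /wedge_struct setUC eq_sym (negbTE nK) andbF mulr0 //.
rewrite wedge_coef2 /wedge_struct setUC eqxx andbT disjoint_sym disjoints1.
by case: (s \in I); rewrite /= ?mulr0 // mulrC.
Qed.
End WedgeAlgebra.

(** * The Weyl group action *)

Section Weyl.
Context {R : realType} {k : nat}.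
Implicit Types (u : 'M[R[i]]_k) (F : nat -> ext R k) (v : nat -> 'rV[R[i]]_k)
  (lam : nat -> R[i]) (w : 'rV[R[i]]_k).

(* A flag fixed by u, with a basis adapted to it and the superdiagonal entries
   of u in this basis. *)
Record regular_flag u F v lam : Prop := {
  rflag0 : F 0%N = ext_one;
  rflagS : forall l, (l < k)%N -> F l.+1 = wedge (F l) (ext_vec (v l));
  rflag_neq0 : forall l, (l <= k)%N -> F l != 0;
  rflag_fix : forall l, (l <= k)%N -> ext_map u (F l) = F l;
  rflag_lam : forall l, (l.+1 < k)%N ->
    wedge (F l) (ext_vec (v l.+1 *m u - v l.+1)) = ext_scale (lam l) (F l.+1);
  rflag_lam0 : forall l, lam l != 0 }.

Definition vspan v m : 'M[R[i]]_(m, k) := \matrix_(l < m) v l.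

Lemma vspanP v m w : reflect (exists c : 'I_m -> R[i], w = \sum_l c l *: v l) (w <= vspan v m)%MS.
Proof.
apply: (iffP submxP) => [[D ->]|[c ->]].
  by exists (D ord0); rewrite mulmx_sum_row; apply: eq_bigr => l _; rewrite rowK.
by exists (\row_l c l); rewrite mulmx_sum_row; apply: eq_bigr => l _; rewrite rowK mxE.
Qed.

Lemma vspan_mem v m l : (l < m)%N -> (v l <= vspan v m)%MS.
Proof.
move=> lm; have -> : v l = row (Ordinal lm) (vspan v m) by rewrite rowK.
exact: row_sub.
Qed.

Lemma vspan_mono v m m' w : (m <= m')%N -> (w <= vspan v m)%MS -> (w <= vspan v m')%MS.
Proof.
move=> mm' /vspanP[c ->]; apply: summx_sub => l _; apply: scalemx_sub.
by apply: vspan_mem; apply: leq_trans mm'.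
Qed.

Section Regular.
Variables (u : 'M[R[i]]_k) (F : nat -> ext R k) (v : nat -> 'rV[R[i]]_k).
Hypothesis F0 : F 0%N = ext_one.
Hypothesis FS : forall l, (l < k)%N -> F l.+1 = wedge (F l) (ext_vec (v l)).
Hypothesis Fn0 : forall l, (l <= k)%N -> F l != 0.
Hypothesis Ffix : forall l, (l <= k)%N -> ext_map u (F l) = F l.

Lemma wedge_vspan m w : (m <= k)%N -> (w <= vspan v m)%MS -> wedge (F m) (ext_vec w) = 0.
Proof.
move=> mk /vspanP[c ->]; elim: m mk c => [|m IH] mk c.
  by rewrite big_ord0 ext_vec0 wedge0r.
have e : wedge (wedge (F m) (ext_vec (v m))) (ext_vec (v m)) = 0.
  by rewrite -wedgeA wedge_vecv wedge0r.
rewrite FS // big_ord_recr /= ext_vecD wedgeDr ext_vecZ wedgeZr e ext_scaler0 addr0.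
by rewrite wedge_vecA (IH (ltnW mk) (fun l => c (widen_ord (leqnSn m) l))) wedge0l ext_scaler0.
Qed.

(** A nonzero product of vectors determines their span. Contract the vanishing product with a set
    [I] such that [F m I] is nonzero: the Leibniz rule then expresses [w] through contractions of
    [F m], which lie in the span. *)
Lemma vspan_wedge m w : (m <= k)%N -> wedge (F m) (ext_vec w) = 0 -> (w <= vspan v m)%MS.
Proof.
move=> mk h; have [I nI] : exists I, F m I != 0.
  apply: contrapT => nex; case/negP: (Fn0 mk); apply/eqP/ffunP => I; rewrite [RHS]ffunE.
  by apply/eqP; apply: contrapT => /negP nI; apply: nex; exists I.
have e := iota_vec_wedge I (F m) w.
have {}e : F m I *: w = \sum_(t in I) (shuffle_sign (I :\ t)%SET [set t]%SET * w ord0 t) *: iota_vec (I :\ t)%SET (F m).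
  apply/eqP; rewrite -subr_eq0 -e h; apply/eqP/rowP => s; rewrite !mxE ffunE mulr0.
  by case: ifP.
rewrite -[w](scalerK nI) e; apply: scalemx_sub; apply: summx_sub => t _; apply: scalemx_sub.
apply/vspanP; apply: (@iota_vec_span _ _ F) => // l lm; apply: FS; exact: leq_trans mk.
Qed.

(** As [u] fixes [F l] and [F l.+1], the product of [F l] with [v l *m u] is the image of [F l.+1],
    that is [F l.+1] again; so [F l] kills the difference. *)
Lemma unipotent_vspan l : (l < k)%N -> (v l *m u - v l <= vspan v l)%MS.
Proof.
move=> lk; apply: vspan_wedge; first exact: ltnW.
have -> : v l *m u - v l = v l *m u + (-1) *: v l by rewrite scaleN1r.
rewrite ext_vecD wedgeDr ext_vecZ wedgeZr -FS //.
rewrite -[F l in X in X + _]Ffix ?(ltnW lk) // -ext_map_wedge -FS // Ffix //.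
by apply/ffunP => I; rewrite !ffunE mulN1r addrN.
Qed.

Lemma unipotent_vspanS m w : (m < k)%N -> (w <= vspan v m.+1)%MS -> (w *m u - w <= vspan v m)%MS.
Proof.
move=> mk /vspanP[c ->]; rewrite mulmx_suml -sumrB; apply: summx_sub => l _.
rewrite -scalemxAl -scalerBr; apply: scalemx_sub.
have lm : (l <= m)%N by rewrite -ltnS.
apply: (vspan_mono lm); apply: unipotent_vspan; exact: leq_ltn_trans mk.
Qed.
End Regular.

Lemma affine_regular u F : (0 < k)%N -> affine_flag F ->
  (forall l, (l <= k)%N -> ext_map u (F l) = F l) ->
  (forall l, (l.+1 < k)%N -> simple_defined u l F) ->
  exists v lam, regular_flag u F v lam.
Proof.
move=> k0 aF Ffix sd.
have [v hv] : exists v, forall l, (l < k)%N -> F l.+1 = wedge (F l) (ext_vec (v l)).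
  suff h l : exists x, (l < k)%N -> F l.+1 = wedge (F l) (ext_vec x) by have [v hv] := choice h; exists v.
  have [lk|kl] := ltnP l k; last by exists 0.
  case: l lk => [|l] lk; last by have [x <-] := aflag_step aF (i := l.+1) lk; exists x.
  (* [aflag_step] starts at the step 1, so the first vector is read off the tensor [F 1] of degree
     1. *)
  exists (\row_j F 1%N [set j]%SET) => _; rewrite (aflag0 aF) wedge1x.
  apply/ffunP => I; rewrite ext_vecE.
  have [/cards1P[j ->]|nI] := boolP (#|I| == 1%N).
    rewrite (bigD1 j) //= mxE eqxx mulr1 big1 ?addr0 // => j' nj.
    by rewrite (inj_eq set1_inj) eq_sym (negbTE nj) mulr0.
  rewrite (homog0 (aflag_homog aF k0) nI) big1 // => j _.
  case: eqP => [eI|_]; rewrite ?mulr0 //.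
  by rewrite eI cards1 in nI.
(* A zero step would make all later steps vanish, including the volume form. *)
have Fn0 l : (l <= k)%N -> F l != 0.
  move=> lk; apply/eqP => Fl0.
  have z m : (l + m <= k)%N -> F (l + m)%N = 0.
    elim: m => [|m IH]; first by rewrite addn0.
    by rewrite addnS => lmk; rewrite hv // IH ?wedge0l // ltnW.
  have := z (k - l)%N; rewrite subnKC // => /(_ (leqnn _)).
  rewrite (aflag_vol aF) => /ffunP/(_ [set: 'I_k]%SET); rewrite !ffunE eqxx => /eqP.
  by rewrite oner_eq0.
have hl l : exists c, c != 0 /\ ((l.+1 < k)%N ->
    wedge (F l) (ext_vec (v l.+1 *m u - v l.+1)) = ext_scale c (F l.+1)).
  (* The default value 1 out of range makes [lam] nonzero everywhere. *)
  have [lk|kl] := ltnP l.+1 k; last by exists 1; split; rewrite ?oner_neq0.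
  have F0 := aflag0 aF.
  have := unipotent_vspan F0 hv Fn0 Ffix lk.
  move=> /vspanP[c e].
  have e2 : wedge (F l) (ext_vec (v l.+1 *m u - v l.+1)) = ext_scale (c ord_max) (F l.+1).
    rewrite e big_ord_recr /= ext_vecD wedgeDr ext_vecZ wedgeZr -hv ?(ltnW lk) //.
    rewrite (wedge_vspan hv) ?add0r //; first by rewrite ltnW // ltnW.
    by apply/vspanP; eexists.
  exists (c ord_max); split=> // ; apply/eqP => c0.
  apply: (sd l lk (v l.+1)); first by rewrite -hv.
  by rewrite e2 c0 ext_scale0.
have [lam hlam] := choice hl.
exists v, lam; split => //.
- exact: aflag0 aF.
- by move=> l lk; case: (hlam l) => _ ->.
- by move=> l; case: (hlam l).
Qed.

Lemma regular_transport u U F v lam (P : 'M[R[i]]_k) :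
  P \in unitmx -> u *m P = P *m U -> regular_flag u F v lam ->
  regular_flag U (fun l => ext_map P (F l)) (fun l => v l *m P) lam.
Proof.
move=> Pu uP [F0 FS Fn0 Ffix Flam lam0]; split => //.
- by rewrite F0 ext_map_one.
- by move=> l lk; rewrite FS // ext_map_wedge.
- move=> l lk; apply: contra (Fn0 l lk) => /eqP h.
  by rewrite -(ext_map1 (F l)) -(mulmxV Pu) -ext_map_comp h ext_map0.
- by move=> l lk; rewrite ext_map_comp -uP -ext_map_comp Ffix.
- by move=> l lk; rewrite -mulmxA -uP mulmxA -mulmxBl -ext_map_wedge Flam // ext_mapZ.
Qed.

Lemma regular_ext u F F' v lam : (forall l, (l <= k)%N -> F l = F' l) ->
  regular_flag u F v lam -> regular_flag u F' v lam.
Proof.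
move=> e [F0 FS Fn0 Ffix Flam lam0]; split => //.
- by rewrite -e.
- by move=> l lk; rewrite -!e ?FS // ltnW.
- by move=> l lk; rewrite -e // Fn0.
- by move=> l lk; rewrite -e // Ffix.
- by move=> l lk; rewrite -!e ?Flam // ltnW // ltnW.
Qed.

(** The entry does not depend on the vector completing the flag: [w] differs from [c *: v l.+1] by
    an element of the span of the first l + 1 vectors, which [u - 1] sends into the span of the
    first l, and [F l] kills that span. *)
Lemma regular_lamP u F v lam l w : regular_flag u F v lam -> (l.+1 < k)%N ->
  forall c, wedge (F l.+1) (ext_vec w) = ext_scale c (F l.+2) ->
  wedge (F l) (ext_vec (w *m u - w)) = ext_scale (c * lam l) (F l.+1).
Proof.
move=> [F0 FS Fn0 Ffix Flam lam0] lk c h.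
have lk' := ltnW lk; have lk2 := ltnW lk'.
have d : (w - c *: v l.+1 <= vspan v l.+1)%MS.
  apply: (vspan_wedge F0 FS Fn0) => //.
  rewrite -scaleNr ext_vecD wedgeDr h ext_vecZ wedgeZr -FS //.
  by apply/ffunP => I; rewrite !ffunE mulNr addrN.
have d' := wedge_vspan FS lk2 (unipotent_vspanS F0 FS Fn0 Ffix lk' d).
have -> : w *m u - w = (w - c *: v l.+1) *m u - (w - c *: v l.+1) + c *: (v l.+1 *m u - v l.+1).
  by rewrite mulmxBl scalerBr -scalemxAl; apply/rowP => j; rewrite !mxE; ring.
by rewrite ext_vecD wedgeDr d' add0r ext_vecZ wedgeZr Flam // ext_scale_scale.
Qed.

(** Makes the scalings at two legs comparable once their flags have been transported to a common
    fibre. *)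
Lemma regular_lam_uniq u F v lam v' lam' l : regular_flag u F v lam -> regular_flag u F v' lam' ->
  (l.+1 < k)%N -> lam l = lam' l.
Proof.
move=> r r' lk; have := regular_lamP r lk (w := v' l.+1) (c := 1).
rewrite -(rflagS r') // ext_scale1 => /(_ erefl); rewrite (rflag_lam r') // mul1r.
move/ffunP => e; have [I nI] : exists I, F l.+1 I != 0.
  apply: contrapT => nex; case/negP: (rflag_neq0 r (ltnW lk)); apply/eqP/ffunP => I; rewrite [RHS]ffunE.
  by apply/eqP; apply: contrapT => /negP nI; apply: nex; exists I.
by have := e I; rewrite !ext_scaleE => /(mulIf nI).
Qed.

(** * Words in the simple transpositions *)

Lemma tperm_word (s : seq 'I_k) i : word_perm (rcons s i) = (tperm i (ordS i) * word_perm s)%g.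
Proof. by rewrite /word_perm -cats1 foldl_cat. Qed.

Let word_ok (s : seq 'I_k) := all (fun i : 'I_k => (i.+1 < k)%N) s.
(** Being the permutation of a word, strengthened to all left translates so as to be stable under
    products; appending a letter multiplies on the left. *)
Let reachable (g : 'S_k) :=
  forall s, word_ok s -> exists2 s', word_ok s' & word_perm s' = (g * word_perm s)%g.

Lemma ordS_val (i : 'I_k) : (i.+1 < k)%N -> ordS i = i.+1 :> nat.
Proof. by move=> ik; rewrite /= modn_small. Qed.

Lemma reachableM g h : reachable g -> reachable h -> reachable (g * h)%g.
Proof.
move=> rg rh s /rh[s' /rg[s'' ok2 e2] e]; exists s'' => //.
by rewrite e2 e mulgA.
Qed.

(** Induction on y - x: exchanging x and y is conjugate, by the simple transposition of y - 1 and y,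
    to exchanging x and y - 1. *)
Lemma reachable_tperm (x y : 'I_k) : (x < y)%N -> reachable (tperm x y).
Proof.
move en : (y - x)%N => n; elim: n y en => [|n IH] y en xy; first by rewrite -subn_gt0 en in xy.
have y0 : (0 < y)%N by apply: leq_ltn_trans xy.
have lt : (y.-1 < k)%N by apply: leq_ltn_trans (ltn_ord y); exact: leq_pred.
pose z := Ordinal lt; have zk : (z.+1 < k)%N by rewrite /= prednK.
have Sz : ordS z = y by apply: ord_inj; rewrite ordS_val //= prednK.
have rz : reachable (tperm z y).
  move=> s ok; exists (rcons s z); first by rewrite /word_ok all_rcons zk.
  by rewrite tperm_word Sz.
have [xz|xz] := eqVneq x z; first by rewrite xz.
have rxz : reachable (tperm x z).
  by apply: IH => /=; [lia | move: xz; rewrite -val_eqE /=; lia].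
have -> : tperm x y = (tperm z y * (tperm x z * tperm z y))%g.
  have e : (tperm x z ^ tperm z y)%g = tperm x y.
    by rewrite tpermJ tpermL tpermD // -val_eqE /=; move: xz; rewrite -val_eqE /=; lia.
  by rewrite -e conjgE tpermV.
by apply: reachableM => //; apply: reachableM.
Qed.

Lemma word_exists (w : 'S_k) : exists s, is_word_of w s.
Proof.
suff : reachable w by case/(_ [::] isT) => s ok e; exists s; split; rewrite // e /word_perm /= mulg1.
have [ts -> _] := prod_tpermP w.
elim: ts => [|[x y] ts IH]; first by rewrite big_nil => s ok; exists s; rewrite ?mul1g.
rewrite big_cons; apply: reachableM => //=.
case: (ltngtP x y) => [xy|yx|/val_inj ->].
- exact: reachable_tperm.
- by rewrite tpermC; exact: reachable_tperm.
- by rewrite tperm1 => s ok; exists s; rewrite ?mul1g.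
Qed.

Lemma card_initial_set a : (a <= k)%N -> #|(initial_set a : {set 'I_k})| = a.
Proof.
move=> ak; have -> : initial_set a = (widen_ord ak @: [set: 'I_a])%SET.
  apply/setP => j; rewrite inE; apply/idP/imsetP => [ja|[i _ ->]]; last by rewrite /= ltn_ord.
  by exists (Ordinal ja); rewrite ?inE //; apply: ord_inj.
by rewrite card_imset ?cardsT ?card_ord // => i j /(congr1 (@nat_of_ord k)) /= /ord_inj.
Qed.

Lemma perm_exists (A : {set 'I_k}) : exists w : 'S_k, (w @: initial_set #|A|)%SET = A.
Proof.
pose s := enum A ++ enum (~: A)%SET.
have szA : size (enum A) = #|A| by rewrite cardE.
have szs : size s = k by rewrite size_cat -!cardE cardsC card_ord.
have us : uniq s.
  rewrite cat_uniq !enum_uniq andbT /=; apply/hasPn => i; rewrite !mem_enum inE.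
  by [].
have inj : injective (fun i : 'I_k => nth i s i).
  move=> i j /= e; apply: ord_inj; apply/eqP.
  by rewrite -(nth_uniq i _ _ us) ?szs // e (set_nth_default j) ?szs.
exists (perm inj); apply/eqP; rewrite eqEcard; apply/andP; split.
  apply/fintype.subsetP => _ /imsetP[i + ->]; rewrite inE permE => iA.
  by rewrite nth_cat szA iA -mem_enum mem_nth ?szA.
rewrite card_imset; last exact: perm_inj.
have Ak : (#|A| <= k)%N by rewrite -[X in (_ <= X)%N]card_ord max_card.
by rewrite card_initial_set.
Qed.

(** A weight for each position, equal to 1 at the last one, such that the quotient of the weights at
    l and l + 1 is the superdiagonal entry [lam l]; there are k - 1 such entries. *)
Definition rweight lam l : R[i] := \prod_(l <= j < k.-1) lam j.

Lemma rweightS lam l : (l.+1 < k)%N -> rweight lam l = lam l * rweight lam l.+1.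
Proof. by move=> lk; rewrite /rweight big_ltn //; case: (k) lk. Qed.

Lemma rweight_neq0 lam l : (forall j, lam j != 0) -> rweight lam l != 0.
Proof. by move=> h; rewrite /rweight; elim/big_rec: _ => [|j x _ x0]; rewrite ?oner_neq0 // mulf_neq0. Qed.

(* The rescaling of the a-th step of the flag under a permutation which maps
   the initial set of size a to A. *)
Definition tag_scale lam (a : nat) (A : {set 'I_k}) : R[i] :=
  (\prod_(l < k | (l < a)%N) rweight lam l) / \prod_(l in A) rweight lam l.

(** Induction on the word. A letter i only changes the step i + 1, and it preserves the image of the
    initial set of size a for every other a. For a = i + 1, the entry [lam i], a quotient of
    consecutive weights, turns the old scale into the new one. *)
Lemma weyl_word u F v lam s : regular_flag u F v lam -> word_ok s ->
  forall a, (a <= k)%N -> foldl (fun F' (i : 'I_k) => simple_act u i F') F s a =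
    ext_scale (tag_scale lam a (word_perm s @: initial_set a)%SET) (F a).
Proof.
move=> reg; have mu0 := rweight_neq0 _ (rflag_lam0 reg).
set mu := rweight lam in mu0 *.
have pr0 (A : {set 'I_k}) : \prod_(l in A) mu l != 0 by apply/prodf_neq0 => j _; exact: mu0.
have pr0' a : \prod_(l < k | (l < a)%N) mu l != 0 by apply/prodf_neq0 => j _; exact: mu0.
elim/last_ind: s => [|s i IH] ok a ak.
  rewrite /= /word_perm /= /tag_scale -/mu.
  have -> : ((1%g : 'S_k) @: initial_set a)%SET = initial_set a.
    apply/setP => j; apply/imsetP/idP => [[l la ->]|ja]; first by rewrite perm1.
    by exists j; rewrite // perm1.
  rewrite (eq_bigl (fun l : 'I_k => l \in initial_set a)); last by move=> l; rewrite inE.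
  by rewrite divff // ext_scale1.
move: ok; rewrite /word_ok all_rcons => /andP[ik ok].
rewrite -cats1 foldl_cat /= {1}/simple_act; set F' := foldl _ _ _ in IH *.
have {}IH := IH ok.
set w := word_perm s in IH *.
have T a' : tag_scale lam a' (w @: initial_set a')%SET =
    (\prod_(l < k | (l < a')%N) mu l) / \prod_(l < k | (l < a')%N) mu (w l).
  rewrite /tag_scale -/mu big_imset /=; last by move=> x y _ _; exact: perm_inj.
  by congr (_ / _); apply: eq_bigl => l; rewrite inE.
have T' a' : tag_scale lam a' (word_perm (s ++ [:: i]) @: initial_set a')%SET =
    (\prod_(l < k | (l < a')%N) mu l) / \prod_(l < k | (l < a')%N) mu (w (tperm i (ordS i) l)).
  rewrite /tag_scale -/mu big_imset /=; last by move=> x y _ _; exact: perm_inj.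
  by congr (_ / _); apply: eq_big => l; rewrite ?inE // cats1 tperm_word permM.
have Si := ordS_val ik.
have iP (P : 'I_k -> R[i]) : \prod_(l < k | (l < i.+1)%N) P l = P i * \prod_(l < k | (l < i)%N) P l.
  rewrite (bigD1 i) //=; congr (_ * _); apply: eq_bigl => l.
  by rewrite -val_eqE /= ltnS; case: (ltngtP l i).
have iP2 (P : 'I_k -> R[i]) : \prod_(l < k | (l < i.+2)%N) P l = P (ordS i) * \prod_(l < k | (l < i.+1)%N) P l.
  rewrite (bigD1 (ordS i)) ?Si //; congr (_ * _); apply: eq_bigl => l.
  have -> : (l == ordS i) = (l == i.+1 :> nat) by rewrite -Si.
  by rewrite ltnS; case: (ltngtP l i.+1).
case: eqP => [->|/eqP ai]; last first.
  rewrite IH // T T'; congr ext_scale; congr (_ / _).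
  rewrite [RHS](reindex_inj (@perm_inj _ (tperm i (ordS i)))) /=.
  apply: eq_big => l; last by rewrite tpermK.
  have := Si; case: tpermP => [->|->|//] e.
    by rewrite e; move: ai; case: (ltngtP a i.+1) => //; lia.
  by rewrite e; move: ai; case: (ltngtP a i.+1) => //; lia.
rewrite T' !iP tpermL.
have -> : \prod_(l < k | (l < i)%N) mu (w (tperm i (ordS i) l)) = \prod_(l < k | (l < i)%N) mu (w l).
  apply: eq_bigr => l li; rewrite tpermD //; apply: contraTneq li => <-; rewrite ?Si; lia.
set v0 := xget _ _.
have i1 := ltnW ik; have i0 := ltnW i1.
(* The quotient of the scales of two consecutive steps is the coefficient [c] with which
   [regular_lamP] applies to the vector chosen by [simple_act]. *)
have hT : tag_scale lam i.+2 (w @: initial_set i.+2)%SET =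
    tag_scale lam i.+1 (w @: initial_set i.+1)%SET * (mu i.+1 / mu (w (ordS i))).
  rewrite !T !iP2 Si; have := mu0 (w (ordS i)).
  have : \prod_(l < k | (l < i.+1)%N) mu (w l) != 0 by apply/prodf_neq0 => j _; exact: mu0.
  by move=> h1 h2; field; rewrite h1 h2.
have hv0 : wedge (F' i.+1) (ext_vec v0) = F' i.+2.
  suff : [set v | wedge (F' i.+1) (ext_vec v) = F' i.+2]%classic v0 by [].
  apply: (@xgetI _ 0 _ ((mu i.+1 / mu (w (ordS i))) *: v i.+1)) => /=.
  rewrite !IH // wedgeZl ext_vecZ wedgeZr -(rflagS reg) // ext_scale_scale hT //.
rewrite !IH // in hv0.
have hv1 : wedge (F i.+1) (ext_vec v0) = ext_scale (mu i.+1 / mu (w (ordS i))) (F i.+2).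
  have T0 : tag_scale lam i.+1 (w @: initial_set i.+1)%SET != 0.
    by rewrite /tag_scale mulf_neq0 ?invr_neq0.
  rewrite wedgeZl hT in hv0.
  have := congr1 (ext_scale (tag_scale lam i.+1 (w @: initial_set i.+1)%SET)^-1) hv0.
  by rewrite !ext_scale_scale mulVf // ext_scale1 mulrA mulVf // mul1r.
rewrite IH // wedgeZl (regular_lamP reg ik hv1) ext_scale_scale; congr ext_scale.
rewrite T; have := rweightS lam ik; rewrite -/mu => e.
have h1 := mu0 (w (ordS i)); have h2 := mu0 i.+1.
have h3 : \prod_(l < k | (l < i)%N) mu (w l) != 0 by apply/prodf_neq0 => j _; exact: mu0.
by rewrite e; field; rewrite h1 h3.
Qed.

(** The scale depends on the permutation only through the image of the initial set, so the arbitrary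
    choices of a permutation and of a word disappear. *)
Lemma tagged_stepE u F v lam a (A : {set 'I_k}) : regular_flag u F v lam -> #|A| = a ->
  tagged_step u F a A = ext_scale (tag_scale lam a A) (F a).
Proof.
move=> reg cA; rewrite /tagged_step /weyl_act.
have ak : (a <= k)%N by rewrite -cA -[X in (_ <= X)%N]card_ord max_card.
set w : 'S_k := xget 1%g _; have wA : (w @: initial_set a)%SET = A.
  have [w0 hw0] := perm_exists A; rewrite cA in hw0.
  suff : [set w : 'S_k | (w @: initial_set a)%SET = A]%classic w by [].
  exact: (@xgetI _ 1%g _ w0).
set s := xget _ _; have [ok ws] : is_word_of w s.
  have [s0 hs0] := word_exists w; exact: (@xgetI _ [::] _ s0).
by rewrite (weyl_word reg ok ak) ws wA.
Qed.

(* The rescaling needed for moving one element from A to B is a product of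
   superdiagonal entries, which is produced by a power of [u - 1]. *)
Lemma power_vspan u F v lam m n w d : regular_flag u F v lam -> (m + n < k)%N ->
  (w - d *: v (m + n)%N <= vspan v (m + n))%MS ->
  (w *m (u - 1) ^+ n - (d * \prod_(m <= l < m + n) lam l) *: v m <= vspan v m)%MS.
Proof.
move=> reg; have [F0 FS Fn0 Ffix Flam _] := reg.
elim: n w d => [|n IH] w d mnk h.
  by rewrite expr0 mulmx1 big_geq ?addn0 // mulr1; rewrite addn0 in h.
rewrite addnS in mnk h *.
rewrite exprS -mulmxE mulmxA big_nat_recr ?leq_addr //= mulrA mulrAC.
apply: IH; first exact: ltnW.
have hv : (v (m + n).+1 *m u - v (m + n).+1 - lam (m + n)%N *: v (m + n)%N <= vspan v (m + n))%MS.
  apply: (vspan_wedge F0 FS Fn0); first by rewrite ltnW // ltnW.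
  rewrite -scaleNr ext_vecD wedgeDr Flam // ext_vecZ wedgeZr -FS; last by rewrite ltnW.
  by apply/ffunP => I; rewrite !ffunE mulNr addrN.
have hw := unipotent_vspanS F0 FS Fn0 Ffix (ltnW mnk) h.
have -> : w *m (u - 1) - (d * lam (m + n)%N) *: v (m + n)%N =
   (w - d *: v (m + n).+1) *m u - (w - d *: v (m + n).+1) +
   d *: (v (m + n).+1 *m u - v (m + n).+1 - lam (m + n)%N *: v (m + n)%N).
  rewrite mulmxBr mulmx1 mulmxBl -scalemxAl !scalerBr scalerA.
  by apply/rowP => j; rewrite !mxE; ring.
by apply: addmx_sub => //; apply: scalemx_sub.
Qed.

Lemma prod_lam_rweight lam m n : (m + n < k)%N -> (forall l, lam l != 0) ->
  \prod_(m <= l < m + n) lam l = rweight lam m / rweight lam (m + n).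
Proof.
move=> mnk lam0; have mu0 l := rweight_neq0 l lam0.
elim: n mnk => [|n IH] mnk; first by rewrite addn0 big_geq // divff.
rewrite addnS in mnk *; rewrite big_nat_recr ?leq_addr //= IH ?(ltnW mnk) //.
by rewrite (rweightS lam mnk); field; rewrite !mu0 lam0.
Qed.

Lemma binomial_sub1 (U : 'M[R[i]]_k) n :
  (U - 1) ^+ n = \sum_(j < n.+1) ((-1) ^+ (n - j) *+ 'C(n, j)) *: U ^+ j.
Proof.
have c : GRing.comm U (-1) by rewrite /GRing.comm mulrN mulNr mulr1 mul1r.
rewrite addrC exprDn_comm; last exact/commr_sym.
apply: eq_bigr => j _.
have -> : (-1 : 'M[R[i]]_k) ^+ (n - j) = ((-1) ^+ (n - j))%:M.
  elim: (n - j)%N => [|l IH]; first by rewrite !expr0.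
  by rewrite !exprS IH mulN1r mulN1r raddfN.
by rewrite -mulmxE mul_scalar_mx scalerMnl.
Qed.

(** The element [i] passes from one denominator to the other. The numerators lose the weight of the
    position a - 1 and gain that of b, which the last factor compensates. *)
Lemma tag_scale_exchange lam a b (A B : {set 'I_k}) i : (forall l, lam l != 0) ->
  (0 < a)%N -> (a <= k)%N -> (b < k)%N -> i \in A -> i \notin B ->
  tag_scale lam a.-1 (A :\ i)%SET * tag_scale lam b.+1 (i |: B)%SET *
    (rweight lam a.-1 / rweight lam b) =
  tag_scale lam a A * tag_scale lam b B.
Proof.
move=> lam0 a0 ak bk iA iB; rewrite /tag_scale.
have mu0 l := rweight_neq0 l lam0; set mu := rweight lam in mu0 *.
have pr0 (C : {set 'I_k}) : \prod_(l in C) mu l != 0 by apply/prodf_neq0 => j _; exact: mu0.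
have prS c : (c < k)%N -> \prod_(l < k | (l < c.+1)%N) mu l = mu c * \prod_(l < k | (l < c)%N) mu l.
  move=> ck; rewrite (bigD1 (Ordinal ck)) //=; congr (_ * _); apply: eq_bigl => l.
  by rewrite -val_eqE /= ltnS; case: (ltngtP l c).
rewrite (prS b) // -[in RHS](prednK a0) prS ?prednK //.
rewrite big_setU1 //= (big_setD1 i iA) /=.
by field; rewrite !mu0 !pr0.
Qed.

(** In the application [u], [F] belong to the leg e and [u'], [F'] to e'; [P] and [Q] transport them
    to a common fibre, with monodromy [U]. [H'] is the transport along the inner piece of e' and
    [Sj j] that along the hook with j0 + j turns. *)
Lemma exchange_identity u F u' F' (U P Q H' : 'M[R[i]]_k) (Sj : nat -> 'M[R[i]]_k)
    (j0 a b : nat) (A B : {set 'I_k}) (i : 'I_k) I I' :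
  affine_flag F -> (forall l, (l <= k)%N -> ext_map u (F l) = F l) ->
  (forall l, (l.+1 < k)%N -> simple_defined u l F) ->
  affine_flag F' -> (forall l, (l <= k)%N -> ext_map u' (F' l) = F' l) ->
  (forall l, (l.+1 < k)%N -> simple_defined u' l F') ->
  P \in unitmx -> Q \in unitmx -> u *m P = P *m U -> u' *m Q = Q *m U ->
  (forall l, (l <= k)%N -> ext_map P (F l) = ext_map Q (F' l)) ->
  (forall j, H' *m Sj j = Q *m U ^+ (j0 + j)) ->
  #|A| = a -> #|B| = b -> (a <= b)%N -> i \in A -> i \notin B ->
  \sum_(j < (b.+1 - a).+1) ((-1) ^+ (b.+1 - a - j) *+ 'C(b.+1 - a, j)) *
    wedge (ext_map P (tagged_step u F a.-1 (A :\ i)%SET))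
      (ext_vec (iota_vec I' (ext_map H' (tagged_step u' F' b.+1 (i |: B)%SET)) *m Sj j)) I =
  ext_map P (tagged_step u F a A) I * ext_map H' (tagged_step u' F' b B) I'.
Proof.
move=> aF fF sF aF' fF' sF' uP uQ PU QU PQ HS cA cB ab iA iB.
have k0 : (0 < k)%N by apply: leq_ltn_trans (ltn_ord i).
have [v [lam reg]] := affine_regular k0 aF fF sF.
have [v' [lam' reg']] := affine_regular k0 aF' fF' sF'.
have rQ := regular_transport uQ QU reg'.
have rP := regular_ext PQ (regular_transport uP PU reg).
have lamE l : (l.+1 < k)%N -> lam' l = lam l by move=> lk; apply: (regular_lam_uniq rQ rP).
have muE l : rweight lam' l = rweight lam l.
  by apply: eq_big_nat => j /andP[_ jk]; apply: lamE; case: (k) jk.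
have scE c (C : {set 'I_k}) : tag_scale lam' c C = tag_scale lam c C.
  by rewrite /tag_scale; congr (_ / _); apply: eq_bigr => l _; exact: muE.
have a0 : (0 < a)%N by rewrite -cA; apply/card_gt0P; exists i.
have cA' : #|(A :\ i)%SET| = a.-1 by rewrite -cA (cardsD1 i A) iA.
have cB' : #|(i |: B)%SET| = b.+1 by rewrite cardsU1 iB cB.
have bk : (b < k)%N by rewrite -cB' -[X in (_ <= X)%N]card_ord max_card.
have ak : (a <= k)%N by rewrite ltnW // (leq_ltn_trans ab).
rewrite !(tagged_stepE reg) // !(tagged_stepE reg') // !scE.
set n := (b.+1 - a)%N; set y := ext_map H' (F' b).
have F'0 := rflag0 reg'; have F'S := rflagS reg'.
(* Contracting the step b + 1 leaves [v' b], with the coordinate at [I'] of the step b as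
   coefficient, plus a combination of the earlier vectors. *)
have [d hd] : exists d : 'I_b.+1 -> R[i], d ord_max = y I' /\
    iota_vec I' (ext_map H' (F' b.+1)) = (\sum_l d l *: v' l) *m H'.
  pose Phi l := ext_map H' (F' l); pose x l := v' l *m H'.
  have P0 : Phi 0%N = ext_one by rewrite /Phi F'0 ext_map_one.
  have PS l : (l < b)%N -> Phi l.+1 = wedge (Phi l) (ext_vec (x l)).
    by move=> lb; rewrite /Phi F'S ?ext_map_wedge // (ltn_trans lb).
  have [c hc] := choice (iota_vec_span P0 PS).
  exists (fun l => match unlift ord_max l with
    | Some l' => - \sum_(t in I') (shuffle_sign (I' :\ t)%SET [set t]%SET * x b ord0 t) * c (I' :\ t)%SET l'
    | None => y I' end); rewrite unlift_none; split=> //.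
  rewrite F'S // ext_map_wedge iota_vec_wedge -/(Phi b) -/(x b).
  rewrite big_ord_recr /= unlift_none mulmxDl -scalemxAl addrC; congr (_ + _).
  under eq_bigr do rewrite hc scaler_sumr.
  rewrite exchange_big /= -sumrN mulmx_suml; apply: eq_bigr => l _.
  have -> : widen_ord (leqnSn b) l = lift ord_max l by apply: ord_inj; rewrite /= /bump leqNgt ltn_ord.
  rewrite liftK -scalemxAl scaleNr scaler_suml; congr (- _); apply: eq_bigr => t _.
  exact: scalerA.
case: hd => hd1 hd2.
pose w := (\sum_l d l *: v' l) *m Q *m U ^+ j0.
have [rF0 rFS rFn0 rFfix _ _] := rQ.
(* [U] is unipotent in the adapted basis, so the j0 preliminary turns do not change the leading
   coefficient. *)
have hw : (w - d ord_max *: (v' b *m Q) <= vspan (fun l => v' l *m Q) b)%MS.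
  have h0 : ((\sum_l d l *: v' l) *m Q - d ord_max *: (v' b *m Q) <= vspan (fun l => v' l *m Q) b)%MS.
    rewrite big_ord_recr /= mulmxDl -scalemxAl addrK mulmx_suml.
    by apply: summx_sub => l _; rewrite -scalemxAl; apply: scalemx_sub; apply: (vspan_mem (fun l => v' l *m Q)).
  rewrite /w; elim: j0 {HS w} => [|j IH]; first by rewrite expr0 mulmx1.
  rewrite exprSr -mulmxE mulmxA; set z := _ *m U ^+ j in IH *.
  have zS : (z <= vspan (fun l => v' l *m Q) b.+1)%MS.
    rewrite -(subrK (d ord_max *: (v' b *m Q)) z); apply: addmx_sub.
      exact: (vspan_mono (leqnSn b) IH).
    by apply: scalemx_sub; apply: (vspan_mem (fun l => v' l *m Q)).
  have := unipotent_vspanS rF0 rFS rFn0 rFfix bk zS => h.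
  by rewrite -(subrK z (z *m U)) -addrA; apply: addmx_sub.
(* The n factors [U - 1] lower the leading vector from index b to index a - 1, where it completes
   the step a - 1 to the step a. *)
have bn : (a.-1 + n)%N = b by rewrite /n; lia.
have hw' : (w *m (U - 1) ^+ n - (d ord_max * \prod_(a.-1 <= l < b) lam' l) *: (v' a.-1 *m Q)
    <= vspan (fun l => v' l *m Q) a.-1)%MS.
  have := @power_vspan U _ _ _ a.-1 n w (d ord_max) rQ; rewrite bn; exact.
have sumw : \sum_(j < n.+1) ((-1) ^+ (n - j) *+ 'C(n, j)) *:
    (iota_vec I' (ext_map H' (F' b.+1)) *m Sj j) = w *m (U - 1) ^+ n.
  rewrite binomial_sub1 mulmx_sumr; apply: eq_bigr => j _.
  rewrite hd2 -mulmxA HS -scalemxAr; congr (_ *: _).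
  by rewrite /w exprD -mulmxE !mulmxA.
have a1k : (a.-1 <= k)%N by apply: leq_trans ak; exact: leq_pred.
have wz : wedge (ext_map P (F a.-1)) (ext_vec (w *m (U - 1) ^+ n)) =
    ext_scale (y I' * (rweight lam a.-1 / rweight lam b)) (ext_map P (F a)).
  rewrite -(subrK ((d ord_max * \prod_(a.-1 <= l < b) lam' l) *: (v' a.-1 *m Q)) (w *m (U - 1) ^+ n)).
  rewrite ext_vecD wedgeDr PQ // (wedge_vspan rFS a1k hw') add0r ext_vecZ wedgeZr -rFS; last by rewrite prednK.
  rewrite prednK // -PQ //; congr ext_scale; rewrite hd1; congr (_ * _).
  by rewrite -{1}bn prod_lam_rweight ?bn ?muE //; exact: rflag_lam0 reg'.
transitivity (tag_scale lam a.-1 (A :\ i)%SET * tag_scale lam b.+1 (i |: B)%SET *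
   (\sum_(j < n.+1) wedge (ext_map P (F a.-1)) (ext_vec (((-1) ^+ (n - j) *+ 'C(n, j)) *:
     (iota_vec I' (ext_map H' (F' b.+1)) *m Sj j))) I)).
  rewrite big_distrr /=; apply: eq_bigr => j _.
  rewrite !ext_mapZ iota_vecZ -scalemxAl !ext_vecZ !wedgeZr wedgeZl !ext_scaleE; ring.
have -> : \sum_(j < n.+1) wedge (ext_map P (F a.-1)) (ext_vec (((-1) ^+ (n - j) *+ 'C(n, j)) *:
     (iota_vec I' (ext_map H' (F' b.+1)) *m Sj j))) I =
    wedge (ext_map P (F a.-1)) (ext_vec (w *m (U - 1) ^+ n)) I.
  by rewrite -sumw (big_morph _ ext_vecD ext_vec0) wedge_sumr sum_ffunE.
rewrite wz !ext_mapZ !ext_scaleE -/y.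
have := tag_scale_exchange (rflag_lam0 reg) a0 ak bk iA iB.
set X := tag_scale lam a A; set Y := tag_scale lam b B => e.
transitivity ((X * Y) * (y I' * ext_map P (F a) I)); last by ring.
by rewrite -e; ring.
Qed.
End Weyl.

(** * State sums *)

Section SumFfun.
Context {V : nmodType}.

Definition ffun_join (A B : finType) (X : Type) (s : {ffun A -> X}) (t : {ffun B -> X}) :
  {ffun (A + B)%type -> X} := [ffun d => match d with inl a => s a | inr b => t b end].

Lemma sum_pair (I J : finType) (F : I * J -> V) : \sum_p F p = \sum_i \sum_j F (i, j).
Proof. by rewrite pair_bigA; apply: eq_bigr => -[]. Qed.

Lemma sum_ffun_sum (A B X : finType) (F : {ffun (A + B)%type -> X} -> V) :
  \sum_f F f = \sum_s \sum_t F (ffun_join s t).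
Proof.
rewrite pair_bigA /=; apply: (reindex (fun st => ffun_join st.1 st.2)); apply: onW_bij.
exists (fun f : {ffun (A + B)%type -> X} => ([ffun a => f (inl a)], [ffun b => f (inr b)])).
  by move=> [s t]; congr pair; apply/ffunP => a; rewrite !ffunE.
by move=> f; apply/ffunP => -[a|b]; rewrite !ffunE.
Qed.

Lemma sum_ffun_bool (X : finType) (F : {ffun bool -> X} -> V) :
  \sum_f F f = \sum_x \sum_y F [ffun b : bool => if b then x else y].
Proof.
rewrite pair_bigA /=; apply: (reindex (fun st : X * X => [ffun b : bool => if b then st.1 else st.2])).
apply: onW_bij; exists (fun f : {ffun bool -> X} => (f true, f false)).
  by move=> [s t]; rewrite !ffunE.
by move=> f; apply/ffunP => -[]; rewrite !ffunE.
Qed.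

Lemma sum_ffun_ord0 (X : finType) (F : {ffun 'I_0 -> X} -> V) f0 : \sum_f F f = F f0.
Proof.
rewrite (big_pred1 f0) // => f.
by rewrite /=; apply/esym/eqP/ffunP => -[].
Qed.

Lemma sum_ffun_ord1 (X : finType) (F : {ffun 'I_1 -> X} -> V) :
  \sum_f F f = \sum_x F [ffun => x].
Proof.
apply: (reindex (fun x : X => [ffun => x])); apply: onW_bij.
exists (fun f : {ffun 'I_1 -> X} => f ord0); first by move=> x; rewrite ffunE.
by move=> f; apply/ffunP => j; rewrite ffunE; congr (f _); apply/val_inj; case: j => [[]].
Qed.
End SumFfun.

Section Resum.
Context {V : pzRingType} (A X1 X2 : finType) (x0 : X1).

Definition ffun_upd (s : {ffun A -> X1 * X2}) (e : A) (x : X1) : {ffun A -> X1 * X2} :=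
  [ffun a => if a == e then (x, (s a).2) else s a].

(** Serves to cut an edge: as [P] does not see the state at the source of [e], only the sum over
    this state matters. States are grouped by their representative with value [x0] at the source. *)
Lemma sum_ffun_upd (e : A) (P : {ffun A -> X1 * X2} -> V) (Q Q' : X1 * X2 -> V) :
  (forall s x, P (ffun_upd s e x) = P s) ->
  (forall y, \sum_x Q (x, y) = \sum_x Q' (x, y)) ->
  \sum_s P s * Q (s e) = \sum_s P s * Q' (s e).
Proof.
move=> hP hQ.
suff h (q : X1 * X2 -> V) : \sum_s P s * q (s e) =
    \sum_(r : {ffun A -> X1 * X2} | (r e).1 == x0) P r * \sum_x q (x, (r e).2).
  by rewrite !h; apply: eq_bigr => r _; rewrite hQ.
rewrite (partition_big (fun s => ffun_upd s e x0) (fun r => (r e).1 == x0)) /=; last first.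
  by move=> s _; rewrite ffunE eqxx.
apply: eq_bigr => r /eqP r0; rewrite mulr_sumr.
rewrite (reindex_onto (fun x => ffun_upd r e x) (fun s => (s e).1)) /=; last first.
  move=> s /eqP <-; apply/ffunP => a; rewrite !ffunE; case: eqP => // ->.
  by rewrite /= -surjective_pairing.
apply: eq_big => [x|x _]; last by rewrite hP ffunE eqxx.
rewrite ffunE eqxx /= eqxx andbT; apply/eqP/ffunP => a; rewrite !ffunE.
by case: eqP => // ->; rewrite /= -r0 -surjective_pairing.
Qed.
End Resum.

(** * Contraction of edges and of the inner part of the diagram *)

Section EdgeWeight.
Context {R : realType} {k : nat}.
Implicit Types (M : 'M[R[i]]_k) (x : ext R k) (I J : {set 'I_k}).

(** The condition [state_ok] is absorbed into the edge factors, so that sums run over all states. *)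
Definition edge_coef M (w : nat) (s : {set 'I_k} * {set 'I_k}) : R[i] :=
  ((#|s.1| == w) && (#|s.2| == w))%:R * ext_map M (ext_base s.1) s.2.

Lemma sum_edge_coef M w x J : homogeneous w x ->
  \sum_I x I * edge_coef M w (I, J) = (#|J| == w)%:R * ext_map M x J.
Proof.
move=> hx; rewrite (ext_map_sum _ x) sum_ffunE mulr_sumr; apply: eq_bigr => I _.
rewrite ext_scaleE /edge_coef /= ext_map_base.
have [->|n0] := eqVneq (x I) 0; first by rewrite !mul0r mulr0.
by rewrite (hx I n0) eqxx /= mulrCA.
Qed.

Lemma homog_card w x J : homogeneous w x -> (#|J| == w)%:R * x J = x J.
Proof.
move=> hx; have [->|n0] := eqVneq (x J) 0; first by rewrite mulr0.
by rewrite (hx J n0) eqxx mul1r.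
Qed.

Lemma sum_edge_coef_homog M w x J : homogeneous w x ->
  \sum_I x I * edge_coef M w (I, J) = ext_map M x J.
Proof. by move=> hx; rewrite sum_edge_coef // homog_card //; exact: ext_map_homog. Qed.

Lemma edge_coef1 M I J : edge_coef M 1 (I, J) =
  \sum_s \sum_t (I == [set s]%SET)%:R * (J == [set t]%SET)%:R * M s t.
Proof.
rewrite /edge_coef /=; case: (boolP (#|I| == 1%N)) => [/cards1P[s ->]|nI]; last first.
  rewrite mul0r big1 // => s _; rewrite big1 // => t _.
  by case: eqP => [h|]; rewrite ?mul0r //; move: nI; rewrite h cards1.
rewrite (bigD1 s) //= [X in _ + X]big1 ?addr0; last first.
  move=> t nt; rewrite big1 // => j _; case: eqP => [/set1_inj h|]; rewrite ?mul0r //.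
  by rewrite h eqxx in nt.
rewrite eqxx ext_map_base big_set1 ext_vecE.
case: (boolP (#|J| == 1%N)) => [_|nJ].
  by rewrite mul1r; apply: eq_bigr => j _; rewrite mxE mul1r mulrC.
rewrite mul0r big1 // => j _; case: eqP => [h|]; rewrite ?mulr0 ?mul0r //.
by move: nJ; rewrite h cards1.
Qed.

(* Contraction of the part of the diagram near the puncture: t and t' are the
   tensors of the inner pieces, I and I' the basis tensors at the sources of the
   outer pieces. *)
Lemma sum_inner (n : bool) (Mf Mf' Ms : 'M[R[i]]_k) (w w' : nat) (t t' : ext R k)
    (I I' : {set 'I_k}) : homogeneous w t -> homogeneous w' t' ->
  \sum_(tau : {ffun (bool + 'I_n)%type -> {set 'I_k} * {set 'I_k}})
    (edge_coef Mf' w' (tau (inl true)) * edge_coef Ms 1 (tau (inl false)) *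
     (\prod_(j < n) edge_coef Mf w (tau (inr j)))) *
    ((t' (tau (inl true)).1 * \prod_(j <- enum 'I_n) t (tau (inr j)).1) *
     (wedge_coef [:: I'; (tau (inl false)).1] (tau (inl true)).2 *
      wedge_coef (rcons [seq (tau (inr j)).2 | j <- enum 'I_n] (tau (inl false)).2) I)) =
  wedge (if n then ext_map Mf t else ext_one) (ext_vec (iota_vec I' (ext_map Mf' t') *m Ms)) I.
Proof.
move=> ht ht'; set G := (if n then _ else _).
(* The white vertex; when the inner piece is absent, its tensor is replaced by the unit. *)
have wG J2 : \sum_(f : {ffun 'I_n -> {set 'I_k} * {set 'I_k}})
    (\prod_(j < n) edge_coef Mf w (f j)) * (\prod_(j <- enum 'I_n) t (f j).1 *
     wedge_coef (rcons [seq (f j).2 | j <- enum 'I_n] J2) I) = wedge G (ext_base J2) I.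
  rewrite /G; case: (n) => /=.
    rewrite sum_ffun_ord1 sum_pair.
    rewrite exchange_big /= [X in wedge X]ext_sum_base wedge_suml sum_ffunE; apply: eq_bigr => K2 _.
    rewrite wedgeZl ext_scaleE -(sum_edge_coef_homog Mf K2 ht) mulr_suml; apply: eq_bigr => K1 _.
    have -> : wedge (ext_base K2) (ext_base J2) I = wedge_coef (R := R) [:: K2; J2] I.
      by rewrite /wedge_coef !big_cons big_nil wedgex1.
    have -> : enum 'I_1 = [:: ord0].
      by rewrite enum_ordSl; congr cons; apply: size0nil; rewrite size_map size_enum_ord.
    by rewrite big_ord1 /= big_seq1 !ffunE /=; ring.
  rewrite (sum_ffun_ord0 _ [ffun => (finset.set0, finset.set0)]) big_ord0; have -> : enum 'I_0 = [::] by apply: size0nil; rewrite size_enum_ord.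
  by rewrite big_nil /= !mul1r wedge1x /wedge_coef big_cons big_nil wedgex1.
transitivity (\sum_(J : {set 'I_k} * {set 'I_k}) edge_coef Ms 1 J *
    (\sum_J2 ext_map Mf' t' J2 * wedge_coef [:: I'; J.1] J2) * wedge G (ext_base J.2) I).
  rewrite sum_ffun_sum sum_ffun_bool exchange_big /=; apply: eq_bigr => J _.
  rewrite -(wG J.2).
  transitivity (\sum_(K : {set 'I_k} * {set 'I_k})
     \sum_(f : {ffun 'I_n -> {set 'I_k} * {set 'I_k}})
     (edge_coef Ms 1 J * (t' K.1 * edge_coef Mf' w' K * wedge_coef [:: I'; J.1] K.2)) *
     ((\prod_(j < n) edge_coef Mf w (f j)) * (\prod_(j <- enum 'I_n) t (f j).1 *
     wedge_coef (rcons [seq (f j).2 | j <- enum 'I_n] J.2) I))).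
    apply: eq_bigr => K _; apply: eq_bigr => f _; rewrite !ffunE /=.
    have -> : \prod_(j < n) edge_coef Mf w (ffun_join [ffun b => if b then K else J] f (inr j)) =
       \prod_(j < n) edge_coef Mf w (f j) by apply: eq_bigr => j _; rewrite ffunE.
    have -> : \prod_(j <- enum 'I_n) t (ffun_join [ffun b => if b then K else J] f (inr j)).1 =
       \prod_(j <- enum 'I_n) t (f j).1 by apply: eq_bigr => j _; rewrite ffunE.
    have -> : [seq (ffun_join [ffun b => if b then K else J] f (inr j)).2 | j <- enum 'I_n] =
       [seq (f j).2 | j <- enum 'I_n] by apply: eq_map => j; rewrite ffunE.
    by ring.
  rewrite sum_pair exchange_big /= -mulrA mulr_suml mulr_sumr.
  apply: eq_bigr => K2 _; rewrite -(sum_edge_coef_homog Mf' K2 ht') !mulr_suml mulr_sumr.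
  by apply: eq_bigr => K1 _; rewrite !mulr_sumr; apply: eq_bigr => f _; ring.
rewrite ext_vec_sum wedge_sumr sum_ffunE.
under [RHS]eq_bigr => s2 _ do rewrite wedgeZr ext_scaleE mxE mulr_suml.
rewrite exchange_big /= sum_pair.
have sumset (F : {set 'I_k} -> R[i]) (s : 'I_k) : \sum_J (J == [set s]%SET)%:R * F J = F [set s]%SET.
  rewrite (bigD1 [set s]%SET) //= eqxx mul1r big1 ?addr0 // => J /negbTE ->; exact: mul0r.
have [A hA] : {A : {set 'I_k} -> R[i] | forall J1, A J1 = \sum_J2 ext_map Mf' t' J2 * wedge_coef [:: I'; J1] J2} by eexists.
have [B hB] : {B : {set 'I_k} -> R[i] | forall J2, B J2 = wedge G (ext_base J2) I} by eexists.
transitivity (\sum_J1 \sum_s (J1 == [set s]%SET)%:R *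
    (A J1 * \sum_J2 \sum_t (J2 == [set t]%SET)%:R * (Ms s t * B J2))).
  apply: eq_bigr => J1 _; under [RHS]eq_bigr => s _ do rewrite !mulr_sumr.
  rewrite [RHS]exchange_big /=; apply: eq_bigr => J2 _.
  rewrite edge_coef1 -hA -hB !mulr_suml; apply: eq_bigr => s _.
  by rewrite !mulr_suml !mulr_sumr; apply: eq_bigr => j _; ring.
rewrite exchange_big /=; apply: eq_bigr => s _.
rewrite sumset exchange_big mulr_sumr /=; apply: eq_bigr => s2 _.
by rewrite sumset iota_vecE hA hB; ring.
Qed.
End EdgeWeight.

Section Invariant.
Context {R : realType} {S : marked_surface R} {K : flavour} {k : nat}.

Lemma diagram_invariantE (T : diagram S K k) (phi : edge T -> {set 'I_k}) (z : moduli_point S K k) :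
  diagram_invariant phi z = \sum_(sigma : state T)
    (\prod_x edge_coef (hol z (curve x) (tlift x)) (wt x) (sigma x)) *
    \prod_v vertex_weight phi z sigma v.
Proof.
rewrite /diagram_invariant big_mkcond; apply: eq_bigr => sigma _.
rewrite /edge_coef big_split /=.
case: (boolP (state_ok sigma)) => [/forallP h|/forallPn[x /negbTE nx]].
  by rewrite [X in X * _ * _]big1 ?mul1r // => x _; rewrite h.
by rewrite (bigD1 x) //= nx !mul0r.
Qed.
End Invariant.

Local Open Scope classical_set_scope.
Local Notation rot := Defs.rot.
Local Notation pi := trigo.pi.
Local Notation dom := Defs.dom.
Local Notation closed := topology_structure.closed.

(** * The plane *)

Section Plane.
Context {R : realType}.
Implicit Types (v w : 'rV[R]_2).

Definition vx v := v ord0 ord0.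
Definition vy v := v ord0 (lift ord0 ord0).
Definition mkv (x y : R) : 'rV[R]_2 := \row_j (if j == ord0 then x else y).

Lemma mkvx x y : vx (mkv x y) = x.
Proof. by rewrite /vx mxE eqxx. Qed.

Lemma mkvy x y : vy (mkv x y) = y.
Proof. by rewrite /vy mxE. Qed.

Lemma rv2P v w : vx v = vx w -> vy v = vy w -> v = w.
Proof.
move=> hx hy; apply/rowP => j; case: (unliftP ord0 j) => [j' ->|-> //].
by rewrite (ord1 j').
Qed.

Lemma mkv_eta v : mkv (vx v) (vy v) = v.
Proof. by apply: rv2P; rewrite ?mkvx ?mkvy. Qed.

Lemma vxD v w : vx (v + w) = vx v + vx w. Proof. by rewrite /vx mxE. Qed.
Lemma vyD v w : vy (v + w) = vy v + vy w. Proof. by rewrite /vy mxE. Qed.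
Lemma vxN v : vx (- v) = - vx v. Proof. by rewrite /vx mxE. Qed.
Lemma vyN v : vy (- v) = - vy v. Proof. by rewrite /vy mxE. Qed.
Lemma vxZ a v : vx (a *: v) = a * vx v. Proof. by rewrite /vx mxE. Qed.
Lemma vyZ a v : vy (a *: v) = a * vy v. Proof. by rewrite /vy mxE. Qed.
Lemma vx0 : vx 0 = 0. Proof. by rewrite /vx mxE. Qed.
Lemma vy0 : vy 0 = 0. Proof. by rewrite /vy mxE. Qed.

Lemma rotx a v : vx (rot a v) = vx v * cos a - vy v * sin a.
Proof. by rewrite /vx mxE eqxx. Qed.

Lemma roty a v : vy (rot a v) = vx v * sin a + vy v * cos a.
Proof. by rewrite /vy mxE. Qed.

Definition v2E := (vxD, vyD, vxN, vyN, vxZ, vyZ, vx0, vy0, rotx, roty, mkvx, mkvy).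

Lemma rotvD a b v : rot (a + b) v = rot a (rot b v).
Proof. by apply: rv2P; rewrite !v2E sinD cosD; ring. Qed.

Lemma rotv0 v : rot 0 v = v.
Proof. by apply: rv2P; rewrite !v2E sin0 cos0; ring. Qed.

Lemma rotvK a v : rot (- a) (rot a v) = v.
Proof. by rewrite -rotvD addNr rotv0. Qed.

Lemma rotvNK a v : rot a (rot (- a) v) = v.
Proof. by rewrite -rotvD addrN rotv0. Qed.

Lemma rotDr a v w : rot a (v + w) = rot a v + rot a w.
Proof. by apply: rv2P; rewrite !v2E; ring. Qed.

Lemma rotB a v w : rot a (v - w) = rot a v - rot a w.
Proof. by apply: rv2P; rewrite !v2E; ring. Qed.

Lemma rot_norm2 a v : vx (rot a v) ^+ 2 + vy (rot a v) ^+ 2 = vx v ^+ 2 + vy v ^+ 2.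
Proof.
rewrite rotx roty; transitivity ((vx v ^+ 2 + vy v ^+ 2) * (cos a ^+ 2 + sin a ^+ 2)); first by ring.
by rewrite cos2Dsin2 mulr1.
Qed.

Lemma rotZ a c v : rot a (c *: v) = c *: rot a v.
Proof. by apply: rv2P; rewrite !v2E; ring. Qed.

Lemma rot_2pi a v : rot (a + 2 * pi) v = rot a v.
Proof. by apply: rv2P; rewrite !v2E mulr_natl sinD2pi cosD2pi. Qed.

Lemma rot_eq0 a v : rot a v = 0 -> v = 0.
Proof. by move=> h; rewrite -(rotvK a v) h; apply: rv2P; rewrite !v2E; ring. Qed.

Lemma norm2_lt v e : (`|v| < e) = (`|vx v| < e) && (`|vy v| < e).
Proof.
have [e0|e0] := ltP 0 e; last first.
  by rewrite !ltNge !(le_trans e0).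
have hb : (`|v| < e) = `[< ball (0 : 'rV[R]_2) e v >].
  by apply/idP/asboolP; rewrite -ball_normE /= sub0r normrN.
rewrite hb; apply/asboolP/andP => [[_ h]|[hx hy]].
  have := h ord0 ord0; have := h ord0 (lift ord0 ord0).
  by rewrite -!ball_normE /= !mxE !sub0r !normrN.
split => // i j; rewrite (ord1 i) -ball_normE /= mxE sub0r normrN.
case: (unliftP ord0 j) => [j' ->|-> //]; by rewrite (ord1 j').
Qed.

Lemma norm2_le v e : (`|v| <= e) = (`|vx v| <= e) && (`|vy v| <= e).
Proof.
apply/idP/andP => [h|[hx hy]].
  split; apply/ler_addgt0Pl => d d0.
    have : `|v| < d + e by apply: le_lt_trans h _; rewrite ltrDr.
    by rewrite norm2_lt => /andP[/ltW].
  have : `|v| < d + e by apply: le_lt_trans h _; rewrite ltrDr.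
  by rewrite norm2_lt => /andP[_ /ltW].
apply/ler_addgt0Pl => d d0; apply/ltW; rewrite norm2_lt.
by rewrite (le_lt_trans hx) ?(le_lt_trans hy) // ltrDr.
Qed.

Lemma vx_le v : `|vx v| <= `|v|.
Proof. by have := lexx `|v|; rewrite {1}norm2_le => /andP[]. Qed.

Lemma vy_le v : `|vy v| <= `|v|.
Proof. by have := lexx `|v|; rewrite {1}norm2_le => /andP[]. Qed.

(** The norm is the maximum of the coordinates, which rotations do not preserve; hence the factor
    2. *)
Lemma norm2_rot a v : `|rot a v| <= 2 * `|v|.
Proof.
have hx := vx_le v; have hy := vy_le v.
have hc := cos_max a; have hs := sin_max a.
have b x y : `|x| <= `|v| -> `|y| <= 1 -> `|x * y| <= `|v|.
  by move=> h1 h2; rewrite normrM -[leRHS]mulr1; apply: ler_pM.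
rewrite norm2_le !v2E; apply/andP; split.
  apply: (le_trans (ler_normB _ _)); have := b _ _ hx hc; have := b _ _ hy hs; lra.
apply: (le_trans (ler_normD _ _)); have := b _ _ hx hs; have := b _ _ hy hc; lra.
Qed.

Lemma norm2_mulmx v (M : 'M[R]_2) : `|v *m M| <= 2 * `|v| * `|M|.
Proof.
have hM i j : `|M i j| <= `|M|.
  rewrite {2}/Num.norm /= mx_normrE.
  by have := le_bigmax (0 : R) (fun ij : 'I_2 * 'I_2 => `|M ij.1 ij.2|) (i, j).
have hx := vx_le v; have hy := vy_le v.
have e j : (v *m M) ord0 j = vx v * M ord0 j + vy v * M (lift ord0 ord0) j.
  by rewrite mxE !big_ord_recl big_ord0 addr0.
rewrite norm2_le; apply/andP; split; rewrite /vx /vy !e;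
  apply: (le_trans (ler_normD _ _)); rewrite !normrM -mulrA mulr_natl mulr2n;
  by apply: lerD; apply: ler_pM.
Qed.

Lemma cvg_rv2 (T : Type) (F : set_system T) (FF : Filter F) (f : T -> 'rV[R]_2) (l : 'rV[R]_2) :
  vx (f x) @[x --> F] --> vx l -> vy (f x) @[x --> F] --> vy l -> f x @[x --> F] --> l.
Proof.
move=> /cvgrPdist_lt hx /cvgrPdist_lt hy; apply/cvgrPdist_lt => e e0.
near=> x; rewrite norm2_lt !v2E; apply/andP; split; near: x; [exact: hx|exact: hy].
Unshelve. all: by end_near. Qed.

Lemma cvg_vx (T : Type) (F : set_system T) (FF : Filter F) (f : T -> 'rV[R]_2) (l : 'rV[R]_2) :
  f x @[x --> F] --> l -> vx (f x) @[x --> F] --> vx l.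
Proof.
move=> /cvgrPdist_lt h; apply/cvgrPdist_lt => e e0.
apply: filterS (h e e0) => x; rewrite norm2_lt !v2E => /andP[]; by [].
Qed.

Lemma cvg_vy (T : Type) (F : set_system T) (FF : Filter F) (f : T -> 'rV[R]_2) (l : 'rV[R]_2) :
  f x @[x --> F] --> l -> vy (f x) @[x --> F] --> vy l.
Proof.
move=> /cvgrPdist_lt h; apply/cvgrPdist_lt => e e0.
apply: filterS (h e e0) => x; rewrite norm2_lt !v2E => /andP[]; by [].
Qed.

Lemma cvg_rot (T : Type) (F : set_system T) (FF : Filter F) (a : T -> R) (f : T -> 'rV[R]_2) (a0 : R) (l : 'rV[R]_2) :
  a x @[x --> F] --> a0 -> f x @[x --> F] --> l -> rot (a x) (f x) @[x --> F] --> rot a0 l.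
Proof.
move=> ha hf.
have hc : cos (a x) @[x --> F] --> cos a0 by apply: continuous_cvg => //; exact: continuous_cos.
have hs : sin (a x) @[x --> F] --> sin a0 by apply: continuous_cvg => //; exact: continuous_sin.
have hx := cvg_vx FF hf; have hy := cvg_vy FF hf.
apply: cvg_rv2.
  under eq_fun do rewrite rotx; rewrite rotx; apply: cvgB; exact: cvgM.
under eq_fun do rewrite roty; rewrite roty; apply: cvgD; exact: cvgM.
Qed.

Lemma cvg_mulmx2 (T : Type) (F : set_system T) (FF : Filter F) (f : T -> 'rV[R]_2)
    (M : T -> 'M[R]_2) (l : 'rV[R]_2) (L : 'M[R]_2) :
  f x @[x --> F] --> l -> M x @[x --> F] --> L -> f x *m M x @[x --> F] --> l *m L.
Proof.
move=> hf hM.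
have hMij i j : M x i j @[x --> F] --> L i j.
  exact: (cvg_comp _ _ hM (@coord_continuous _ 2 2 i j L)).
have hx := cvg_vx FF hf; have hy := cvg_vy FF hf.
have e (v : 'rV[R]_2) (A : 'M[R]_2) j : (v *m A) ord0 j = vx v * A ord0 j + vy v * A (lift ord0 ord0) j.
  by rewrite mxE !big_ord_recl big_ord0 addr0.
apply: cvg_rv2; rewrite /vx /vy; under eq_fun do rewrite e; rewrite e;
  by apply: cvgD; apply: cvgM.
Qed.
End Plane.

Section Within.
Context {X Y Z : topologicalType}.

Lemma withinP (A : set X) (f : X -> Y) : {within A, continuous f} <->
  forall x, A x -> f y @[y --> within A (nbhs x)] --> f x.
Proof. exact: subspace_continuousP. Qed.

Lemma within_comp (A : set X) (B : set Y) (f : X -> Y) (g : Y -> Z) :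
  {within A, continuous f} -> {within B, continuous g} -> (forall x, A x -> B (f x)) ->
  {within A, continuous (g \o f)}.
Proof.
move=> /subspace_continuousP cf /subspace_continuousP cg AB.
apply/subspace_continuousP => x Ax N hN.
have := cg _ (AB _ Ax) N hN => h.
have h' : nbhs x (fun t => A t -> B (f t) -> N (g (f t))) := cf x Ax _ h.
suff : nbhs x (fun t => A t -> N (g (f t))) by [].
by apply: filterS h' => t ht At; exact: ht At (AB _ At).
Qed.
End Within.

(** * Charts at a puncture *)

Lemma nbhs_norm_lt (R : realType) (V : normedModType R) (x : V) (P : set V) :
  nbhs x P -> exists2 r : R, 0 < r & forall y, `|y - x| < r -> P y.
Proof.
move=> /nbhs_normP[r /= r0 h].
by exists r => // y yr; apply: h; rewrite /= distrC.
Qed.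

Lemma ball_nbhs (R : realType) (V : normedModType R) (x : V) (P : set V) (r : R) :
  0 < r -> (forall y, `|y - x| < r -> P y) -> nbhs x P.
Proof.
by move=> r0 h; apply/nbhs_normP; exists r => // y /= yr; apply: h; rewrite distrC.
Qed.

Lemma cvg_near (T : Type) (U : topologicalType) (F : set_system T) (f : T -> U) (l : U) (P : set U) :
  f @ F --> l -> nbhs l P -> F (fun t => P (f t)).
Proof. by move=> c h; exact: c. Qed.

Lemma eq_small (R : realType) (V : normedModType R) (a : V) (C : R) :
  (forall e, 0 < e -> e <= 1 -> `|a| <= e * C) -> a = 0.
Proof.
move=> h; apply/eqP; rewrite -normr_le0; apply/ler_addgt0Pl => d d0; rewrite addr0.
have C1 : 0 < `|C| + 1 by rewrite ltr_pwDr.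
have dC : 0 < d / (`|C| + 1) by apply: divr_gt0.
have m0 : 0 < Num.min 1 (d / (`|C| + 1)) by rewrite lt_min ltr01.
have m1 : Num.min 1 (d / (`|C| + 1)) <= 1 by rewrite ge_min lexx.
have m2 : Num.min 1 (d / (`|C| + 1)) <= d / (`|C| + 1) by rewrite ge_min lexx orbT.
apply: (le_trans (h _ m0 m1)).
apply: (@le_trans _ _ (Num.min 1 (d / (`|C| + 1)) * (`|C| + 1))).
  by apply: ler_wpM2l; [exact: ltW|rewrite (le_trans (ler_norm C)) // lerDl].
by apply: (le_trans (ler_wpM2r (ltW C1) m2)); rewrite divfK ?gt_eqF.
Qed.

Lemma line_cvg (R : realType) (V : normedModType R) (x v : V) :
  (fun t : R => x + t *: v) @ (0 : R) --> x.
Proof.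
rewrite -[X in _ --> X]addr0 -(scale0r v); apply: cvgD; first exact: cvg_cst.
by apply: cvgZr_tmp; exact: cvg_id.
Qed.

Section Disc.
Context {R : realType} {S : surface R} (p : S) (i0 : chart_ix S).
Hypotheses (dp : dom i0 p) (np : ~ bdry S p).
Let x0 := chart i0 p.

(** At an interior point the half-plane constraint is inactive, so the image of the chart contains a
    full ball. *)
Lemma disc_exists : exists2 r : R, 0 < r & forall x, `|x - x0| < r ->
  0 < vy x /\ exists2 y, dom i0 y & chart i0 y = x.
Proof.
have [B oB eB] := chart_open (dom_open i0) (@subset_refl _ (dom i0)).
have [Bx0 hx0] : (B `&` half_plane) x0 by rewrite -eB; exists p.
have y0 : 0 < vy x0.
  rewrite lt_neqAle hx0 andbT eq_sym; apply/eqP => h; apply: np; exists i0 => //.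
have n1 : \forall x \near x0, B x by apply: open_nbhs_nbhs.
have n2 : \forall x \near x0, 0 < vy x.
  have := cvg_vy (nbhs_filter x0) (@cvg_id _ (nbhs x0)) => /cvgrPdist_lt/(_ _ y0).
  by apply: filterS => x; rewrite ltr_norml => /andP[_]; rewrite ltrBlDr => h; lra.
have [r r0 hr] := nbhs_norm_lt (filterI n1 n2).
exists r => // x /hr[Bx yx]; split=> //.
have : (B `&` half_plane) x by split=> //; exact: ltW.
by rewrite -eB => -[y dy <-]; exists y.
Qed.

Variable r0 : R.
Hypothesis disc : forall x, `|x - x0| < r0 ->
  0 < vy x /\ exists2 y, dom i0 y & chart i0 y = x.

(** The inverse of the chart [i0], with default value [p] off its image. *)
Definition psi (x : 'rV[R]_2) : S := xget p [set y | dom i0 y /\ chart i0 y = x].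

Lemma psiP x : `|x - x0| < r0 -> dom i0 (psi x) /\ chart i0 (psi x) = x.
Proof.
move=> /disc[_ [y dy ey]].
suff : [set y | dom i0 y /\ chart i0 y = x] (psi x) by [].
exact: (@xgetI _ p _ y).
Qed.

Lemma psi_chart y : dom i0 y -> psi (chart i0 y) = y.
Proof.
move=> dy; have : [set z | dom i0 z /\ chart i0 z = chart i0 y] (psi (chart i0 y)).
  exact: (@xgetI _ p _ y).
by move=> [dz /(chart_inj dz dy)].
Qed.

Lemma near_disc x : `|x - x0| < r0 -> \forall x' \near x, `|x' - x0| < r0.
Proof.
move=> xr; apply: (@ball_nbhs _ _ _ _ (r0 - `|x - x0|)); first by rewrite subr_gt0.
by move=> y yr; rewrite -(subrK x y) -addrA (le_lt_trans (ler_normD _ _)) // -ltrBrDr.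
Qed.

Lemma psi_continuous x : `|x - x0| < r0 -> psi x' @[x' --> x] --> psi x.
Proof.
move=> xr N; have [dx ex] := psiP xr; rewrite nbhsE => -[A [oA Ax] AN].
have [B oB eB] := chart_open (openI oA (dom_open i0)) (@subIsetr _ A (dom i0)).
have [Bx _] : (B `&` half_plane) x by rewrite -eB; exists (psi x).
have n1 : \forall x' \near x, B x' by apply: open_nbhs_nbhs.
suff : \forall x' \near x, N (psi x') by [].
near=> x'; apply: AN.
have x'r : `|x' - x0| < r0 by near: x'; exact: near_disc.
have : (B `&` half_plane) x'.
  split; first by near: x'.
  by apply: ltW; case: (disc x'r).
by rewrite -eB => -[y [Ay dy] <-]; rewrite psi_chart.
Unshelve. all: by end_near. Qed.

Lemma psi_diff x i : `|x - x0| < r0 -> dom i (psi x) -> forall e : R, 0 < e ->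
  \forall x' \near x, dom i (psi x') /\
    `|chart i (psi x') - chart i (psi x) - (x' - x) *m dtrans i0 i (psi x)| <= e * `|x' - x|.
Proof.
move=> xr di e e0; have [dx ex] := psiP xr.
have c := psi_continuous xr.
have h1 : \forall x' \near x, dom i (psi x').
  by apply: c; apply: open_nbhs_nbhs; split => //; exact: dom_open.
have h2 := cvg_near c (dtrans_diff dx di e0).
apply: filterS3 h1 h2 (near_disc xr) => x' dx' + x'r.
by rewrite /= ex (psiP x'r).2.
Qed.

Lemma psi_line x i : `|x - x0| < r0 -> dom i (psi x) -> forall e : R, 0 < e -> forall v,
  \forall t \near (0 : R), dom i (psi (x + t *: v)) /\
    `|chart i (psi (x + t *: v)) - chart i (psi x) - t *: (v *m dtrans i0 i (psi x))|
      <= e * `|t| * `|v|.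
Proof.
move=> xr di e e0 v; have h := psi_diff xr di e0.
have c := @line_cvg _ _ x v.
apply: filterS (cvg_near c h) => t [d1].
have -> : x + t *: v - x = t *: v by rewrite (addrC x) addrK.
by rewrite -scalemxAl normrZ mulrA.
Qed.

(** A differential is unique where all directions are available. On the disc this gives the identity
    here and, with the chain rule, the cocycle relation below. *)
Lemma dtrans_id x : `|x - x0| < r0 -> dtrans i0 i0 (psi x) = 1%:M.
Proof.
move=> xr; have [dx ex] := psiP xr; apply/row_matrixP => j.
rewrite rowE [RHS]rowE mulmx1; set v := delta_mx 0 j.
apply/eqP; rewrite eq_sym -subr_eq0; apply/eqP; apply: (@eq_small _ _ _ `|v|) => e e0 _.
have h := psi_line xr dx e0 v.
have c := @line_cvg _ _ x v.
have [d d0 hd] := nbhs_norm_lt (filterI h (cvg_near c (near_disc xr))).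
have [] := hd (d / 2); first by rewrite subr0 ger0_norm ?divr_ge0 ?(ltW d0) // ltr_pdivrMr // mulr_natr mulr2n ltrDl.
move=> [_ hh] /= h2; move: hh; rewrite (psiP h2).2 ex (addrC x) addrK -scalerBr normrZ.
have d2 : 0 < d / 2 by rewrite divr_gt0.
rewrite (gtr0_norm d2); have -> : e * (d / 2) * `|v| = (d / 2) * (e * `|v|) by ring.
by rewrite ler_pM2l.
Qed.

Lemma near0_pos (P : set R) : nbhs (0 : R) P -> exists2 t : R, 0 < t & P t.
Proof.
move=> /nbhs_norm_lt[d d0 hd]; exists (d / 2); first by rewrite divr_gt0.
by apply: hd; rewrite subr0 ger0_norm ?divr_ge0 ?(ltW d0) // ltr_pdivrMr // mulr_natr mulr2n ltrDl.
Qed.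

Lemma dtrans_cocycle x j j' : `|x - x0| < r0 -> dom j (psi x) -> dom j' (psi x) ->
  dtrans i0 j' (psi x) = dtrans i0 j (psi x) *m dtrans j j' (psi x).
Proof.
move=> xr dj dj'; have [dx ex] := psiP xr; apply/row_matrixP => l.
rewrite rowE [RHS]rowE mulmxA; set v := delta_mx 0 l.
set A := v *m dtrans i0 j (psi x); set M := dtrans j j' (psi x).
apply/eqP; rewrite -subr_eq0; apply/eqP.
apply: (@eq_small _ _ _ (`|v| + (`|A| + `|v|) + 2 * `|v| * `|M|)) => e e0 e1.
have h1 := psi_line xr dj e0 v.
have h2 := psi_line xr dj' e0 v.
have h3 := cvg_near (cvg_trans (cvg_app psi (@line_cvg _ _ x v)) (psi_continuous xr)) (dtrans_diff dj dj' e0).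
have [t t0 [[] [_ a1] [_ a2] a3]] := near0_pos (filterI (filterI h1 h2) h3).
move: a1 a2 a3; rewrite /= -/A -/M.
set a := chart j _ - chart j _; set b := chart j' _ - chart j' _ => a1 a2 a3.
rewrite (gtr0_norm t0) in a1 a2.
have a4 : `|a| <= t * (`|A| + `|v|).
  rewrite -(subrK (t *: A) a) (le_trans (ler_normD _ _)) // normrZ (gtr0_norm t0).
  rewrite mulrDr addrC lerD2l (le_trans a1) //; apply: ler_wpM2r => //.
  by rewrite ler_piMl // ltW.
have a5 : `|(a - t *: A) *m M| <= 2 * (e * t * `|v|) * `|M|.
  by apply: (le_trans (norm2_mulmx _ _)); apply: ler_wpM2r => //; apply: ler_wpM2l.
have key : t *: (v *m dtrans i0 j' (psi x) - A *m M) =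
    - (b - t *: (v *m dtrans i0 j' (psi x))) + (b - a *m M) + (a - t *: A) *m M.
  by rewrite (mulmxBl a (t *: A)) -scalemxAl scalerBr; apply/rowP => q; rewrite !mxE; ring.
set w := v *m _ - _ in key *.
have nt : t * `|w| = `|t *: w| by rewrite normrZ (gtr0_norm t0).
rewrite -(ler_pM2l t0) nt key.
apply: (le_trans (ler_normD _ _)); apply: (@le_trans _ _ (e * t * `|v| + e * (t * (`|A| + `|v|)) + 2 * (e * t * `|v|) * `|M|)).
  apply: lerD => //; apply: (le_trans (ler_normD _ _)); rewrite normrN; apply: lerD => //.
  by apply: (le_trans a3); apply: ler_wpM2l => //; exact: ltW.
by rewrite le_eqVlt; apply/orP; left; apply/eqP; ring.
Qed.

(** The boundary is defined through the existence of a chart. If some chart sent a point of the disc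
    to the boundary line, moving in the direction whose image is (0, -1) would leave the
    half-plane. *)
Lemma psi_nbdry x : `|x - x0| < r0 -> ~ bdry S (psi x).
Proof.
move=> xr [i di hi].
have [B oB eB] := chart_open (dom_open i) (@subset_refl _ (dom i)).
have hp y : dom i y -> 0 <= vy (chart i y).
  move=> dy; suff : (B `&` half_plane) (chart i y) by case.
  by rewrite -eB; exists y.
have [dx ex] := psiP xr.
set D := dtrans i0 i (psi x).
have uD : D \in unitmx by rewrite unitmxE unitfE gt_eqF // dtrans_oriented.
pose v := mkv 0 (-1) *m invmx D.
have vD : v *m D = mkv 0 (-1) by rewrite /v mulmxKV.
(* With this precision the error of the linearization is less than the downward displacement t. *)
have e0 : 0 < (2 * (`|v| + 1))^-1 :> R by rewrite invr_gt0 mulr_gt0 // ltr_wpDl.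
have [t t0 [dt ht]] := near0_pos (psi_line xr di e0 v).
have := le_trans (vy_le _) ht; rewrite !v2E vD !v2E.
have -> : vy (chart i (psi x)) = 0 by [].
have h1 := hp _ dt; rewrite (gtr0_norm t0).
have h2 : (2 * (`|v| + 1))^-1 * t * `|v| < t.
  have n0 := normr_ge0 v; set n := `|v| in n0 *.
  rewrite mulrAC -[ltRHS]mul1r ltr_pM2r //.
  rewrite mulrC ltr_pdivrMr ?mul1r; lra.
rewrite ler_norml => /andP[_ h3]; lra.
Qed.

Definition frame_at (y : S) (v : 'rV[R]_2) : frame S := fun j => v *m dtrans i0 j y.

Lemma frame_at_tangent x v : `|x - x0| < r0 -> v != 0 -> nonzero_tangent (psi x) (frame_at (psi x) v).
Proof.
move=> xr v0; split=> [i j di dj|i di].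
  by rewrite /frame_at (dtrans_cocycle xr di dj) mulmxA.
have uD : dtrans i0 i (psi x) \in unitmx.
  by rewrite unitmxE unitfE gt_eqF // dtrans_oriented //; exact: (psiP xr).1.
by move=> h; move/eqP: v0; apply; rewrite -(mulmxK uD v) -/(frame_at _ _ i) h mul0mx.
Qed.

Lemma frame_at_id x v : `|x - x0| < r0 -> frame_at (psi x) v i0 = v.
Proof. by move=> xr; rewrite /frame_at dtrans_id // mulmx1. Qed.

Lemma tangent_frame_at y d : dom i0 y -> tangent y d -> same_vec y d (frame_at y (d i0)).
Proof. by move=> dy td i di; rewrite (td i0 i). Qed.
End Disc.

(** * Polar coordinates at a puncture *)

Lemma conv_lt (R : realType) (s x y r : R) : 0 <= s -> s <= 1 -> x < r -> y < r ->
  (1 - s) * x + s * y < r.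
Proof.
move=> s0 s1 xr yr; have [xy|yx] := leP x y.
  apply: le_lt_trans yr; nra.
apply: le_lt_trans xr; nra.
Qed.

Lemma conv_gt (R : realType) (s x y r : R) : 0 <= s -> s <= 1 -> r < x -> r < y ->
  r < (1 - s) * x + s * y.
Proof.
move=> s0 s1 xr yr; have [xy|yx] := leP x y.
  apply: (lt_le_trans xr); nra.
apply: (lt_le_trans yr); nra.
Qed.

Section FramedExt.
Context {R : realType} {S : marked_surface R}.

Lemma framed_family_ext (G G' : R -> R -> S) (W W' : R -> R -> frame S) :
  (forall s t, unit_itv s -> unit_itv t -> G s t = G' s t /\ same_vec (G s t) (W s t) (W' s t)) ->
  framed_family G W -> framed_family G' W'.
Proof.
move=> e [h1 h2 h3 h4 h5]; split.
- apply/withinP => st sst; move/withinP: h1 => /(_ st sst).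
  rewrite /= (e _ _ sst.1 sst.2).1; apply: cvg_trans; apply: fmap_within_eq => -[s t] /set_mem[s1 t1] /=.
  by rewrite (e _ _ s1 t1).1.
- move=> s t s1 t1; rewrite -(e _ _ s1 t1).1.
  have [h hn] := h2 s t s1 t1; have [_ sv] := e s t s1 t1; split.
    by move=> i j di dj; rewrite -!sv //; exact: h.
  by move=> i di; rewrite -sv //; exact: hn.
- move=> i; apply/withinP => st [sst dst].
  have dst' : dom i (G st.1 st.2) by rewrite (e _ _ sst.1 sst.2).1.
  move/withinP: (h3 i) => /(_ st (conj sst dst')).
  rewrite /= ((e _ _ sst.1 sst.2).2 i dst').
  have -> : [set st | unit_square st /\ dom i (G' st.1 st.2)] = [set st | unit_square st /\ dom i (G st.1 st.2)].
    by apply/seteqP; split => -[s t] /= [sq]; rewrite (e _ _ sq.1 sq.2).1.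
  apply: cvg_trans; apply: fmap_within_eq => -[s t] /set_mem[[s1 t1] dd] /=.
  by rewrite ((e _ _ s1 t1).2 i dd).
- by move=> s t s1 t1 t0; rewrite -(e _ _ s1 t1).1; exact: h4.
- have i0 : unit_itv (0 : R) by rewrite /unit_itv /= lexx ler01.
  case: h5 => [h5|[p pp [hp h5]]]; [left|right].
    by move=> s s1; rewrite -(e _ _ s1 i0).1; exact: h5.
  exists p => //; split=> [s s1|]; first by rewrite -(e _ _ s1 i0).1; exact: hp.
  move=> i di eps eps0; have [r r0 hr] := h5 i di eps eps0; exists r => // s t s1 t0 t1.
  have [c c0 hc] := hr s t s1 t0 t1; exists c => //.
  have tI : unit_itv t by case/andP: t0 => t0 _; rewrite /unit_itv /= (ltW t0).
  by rewrite -(e _ _ s1 tI).1 -((e _ _ s1 i0).2 i) ?hp.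
Qed.

Context {K : flavour} {k : nat} (z : moduli_point S K k).

Lemma unit_itv0 : unit_itv (0 : R). Proof. by rewrite /unit_itv /= lexx ler01. Qed.
Lemma unit_itv1 : unit_itv (1 : R). Proof. by rewrite /unit_itv /= lexx ler01. Qed.

Lemma hol_ext (g g' : R -> S) (w w' : R -> frame S) : framed_path g w ->
  (forall t, unit_itv t -> g t = g' t /\ same_vec (g t) (w t) (w' t)) ->
  hol z g w = hol z g' w'.
Proof.
move=> fg e.
(* The arguments of [hol] are functions on all of [R], related only by homotopies. As the two paths
   agree on [0, 1], a family that jumps from one to the other is still continuous on the unit
   square. *)
have ff : framed_family (fun s => if s == 0 then g else g') (fun s => if s == 0 then w else w').
  apply: framed_family_ext fg => s t s1 t1; case: (s == 0); [by split|exact: e].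
have := hol_homotopy z ff; rewrite /= eqxx oner_eq0; apply => s s1.
have [e0 e0'] := e 0 unit_itv0; have [e1 e1'] := e 1 unit_itv1.
case: (s == 0); first by split.
by split; rewrite ?e0 ?e1 // => i di; symmetry; [apply: e0'; rewrite e0|apply: e1'; rewrite e1].
Qed.

Lemma hol_unit (g : R -> S) (w : R -> frame S) : framed_path g w -> hol z g w \in unitmx.
Proof. by move=> h; rewrite unitmxE (hol_SL z h) unitr1. Qed.
End FramedExt.

(** * Parallel transport in polar coordinates *)

Section Polar.
Context {R : realType} {S : marked_surface R} (p : S) (i0 : chart_ix S).
Hypotheses (dp : dom i0 p) (pp : puncture p).
Let np : ~ bdry S p := pp.2.
Let x0 := chart i0 p.
Variable r0 : R.
Hypothesis r0_gt0 : 0 < r0.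
Hypothesis disc : forall x, `|x - x0| < r0 ->
  0 < vy x /\ exists2 y, dom i0 y & chart i0 y = x.
Hypothesis disc_marked : forall x, `|x - x0| < r0 -> marked S (psi p i0 x) -> x = x0.

(* A point of the disc and a tangent vector at this point: the polar
   coordinates (r, theta) of the point, and the coordinates (m1, m2) of the
   vector in the basis given by the radial and the angular directions. *)
Definition param := (R * R * R * R)%type.
Definition prad (a : param) := a.1.1.1.
Definition pang (a : param) := a.1.1.2.
Definition pm1 (a : param) := a.1.2.
Definition pm2 (a : param) := a.2.

Definition plane_pt (a : param) := x0 + rot (pang a) (mkv (prad a) 0).
Definition Pt (a : param) : S := psi p i0 (plane_pt a).
Definition Fr (a : param) : frame S :=
  frame_at i0 (Pt a) (rot (pang a) (mkv (pm1 a) (pm2 a))).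

(** A positive radial component makes the vector nonzero and is a convex condition, so segments
    between regular parameters are regular. *)
Definition regular (a : param) := 0 < prad a < r0 /\ 0 < pm1 a.
(** At radius 0 the angle records the direction of the tangent vector at [p], which is therefore
    purely radial. *)
Definition initial (a : param) := [/\ prad a = 0, 0 < pm1 a & pm2 a = 0].

Record cpath (a : R -> param) : Prop := {
  crad : {within unit_itv, continuous (fun t => prad (a t))};
  cang : {within unit_itv, continuous (fun t => pang (a t))};
  cm1 : {within unit_itv, continuous (fun t => pm1 (a t))};
  cm2 : {within unit_itv, continuous (fun t => pm2 (a t))} }.

Definition rpath a := cpath a /\ forall t, unit_itv t -> regular (a t).
Definition ipath a := [/\ cpath a, initial (a 0) & forall t, unit_itv t -> 0 < t -> regular (a t)].

Definition lin (a b : param) (s : R) : param :=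
  ((1 - s) * prad a + s * prad b, (1 - s) * pang a + s * pang b,
   (1 - s) * pm1 a + s * pm1 b, (1 - s) * pm2 a + s * pm2 b).

Lemma lin0 a b : lin a b 0 = a.
Proof. by case: a => [[[? ?] ?] ?]; rewrite /lin /= subr0 !mul1r !mul0r !addr0. Qed.

Lemma lin1 a b : lin a b 1 = b.
Proof. by case: b => [[[? ?] ?] ?]; rewrite /lin /= subrr !mul1r !mul0r !add0r. Qed.

Lemma linxx a s : lin a a s = a.
Proof.
case: a => [[[x y] u] v]; rewrite /lin /prad /pang /pm1 /pm2 /=.
have h (w : R) : (1 - s) * w + s * w = w by rewrite -mulrDl subrK mul1r.
by rewrite !h.
Qed.

Lemma plane_pt_norm a : 0 <= prad a < r0 -> `|plane_pt a - x0| < r0.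
Proof.
move=> /andP[a0 ar]; rewrite /plane_pt addrC addKr norm2_lt !v2E !mul0r subr0 addr0.
rewrite !normrM (ger0_norm a0); apply/andP; split; apply: le_lt_trans ar;
  by rewrite ler_piMr // ?cos_max ?sin_max.
Qed.

Lemma regular_norm a : regular a -> `|plane_pt a - x0| < r0.
Proof. by move=> [/andP[h1 h2] _]; apply: plane_pt_norm; rewrite (ltW h1). Qed.

Lemma initial_pt a : initial a -> plane_pt a = x0.
Proof. by case=> h _ _; rewrite /plane_pt h; apply: rv2P; rewrite !v2E; ring. Qed.

Lemma initial_Pt a : initial a -> Pt a = p.
Proof. by move=> h; rewrite /Pt initial_pt // psi_chart. Qed.

Lemma initial_norm a : initial a -> `|plane_pt a - x0| < r0.
Proof. by move=> /initial_pt ->; rewrite subrr normr0. Qed.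

Lemma regular_neq a : regular a -> plane_pt a <> x0.
Proof.
move=> [/andP[h1 _] _] h; have : rot (pang a) (mkv (prad a) 0) = 0.
  by apply: (addrI x0); rewrite addr0.
move/rot_eq0 => /(congr1 vx); rewrite mkvx vx0 => e; by rewrite e ltxx in h1.
Qed.

Lemma regular_puncture a : regular a -> ~ puncture (Pt a).
Proof.
move=> ra [mp _]; exact: (regular_neq ra (disc_marked (regular_norm ra) mp)).
Qed.

Lemma Fr_tangent a : `|plane_pt a - x0| < r0 -> 0 < pm1 a -> nonzero_tangent (Pt a) (Fr a).
Proof.
move=> ha m0; apply: (frame_at_tangent disc) => //; apply/eqP => /rot_eq0/(congr1 vx).
by rewrite mkvx vx0 => e; rewrite e ltxx in m0.
Qed.

Lemma regular_lin a b s : unit_itv s -> regular a -> regular b -> regular (lin a b s).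
Proof.
move=> /andP[s0 s1] [/andP[a1 a2] a3] [/andP[b1 b2] b3]; rewrite /regular /prad /pm1 /=.
rewrite -/(prad a) -/(prad b) -/(pm1 a) -/(pm1 b).
have h x y : 0 < x -> 0 < y -> 0 < (1 - s) * x + s * y by move=> hx hy; nra.
by split; [rewrite h //=; exact: conv_lt|exact: h].
Qed.

Lemma initial_lin a b s : unit_itv s -> initial a -> initial b -> initial (lin a b s).
Proof.
move=> /andP[s0 s1] [a1 a2 a3] [b1 b2 b3]; rewrite /initial /prad /pm1 /pm2 /=.
rewrite -/(prad a) -/(prad b) -/(pm1 a) -/(pm1 b) -/(pm2 a) -/(pm2 b) a1 b1 a3 b3 !mulr0 addr0.
by split=> //; nra.
Qed.

Lemma within_snd (f : R -> R) : {within unit_itv, continuous f} ->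
  {within unit_square, continuous (fun st : R * R => f st.2)}.
Proof.
move=> cf; apply: (@within_comp _ _ _ unit_square unit_itv snd f) => //; last by move=> st [].
by apply: continuous_subspaceT => st; exact: cvg_snd.
Qed.

Lemma within_mix (f g : R -> R) : {within unit_itv, continuous f} -> {within unit_itv, continuous g} ->
  {within unit_square, continuous (fun st : R * R => (1 - st.1) * f st.2 + st.1 * g st.2)}.
Proof.
move=> /within_snd/withinP cf /within_snd/withinP cg.
apply/withinP => st sst.
have c1 : st'.1 @[st' --> within unit_square (nbhs st)] --> st.1.
  by apply: cvg_within_filter; exact: cvg_fst.
apply: cvgD; apply: cvgM => //; [|exact: cf|exact: cg].
by apply: cvgB => //; exact: cvg_cst.
Qed.

Section Mix.
Variables a b : R -> param.
Hypothesis ab : (rpath a /\ rpath b) \/ (ipath a /\ ipath b).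
Let A (s t : R) := lin (a t) (b t) s.

Let ca : cpath a. Proof. by case: ab => [[[]]|[[]]]. Qed.
Let cb : cpath b. Proof. by case: ab => [[_ []]|[_ []]]. Qed.

Let Areg s t : unit_itv s -> unit_itv t -> 0 < t -> regular (A s t).
Proof.
move=> s1 t1 t0; case: ab => [[[_ ra] [_ rb]]|[[_ _ ra] [_ _ rb]]].
  by apply: regular_lin; [|exact: ra|exact: rb].
by apply: regular_lin; [|exact: ra|exact: rb].
Qed.

Let Anorm s t : unit_itv s -> unit_itv t -> `|plane_pt (A s t) - x0| < r0 /\ 0 < pm1 (A s t).
Proof.
move=> s1 t1; have [t0|t0] := ltP 0 t.
  by have h := Areg s1 t1 t0; split; [exact: regular_norm|case: h].
have -> : t = 0 by apply/eqP; rewrite eq_le t0; case/andP: t1.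
case: ab => [[[_ ra] [_ rb]]|[[_ ra _] [_ rb _]]].
  have h : regular (A s 0) by apply: regular_lin; [|exact: ra unit_itv0|exact: rb unit_itv0].
  by split; [exact: regular_norm|case: h].
have h : initial (A s 0) by exact: initial_lin.
by split; [exact: initial_norm|case: h].
Qed.

Let cplane st : unit_square st ->
  plane_pt (A st'.1 st'.2) @[st' --> within unit_square (nbhs st)] --> plane_pt (A st.1 st.2).
Proof.
move=> sst; apply: cvgD; first exact: cvg_cst.
move: (within_mix (crad ca) (crad cb)) => /withinP /(_ st sst) h1.
move: (within_mix (cang ca) (cang cb)) => /withinP /(_ st sst) h2.
apply: cvg_rot => //; apply: cvg_rv2; under eq_fun do rewrite !v2E; rewrite !v2E //.
exact: cvg_cst.
Qed.

Let cPt st : unit_square st ->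
  Pt (A st'.1 st'.2) @[st' --> within unit_square (nbhs st)] --> Pt (A st.1 st.2).
Proof.
move=> sst; apply: cvg_comp (cplane sst) _; apply: (psi_continuous disc).
exact: (Anorm sst.1 sst.2).1.
Qed.

Lemma rot_near1 e : 0 < e -> exists2 d : R, 0 < d & forall x : R, `|x| < d ->
  `|rot x (mkv 1 0) - mkv 1 0| < e.
Proof.
move=> e0; have c : rot x (mkv 1 0) @[x --> (0 : R)] --> rot (0 : R) (mkv 1 0).
  apply: cvg_rot; [exact: cvg_id|exact: cvg_cst].
rewrite rotv0 in c; move/cvgrPdist_lt: c => /(_ e e0) /nbhs_norm_lt[d d0 hd]; exists d => // x xd.
by rewrite distrC; apply: hd; rewrite subr0.
Qed.

Lemma within0 (f : R -> R) e : {within unit_itv, continuous f} -> 0 < e ->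
  exists2 d : R, 0 < d & forall t, unit_itv t -> t < d -> `|f t - f 0| < e.
Proof.
move=> /withinP /(_ 0 unit_itv0) /cvgrPdist_lt /(_ e) h /h.
rewrite /within /= => /nbhs_norm_lt[d d0 hd]; exists d => // t t1 td.
rewrite distrC; apply: hd => //; rewrite subr0 ger0_norm //; by case/andP: t1.
Qed.

(** The source of the homotopies near the puncture: interpolation in polar coordinates. The delicate
    condition is the departure from [p] in the prescribed direction, uniformly in s; it holds
    because the radius tends to 0 and the angle to its initial value uniformly. *)
Lemma framed_mix : framed_family (fun s t => Pt (A s t)) (fun s t => Fr (A s t)).
Proof.
split.
- by apply/withinP => st sst; exact: cPt.
- by move=> s t s1 t1; have [h1 h2] := Anorm s1 t1; exact: Fr_tangent.
- move=> i; apply/withinP => st [sst dst].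
  have sub (T : topologicalType) (f : R * R -> T) (l : T) :
      f st' @[st' --> within unit_square (nbhs st)] --> l ->
      f st' @[st' --> within [set st | unit_square st /\ dom i (Pt (A st.1 st.2))] (nbhs st)] --> l.
    by apply: cvg_trans; apply: cvg_app; apply: within_subset => x [].
  apply: cvg_mulmx2.
    apply: sub.
    move: (within_mix (cang ca) (cang cb)) => /withinP /(_ st sst) h1.
    move: (within_mix (cm1 ca) (cm1 cb)) => /withinP /(_ st sst) h2.
    move: (within_mix (cm2 ca) (cm2 cb)) => /withinP /(_ st sst) h3.
    by apply: cvg_rot => //; apply: cvg_rv2; under eq_fun do rewrite !v2E; rewrite !v2E.
  have dx := (psiP disc (Anorm sst.1 sst.2).1).1.
  apply: (cvg_comp _ _ (sub _ _ _ (cPt sst))); exact: (dtrans_continuous dx dst).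
- by move=> s t s1 t1 t0; apply: regular_puncture; exact: Areg.
- case: ab => [[[_ ra] [_ rb]]|[[_ ia ra] [_ ib rb]]]; [left|right].
    move=> s s1; apply: regular_puncture; apply: regular_lin => //.
      exact: ra unit_itv0.
    exact: rb unit_itv0.
  exists p => //; split=> [s s1|i di e e0].
    by apply: initial_Pt; exact: initial_lin.
  have [a1 a2 a3] := ia; have [b1 b2 b3] := ib.
  (* A bound for the initial radial components of the whole family, which makes the precisions below
     independent of s. *)
  set M := pm1 (a 0) + pm1 (b 0); have M0 : 0 < M by exact: addr_gt0.
  set D := dtrans i0 i p.
  have [d1 d10 h1] := nbhs_norm_lt (psi_diff disc (i := i) (x := x0) (e := e / (2 * M)) ltac:(by rewrite subrr normr0) ltac:(by rewrite psi_chart) ltac:(by rewrite divr_gt0 // mulr_gt0)).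
  have D0 : 0 < 4 * `|D| + 1 by rewrite ltr_wpDl // mulr_ge0.
  have e20 : 0 < e / (2 * M * (4 * `|D| + 1)) by rewrite divr_gt0 // !mulr_gt0.
  have [d2 d20 h2] := rot_near1 e20.
  have [ta ta0 ha] := within0 (cang ca) d20.
  have [tb tb0 hb] := within0 (cang cb) d20.
  have [sa sa0 ka] := within0 (crad ca) d10.
  have [sb sb0 kb] := within0 (crad cb) d10.
  exists (Num.min (Num.min ta tb) (Num.min sa sb)); first by rewrite !lt_min ta0 tb0 sa0 sb0.
  move=> s t s1 /andP[t0]; rewrite !lt_min => /andP[/andP[tta ttb] /andP[tsa tsb]] t1.
  have tI : unit_itv t by rewrite /unit_itv /= ltW.
  have ms : 0 < pm1 (A s 0) <= M.
    case/andP: s1 => s0 s1; rewrite /A /lin /pm1 /= -/(pm1 (a 0)) -/(pm1 (b 0)) /M.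
    by apply/andP; split; nra.
  case/andP: ms => m0 mM.
  have [rr _] := Areg s1 tI t0; case/andP: rr => rr0 rr1.
  (* This multiple of the initial vector is the radius times the unit vector in the initial
     direction. *)
  exists (prad (A s t) / pm1 (A s 0)); first by rewrite divr_gt0.
  have -> : chart i p = chart i (psi p i0 x0) by rewrite psi_chart.
  have xd : `|plane_pt (A s t) - x0| < d1.
    have hr : prad (A s t) < d1.
      have := ka t tI tsa; have := kb t tI tsb; rewrite a1 b1 !subr0.
      rewrite !ltr_norml => /andP[_ q1] /andP[_ q2].
      case/andP: s1 => s0 s1; rewrite /A /lin /prad /= -/(prad (a t)) -/(prad (b t)); exact: conv_lt.
    rewrite /plane_pt addrC addKr norm2_lt !v2E !mul0r subr0 addr0 !normrM (gtr0_norm rr0).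
    by apply/andP; split; apply: le_lt_trans hr; rewrite ler_piMr ?cos_max ?sin_max // ltW.
  have [_ k1] := h1 _ xd.
  set r := prad (A s t) in rr0 rr1 *; set m := pm1 (A s 0) in m0 mM *.
  have xr : `|plane_pt (A s t) - x0| <= r.
    rewrite /plane_pt addrC addKr norm2_le !v2E !mul0r subr0 addr0 !normrM (gtr0_norm rr0).
    by apply/andP; split; rewrite ler_piMr ?cos_max ?sin_max // ltW.
  have Pp : Pt (A s 0) = p by apply: initial_Pt; exact: initial_lin.
  set del := pang (A s t) - pang (A s 0).
  have hdel : `|del| < d2.
    have q1 := ha t tI tta; have q2 := hb t tI ttb; rewrite /del /A /lin /pang /=.
    rewrite -/(pang (a t)) -/(pang (b t)) -/(pang (a 0)) -/(pang (b 0)).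
    move: q1 q2; rewrite !ltr_norml => /andP[q1 q2] /andP[q3 q4].
    have -> : (1 - s) * pang (a t) + s * pang (b t) - ((1 - s) * pang (a 0) + s * pang (b 0)) =
      (1 - s) * (pang (a t) - pang (a 0)) + s * (pang (b t) - pang (b 0)) by ring.
    by case/andP: s1 => s0 s1; apply/andP; split; [exact: conv_gt|exact: conv_lt].
  have eF : (r / m) *: Fr (A s 0) i = r *: (rot (pang (A s 0)) (mkv 1 0) *m D).
    rewrite /Fr /frame_at Pp -/D.
    have -> : mkv (pm1 (A s 0)) (pm2 (A s 0)) = m *: mkv 1 0.
      have -> : pm2 (A s 0) = 0 by case: (initial_lin s1 ia ib).
      by apply: rv2P; rewrite !v2E ?mulr1 ?mulr0.
    by rewrite rotZ -scalemxAl scalerA divfK // gt_eqF.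
  have ex : plane_pt (A s t) - x0 = r *: rot (pang (A s 0)) (mkv 1 0) + r *: rot (pang (A s 0)) (rot del (mkv 1 0) - mkv 1 0).
    have e1 (v w : 'rV[R]_2) : v + (w - v) = w by rewrite addrC subrK.
    have e2 : pang (A s 0) + del = pang (A s t) by rewrite /del addrC subrK.
    rewrite -scalerDr -rotDr e1 -rotvD e2 /plane_pt addrC addKr.
    by rewrite -rotZ; congr rot; apply: rv2P; rewrite !v2E ?mulr1 ?mulr0.
  have -> : chart i (Pt (A s t)) - chart i (psi p i0 x0) - (r / m) *: Fr (A s 0) i =
     (chart i (Pt (A s t)) - chart i (psi p i0 x0) - (plane_pt (A s t) - x0) *m D) +
     (r *: rot (pang (A s 0)) (rot del (mkv 1 0) - mkv 1 0)) *m D.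
    rewrite eF ex mulmxDl -scalemxAl; apply/rowP => q; rewrite !mxE; ring.
  apply: (le_trans (ler_normD _ _)).
  have k2 : `|chart i (Pt (A s t)) - chart i (psi p i0 x0) - (plane_pt (A s t) - x0) *m D| <= e / (2 * M) * r.
    have -> : D = dtrans i0 i (psi p i0 x0) by rewrite /D psi_chart.
    by apply: (le_trans k1); apply: ler_wpM2l => //; rewrite divr_ge0 ?mulr_ge0 // ltW.
  set q := rot del (mkv 1 0) - mkv 1 0 in ex *; have hq : `|q| < e / (2 * M * (4 * `|D| + 1)) := h2 _ hdel.
  have k3 : `|(r *: rot (pang (A s 0)) q) *m D| <= r * (4 * `|q| * `|D|).
    apply: (le_trans (norm2_mulmx _ _)); rewrite normrZ (gtr0_norm rr0).
    have := ler_wpM2r (normr_ge0 D) (norm2_rot (pang (A s 0)) q) => h4.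
    have -> : 2 * (r * `|rot (pang (A s 0)) q|) * `|D| = r * (2 * (`|rot (pang (A s 0)) q| * `|D|)) by ring.
    rewrite ler_pM2l //; lra.
  have k4 : 4 * `|q| * `|D| <= e / (2 * M).
    have n0 := normr_ge0 D; have q0 := normr_ge0 q.
    apply: (@le_trans _ _ (`|q| * (4 * `|D| + 1))); first by nra.
    rewrite -ler_pdivlMr // ltW // (lt_le_trans hq) // le_eqVlt; apply/orP; left; apply/eqP.
    by field; rewrite !gt_eqF.
  have k5 : e / (2 * M) * r + r * (e / (2 * M)) <= e * (r / m).
    have -> : e / (2 * M) * r + r * (e / (2 * M)) = e * (r / M) by field; rewrite gt_eqF.
    by rewrite ler_pM2l // ler_pM2l // lef_pV2.
  apply: le_trans k5; apply: lerD => //; apply: (le_trans k3); apply: ler_wpM2l => //; exact: ltW.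
Qed.
End Mix.

Context {K : flavour} {k : nat} (z : moduli_point S K k).

Definition holp (a : R -> param) := hol z (fun t => Pt (a t)) (fun t => Fr (a t)).

Lemma path_framed a : rpath a \/ ipath a -> framed_path (fun t => Pt (a t)) (fun t => Fr (a t)).
Proof.
move=> ha; have := @framed_mix a a; rewrite /framed_path.
have -> : (fun s t => Pt (lin (a t) (a t) s)) = (fun _ t => Pt (a t)).
  by apply/funext => s; apply/funext => t; rewrite linxx.
have -> : (fun s t => Fr (lin (a t) (a t) s)) = (fun _ t => Fr (a t)).
  by apply/funext => s; apply/funext => t; rewrite linxx.
by apply; case: ha => h; [left|right].
Qed.

Lemma holp_eq a b : (rpath a /\ rpath b) \/ (ipath a /\ ipath b) ->
  a 0 = b 0 -> a 1 = b 1 -> holp a = holp b.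
Proof.
move=> ab e0 e1; have := hol_homotopy z (framed_mix ab).
have -> : (fun t => Pt (lin (a t) (b t) 0)) = (fun t => Pt (a t)) by apply/funext => t; rewrite lin0.
have -> : (fun t => Fr (lin (a t) (b t) 0)) = (fun t => Fr (a t)) by apply/funext => t; rewrite lin0.
have -> : (fun t => Pt (lin (a t) (b t) 1)) = (fun t => Pt (b t)) by apply/funext => t; rewrite lin1.
have -> : (fun t => Fr (lin (a t) (b t) 1)) = (fun t => Fr (b t)) by apply/funext => t; rewrite lin1.
apply=> s s1; rewrite e0 e1 !linxx; split => //.
Qed.

Definition Hol (a b : param) := holp (lin a b).

Lemma cont_aff (u v : R) : {within unit_itv, continuous (fun t : R => (1 - t) * u + t * v)}.
Proof.
apply: continuous_subspaceT => t; apply: cvgD; apply: cvgM; try exact: cvg_cst; last exact: cvg_id.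
by apply: cvgB; [exact: cvg_cst|exact: cvg_id].
Qed.

Lemma cpath_lin a b : cpath (lin a b).
Proof. by split; exact: cont_aff. Qed.

Lemma rpath_lin a b : regular a -> regular b -> rpath (lin a b).
Proof. by move=> ra rb; split=> [|t t1]; [exact: cpath_lin|exact: regular_lin]. Qed.

Lemma regular_ilin a b t : unit_itv t -> 0 < t -> initial a -> regular b -> regular (lin a b t).
Proof.
move=> /andP[_ t1] t0 [a1 a2 a3] [/andP[b1 b2] b3]; rewrite /regular /prad /pm1 /=.
rewrite -/(prad a) -/(prad b) -/(pm1 a) -/(pm1 b) a1 mulr0 add0r.
split; last by nra.
by rewrite mulr_gt0 //= (le_lt_trans _ b2) // ler_piMl // ltW.
Qed.

Lemma ipath_lin a b : initial a -> regular b -> ipath (lin a b).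
Proof.
move=> ia rb; split=> [||t t1 t0]; [exact: cpath_lin|by rewrite lin0|].
exact: regular_ilin.
Qed.

Lemma path_lin a b : (regular a \/ initial a) -> regular b -> rpath (lin a b) \/ ipath (lin a b).
Proof. by move=> [h|h] rb; [left; exact: rpath_lin|right; exact: ipath_lin]. Qed.

(* A path from a to c through b, reparametrizing the broken line. *)
Definition kink (a b c : param) (t : R) : param :=
  let m := 2 * Num.min t (1 - t) in
  let f (pr : param -> R) := (1 - t) * pr a + t * pr c + m * (pr b - (pr a + pr c) / 2) in
  (f prad, f pang, f pm1, f pm2).

Lemma kink_half1 a b c t : unit_itv t -> kink a b c (t / 2) = lin a b t.
Proof.
move=> /andP[t0 t1]; have -> : kink a b c (t / 2) = lin a b t; last by [].
rewrite /kink; have -> : Num.min (t / 2) (1 - t / 2) = t / 2.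
  by apply/min_idPl; lra.
by rewrite /lin; congr (_, _, _, _); field.
Qed.

Lemma kink_half2 a b c t : unit_itv t -> kink a b c ((1 + t) / 2) = lin b c t.
Proof.
move=> /andP[t0 t1]; rewrite /kink.
have -> : Num.min ((1 + t) / 2) (1 - (1 + t) / 2) = (1 - t) / 2.
  have -> : 1 - (1 + t) / 2 = (1 - t) / 2 by field.
  by rewrite minC; apply/min_idPl; lra.
by rewrite /lin; congr (_, _, _, _); field.
Qed.

Lemma cpath_kink a b c : cpath (kink a b c).
Proof.
have cm (u v w : R) : {within unit_itv, continuous (fun t : R =>
    (1 - t) * u + t * v + 2 * Num.min t (1 - t) * w)}.
  apply: continuous_subspaceT => t; apply: cvgD.
    apply: cvgD; apply: cvgM; try exact: cvg_cst; last exact: cvg_id.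
    by apply: cvgB; [exact: cvg_cst|exact: cvg_id].
  apply: cvgM; last exact: cvg_cst.
  apply: cvgM; first exact: cvg_cst.
  apply: (@continuous_min _ _ (fun t : R => t) (fun t : R => 1 - t)); first exact: cvg_id.
  by apply: cvgB; [exact: cvg_cst|exact: cvg_id].
by split; exact: cm.
Qed.

Lemma kink_cases a b c t : unit_itv t ->
  (exists2 s, unit_itv s /\ (0 < t -> 0 < s) & kink a b c t = lin a b s) \/
  (exists2 s, unit_itv s & kink a b c t = lin b c s).
Proof.
move=> /andP[t0 t1]; have [th|th] := leP t (1 / 2); [left|right].
  have h : unit_itv (2 * t) by rewrite /unit_itv /=; apply/andP; split; lra.
  exists (2 * t); first by split => // ?; rewrite mulr_gt0.
  by rewrite -(@kink_half1 a b c) //; congr kink; field.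
have h : unit_itv (2 * t - 1) by rewrite /unit_itv /=; apply/andP; split; lra.
exists (2 * t - 1) => //.
by rewrite -(@kink_half2 a b c) //; congr kink; field.
Qed.

Lemma kink0 a b c : kink a b c 0 = a.
Proof. by have := @kink_half1 a b c 0 unit_itv0; rewrite mul0r lin0. Qed.

Lemma kink1 a b c : kink a b c 1 = c.
Proof.
have := @kink_half2 a b c 1 unit_itv1; rewrite lin1.
by have -> : (1 + 1) / 2 = 1 :> R by field.
Qed.

Lemma Hol_cat a b c : regular a \/ initial a -> regular b -> regular c ->
  Hol a c = Hol a b *m Hol b c.
Proof.
move=> ha rb rc.
have hk : (rpath (kink a b c) /\ rpath (lin a c)) \/ (ipath (kink a b c) /\ ipath (lin a c)).
  case: ha => ha; [left|right].
    split; last exact: rpath_lin.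
    split=> [|t t1]; first exact: cpath_kink.
    by case: (kink_cases a b c t1) => [[s [s1 _] ->]|[s s1 ->]]; exact: regular_lin.
  split; last exact: ipath_lin.
  split=> [||t t1 t0]; [exact: cpath_kink|by rewrite kink0|].
  case: (kink_cases a b c t1) => [[s [s1 s0] ->]|[s s1 ->]]; last exact: regular_lin.
  by apply: regular_ilin => //; exact: s0.
rewrite /Hol -(holp_eq hk) ?kink0 ?kink1 ?lin0 ?lin1 //.
apply: hol_cat.
- by apply: path_framed; exact: path_lin.
- by apply: path_framed; left; exact: rpath_lin.
- by apply: path_framed; case: hk => -[]; [left|right].
- by move=> t t1; rewrite kink_half1.
- by move=> t t1; rewrite kink_half2.
Qed.

Lemma Hol_unit a b : regular a \/ initial a -> regular b -> Hol a b \in unitmx.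
Proof. by move=> ha rb; apply: hol_unit; apply: path_framed; exact: path_lin. Qed.

(** It is idempotent by [Hol_cat], and invertible. *)
Lemma Hol_refl b : regular b -> Hol b b = 1%:M.
Proof.
move=> rb; have u := Hol_unit (or_introl rb) rb.
have := Hol_cat (or_introl rb) rb rb => /(congr1 (mulmx (invmx (Hol b b)))).
by rewrite mulmxA mulVmx // mul1mx.
Qed.

Definition turn (n : nat) (a : param) : param := (prad a, pang a + 2 * pi * n%:R, pm1 a, pm2 a).

Lemma rot_turn n (t : R) (v : 'rV[R]_2) : rot (t + 2 * pi * n%:R) v = rot t v.
Proof.
elim: n => [|n IH]; first by rewrite mulr0 addr0.
by rewrite -[n.+1%:R]natr1 mulrDr mulr1 addrA rot_2pi.
Qed.

Lemma Pt_turn n a : Pt (turn n a) = Pt a.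
Proof. by rewrite /Pt /plane_pt /= rot_turn. Qed.

Lemma Fr_turn n a : Fr (turn n a) = Fr a.
Proof. by rewrite /Fr Pt_turn /= rot_turn. Qed.

Lemma regular_turn n a : regular a -> regular (turn n a).
Proof. by []. Qed.

Lemma initial_turn n a : initial a -> initial (turn n a).
Proof. by []. Qed.

Lemma turn0 a : turn 0 a = a.
Proof. by case: a => [[[? ?] ?] ?]; rewrite /turn /= mulr0 addr0. Qed.

Lemma turn_turn n m a : turn n (turn m a) = turn (n + m) a.
Proof. by rewrite /turn /prad /pang /pm1 /pm2 /= natrD; congr (_, _, _, _); ring. Qed.

Lemma lin_turn n a b t : lin (turn n a) (turn n b) t = turn n (lin a b t).
Proof. by rewrite /lin /turn /prad /pang /pm1 /pm2 /=; congr (_, _, _, _); ring. Qed.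

Lemma Hol_turn n a b : Hol (turn n a) (turn n b) = Hol a b.
Proof.
rewrite /Hol /holp; congr (hol z _ _); apply/funext => t; rewrite lin_turn.
  exact: Pt_turn.
exact: Fr_turn.
Qed.

Lemma pointing_initial a : initial a -> pointing p (Fr a).
Proof.
move=> ia; split=> //; rewrite -(initial_Pt ia).
by apply: Fr_tangent; [exact: initial_norm|case: ia].
Qed.

Lemma initial_frame (d : frame S) a : initial a -> pointing p d ->
  d i0 = rot (pang a) (mkv (pm1 a) 0) -> same_vec p d (Fr a).
Proof.
move=> ia [[td _] _] e i di; rewrite /Fr (initial_Pt ia).
have [_ _ ->] := ia; rewrite -e; exact: tangent_frame_at.
Qed.

Lemma flag_Hol (d d' : frame S) o o' b i : initial o -> initial o' -> regular b ->
  pointing p d -> d i0 = rot (pang o) (mkv (pm1 o) 0) ->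
  pointing p d' -> d' i0 = rot (pang o') (mkv (pm1 o') 0) -> (i <= k)%N ->
  ext_map (Hol o b) (flag z p d i) = ext_map (Hol o' b) (flag z p d' i).
Proof.
move=> io io' rb pd ed pd' ed' ik.
have ff := framed_mix (or_intror (conj (ipath_lin io rb) (ipath_lin io' rb))).
(* [flag] takes the frame itself, including its irrelevant coordinates, so the family is modified at
   two corners to start exactly with [d] and [d']. *)
pose W s t := if t == 0 then (if s == 0 then d else if s == 1 then d'
   else Fr (lin (lin o b t) (lin o' b t) s)) else Fr (lin (lin o b t) (lin o' b t) s).
have Weq s t : unit_itv s -> unit_itv t ->
    same_vec (Pt (lin (lin o b t) (lin o' b t) s)) (Fr (lin (lin o b t) (lin o' b t) s)) (W s t).
  move=> s1 t1; rewrite /W; have [->|//] := eqVneq t 0.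
  have [->|_] := eqVneq s 0.
    by rewrite !lin0 initial_Pt // => j dj; rewrite (initial_frame io pd ed).
  have [->|//] := eqVneq s 1.
  by rewrite !lin0 !lin1 initial_Pt // => j dj; rewrite (initial_frame io' pd' ed').
have ff' : framed_family (fun s t => Pt (lin (lin o b t) (lin o' b t) s)) W.
  by apply: framed_family_ext ff => s t s1 t1; split=> //; exact: Weq.
have pW s : unit_itv s -> Pt (lin (lin o b 0) (lin o' b 0) s) = p /\ pointing p (W s 0).
  move=> s1; have il : initial (lin (lin o b 0) (lin o' b 0) s) by apply: initial_lin; rewrite ?lin0.
  split; first exact: initial_Pt.
  rewrite /W eqxx; case: (s == 0) => //; case: (s == 1) => //; exact: pointing_initial.
have := flag_flat z (or_introl pp) ff' pW ik.
have -> : W 0 0 = d by rewrite /W !eqxx.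
have -> : W 1 0 = d' by rewrite /W !eqxx oner_eq0.
have h0 : Hol o b = hol z (fun t => Pt (lin (lin o b t) (lin o' b t) 0)) (W 0).
  apply: hol_ext; first by apply: path_framed; right; exact: ipath_lin.
  by move=> t t1; have := Weq 0 t unit_itv0 t1; rewrite !lin0.
have h1 : Hol o' b = hol z (fun t => Pt (lin (lin o b t) (lin o' b t) 1)) (W 1).
  apply: hol_ext; first by apply: path_framed; right; exact: ipath_lin.
  by move=> t t1; have := Weq 1 t unit_itv1 t1; rewrite !lin1.
have h2 : Hol b b = hol z (fun s => Pt (lin (lin o b 1) (lin o' b 1) s)) (W^~ 1).
  apply: hol_ext; first by apply: path_framed; left; exact: rpath_lin.
  move=> s s1; rewrite /W oner_eq0 !lin1; split => //.
by rewrite -h0 -h1 -h2 Hol_refl // mulmx1.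
Qed.

Lemma rot_inj1 (s s' : R) (v : 'rV[R]_2) : 0 <= s < 1 -> 0 <= s' < 1 -> vx v != 0 -> vy v = 0 ->
  forall a, rot (a + 2 * pi * s) v = rot (a + 2 * pi * s') v -> s = s'.
Proof.
move=> /andP[s0 s1] /andP[s0' s1'] v0 v1 a; rewrite !rotvD => /(congr1 (rot (- a))).
rewrite !rotvK => h.
have hc : cos (2 * pi * s) = cos (2 * pi * s').
  by have := congr1 vx h; rewrite !v2E v1 !mul0r !subr0 => /(mulfI v0).
have hs : sin (2 * pi * s) = sin (2 * pi * s').
  by have := congr1 vy h; rewrite !v2E v1 !mul0r !addr0 => /(mulfI v0).
(* Half the difference of the angles: it lies strictly between -pi and pi, and its sine vanishes. *)
set x := pi * (s - s').
have e1 : cos (x *+ 2) = 1.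
  have -> : x *+ 2 = 2 * pi * s - 2 * pi * s' by rewrite /x mulr2n; ring.
  by rewrite cosB hc hs -!expr2 cos2Dsin2.
have e2 : sin x = 0.
  have : sin x ^+ 2 = 0 by have := cos2Dsin2 x; rewrite cos_mulr2n mulr2n in e1; lra.
  by move/eqP; rewrite sqrf_eq0 => /eqP.
have p0 := @pi_gt0 R; have xlt : -pi < x < pi by rewrite /x; apply/andP; split; nra.
case/andP: xlt => x1 x2; case: (ltgtP x 0) => [xn|xp|xz].
- have : 0 < sin (- x) by apply: sin_gt0_pi; rewrite oppr_gt0 xn /=; lra.
  by rewrite sinN e2 oppr0 ltxx.
- have : 0 < sin x by apply: sin_gt0_pi; rewrite xp.
  by rewrite e2 ltxx.
- by move/eqP: xz; rewrite /x mulf_eq0 gt_eqF //= subr_eq0 => /eqP.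
Qed.

Lemma mono_Hol (d : frame S) o b : initial o -> regular b -> pointing p d ->
  d i0 = rot (pang o) (mkv (pm1 o) 0) ->
  mono z p d *m Hol o b = Hol o (turn 1 b).
Proof.
move=> io rb pd ed.
(* [mono_loop] concerns the boundary of a polar disc, here of radius r0 / 2, and [b0] is its point
   on the ray of [o]. The general [b] follows by transport from [b0]. *)
pose b0 : param := (r0 / 2, pang o, pm1 o, 0).
have [q1 q2 q3] := io.
have rb0 : regular b0.
  rewrite /regular /prad /pm1 /=; split=> //; apply/andP; split; first by rewrite divr_gt0.
  by rewrite ltr_pdivrMr // mulr_natr mulr2n ltrDl.
have step : mono z p d *m Hol o b0 = Hol o b0 *m Hol b0 (turn 1 b0).
  (* Interpolating between a radial path and its translate by a full turn sweeps the disc, at angle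
     [pang o + 2 * pi * s]. *)
  pose a t := lin o b0 t; pose a' t := lin (turn 1 o) (turn 1 b0) t.
  have ia : ipath a by exact: ipath_lin.
  have ia' : ipath a' by apply: ipath_lin => //; exact: initial_turn.
  have ff := framed_mix (or_intror (conj ia ia')).
  have ang s t : pang (lin (a t) (a' t) s) = pang o + 2 * pi * s.
    by rewrite /a /a' /lin /turn /b0 /pang /=; ring.
  have rad s t : prad (lin (a t) (a' t) s) = t * (r0 / 2).
    by rewrite /a /a' /lin /turn /b0 /prad /= -/(prad o) q1; ring.
  have m1E s t : pm1 (lin (a t) (a' t) s) = pm1 o.
    by rewrite /a /a' /lin /turn /b0 /pm1 /= -/(pm1 o); ring.
  have m2E s t : pm2 (lin (a t) (a' t) s) = 0.
    by rewrite /a /a' /lin /turn /b0 /pm2 /= -/(pm2 o) q3; ring.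
  pose W s t := if (s == 0) && (t == 0) then d else Fr (lin (a t) (a' t) s).
  have Weq s t : unit_itv s -> unit_itv t ->
      same_vec (Pt (lin (a t) (a' t) s)) (Fr (lin (a t) (a' t) s)) (W s t).
    move=> s1 t1; rewrite /W; case: eqVneq => [->|//]; case: eqVneq => [->|//] /=.
    by rewrite /a !lin0 initial_Pt // => j dj; rewrite (initial_frame io pd ed).
  have W00 : W 0 0 = d by rewrite /W !eqxx.
  have r2 : 0 < r0 / 2 by rewrite divr_gt0.
  have hnorm s t : unit_itv t -> `|plane_pt (lin (a t) (a' t) s) - x0| < r0.
    move=> /andP[t0 t1]; apply: plane_pt_norm; rewrite rad mulr_ge0 ?(ltW r2) //=.
    by apply: (@le_lt_trans _ _ (r0 / 2)); [rewrite ler_piMl // ltW|rewrite ltr_pdivrMr // mulr_natr mulr2n ltrDl].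
  have pdisc : polar_disc p (fun s t => Pt (lin (a t) (a' t) s)) W.
    split.
    - by apply: framed_family_ext ff => s t s1 t1; split=> //; exact: Weq.
    - by move=> s s1; apply: initial_Pt; apply: initial_lin => //; rewrite /a /a' lin0.
    - move=> t t1; have e : Pt (lin (a t) (a' t) 1) = Pt (lin (a t) (a' t) 0).
        by rewrite lin0 lin1 /a' lin_turn Pt_turn.
      split=> // j dj; have h0 := Weq 0 t unit_itv0 t1 j dj.
      have := Weq 1 t unit_itv1 t1 j; rewrite e => /(_ dj) <-; rewrite -h0.
      by rewrite lin0 lin1 /a' lin_turn Fr_turn.
    - move=> s t s' t' s1 /andP[t0 t1] s1' /andP[t0' t1'] e.
      have n1 : `|plane_pt (lin (a t) (a' t) s) - x0| < r0 by apply: hnorm; rewrite /unit_itv /= ltW.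
      have n2 : `|plane_pt (lin (a t') (a' t') s') - x0| < r0 by apply: hnorm; rewrite /unit_itv /= ltW.
      have e2 : plane_pt (lin (a t) (a' t) s) = plane_pt (lin (a t') (a' t') s').
        by rewrite -(psiP disc n1).2 -(psiP disc n2).2; congr chart.
      have e3 : rot (pang o + 2 * pi * s) (mkv (t * (r0 / 2)) 0) = rot (pang o + 2 * pi * s') (mkv (t' * (r0 / 2)) 0).
        by move: e2; rewrite /plane_pt !ang !rad => /addrI.
      have tt : t = t'.
        have sq (x : R) (y : R) : vx (rot x (mkv y 0)) ^+ 2 + vy (rot x (mkv y 0)) ^+ 2 = y ^+ 2.
          rewrite !v2E; transitivity (y ^+ 2 * (cos x ^+ 2 + sin x ^+ 2)); first by ring.
          by rewrite cos2Dsin2 mulr1.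
        have := sq (pang o + 2 * pi * s) (t * (r0 / 2)); rewrite e3 sq => /eqP.
        rewrite eqrXn2 ?mulr_ge0 // ?ltW // => /eqP/(mulIf (lt0r_neq0 r2)) //.
      split=> //; rewrite -tt in e3; apply: (rot_inj1 s1 s1' _ _ e3); rewrite !v2E //.
      by rewrite mulf_neq0 ?gt_eqF.
    - exists i0 => // s s1; rewrite W00 ed -rotvD addrC.
      have il : initial (lin (a 0) (a' 0) s) by apply: initial_lin => //; rewrite /a /a' lin0.
      have := Weq s 0 s1 unit_itv0 i0; rewrite initial_Pt // => /(_ dp) <-.
      rewrite /Fr initial_Pt // ang m1E m2E.
      have h00 : `|x0 - x0| < r0 by rewrite subrr normr0.
      by have := frame_at_id disc (rot (pang o + 2 * pi * s) (mkv (pm1 o) 0)) h00; rewrite psi_chart.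
  have := mono_loop z pp pdisc; rewrite W00.
  have <- : Hol o b0 = hol z (fun t => Pt (lin (a t) (a' t) 0)) (W 0).
    apply: hol_ext; first by apply: path_framed; right.
    by move=> t t1; have := Weq 0 t unit_itv0 t1; rewrite !lin0.
  have <- // : Hol b0 (turn 1 b0) = hol z (fun s => Pt (lin (a 1) (a' 1) s)) (W^~ 1).
  apply: hol_ext; first by apply: path_framed; left; exact: rpath_lin.
  by move=> s s1; have := Weq s 1 s1 unit_itv1; rewrite /a /a' !lin1.
have rt := regular_turn 1 rb; have rt0 := regular_turn 1 rb0.
rewrite (Hol_cat (or_intror io) rb0 rb) mulmxA step -mulmxA -(Hol_turn 1 b0 b).
by rewrite -(Hol_cat (or_introl rb0) rt0 rt) -(Hol_cat (or_intror io) rb0 rt).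
Qed.

Lemma mono_Hol_iter (d : frame S) o b n : initial o -> regular b -> pointing p d ->
  d i0 = rot (pang o) (mkv (pm1 o) 0) ->
  mono z p d ^+ n *m Hol o b = Hol o (turn n b).
Proof.
move=> io rb pd ed; elim: n => [|n IH]; first by rewrite expr0 mul1mx turn0.
rewrite exprS -mulmxE -mulmxA IH mono_Hol ?turn_turn //.
Qed.
End Polar.

(** * Subpaths and polar lifts *)

Lemma pair0_continuous (R : realType) : continuous (fun t : R => (0 : R, t)).
Proof.
move=> t N [[A B] /= [hA hB] AB]; suff : \forall s \near t, N (0, s) by [].
by apply: filterS hB => s Bs; apply: AB; split=> //=; exact: nbhs_singleton.
Qed.

Section FramedPath.
Context {R : realType} {S : marked_surface R}.

Lemma framed_path_cont (g : R -> S) w : framed_path g w -> {within unit_itv, continuous g}.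
Proof.
case=> h _ _ _ _; apply: (@within_comp _ _ _ unit_itv unit_square (fun t => (0, t)) _ _ h).
  exact/continuous_subspaceT/pair0_continuous.
by move=> t t1; split=> //; exact: unit_itv0.
Qed.

Lemma framed_path_vec (g : R -> S) w i : framed_path g w ->
  {within [set t | unit_itv t /\ dom i (g t)], continuous (fun t => w t i)}.
Proof.
case=> _ _ h _ _; apply: (@within_comp _ _ _ _ [set st : R * R | unit_square st /\ dom i (g st.2)] (fun t => (0, t)) _ _ (h i)).
  exact/continuous_subspaceT/pair0_continuous.
by move=> t [t1 dt]; do !split=> //; exact: unit_itv0.
Qed.

Lemma near0_within (T : topologicalType) (f : R -> T) (U : set T) :
  {within unit_itv, continuous f} -> nbhs (f 0) U ->
  exists2 d : R, 0 < d & forall t, unit_itv t -> t < d -> U (f t).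
Proof.
move=> /withinP /(_ 0 unit_itv0) c /c h.
have h' : \forall t \near (0 : R), unit_itv t -> U (f t) := h.
have [d d0 hd] := nbhs_norm_lt h'; exists d => // t t1 td; apply: hd => //.
by rewrite subr0 ger0_norm //; case/andP: t1.
Qed.

(** For a path issuing from a puncture, the linear bound at 0 keeps the departure in the prescribed
    direction uniform in s. *)
Lemma framed_reparam (g : R -> S) w (phi : R -> R -> R) : framed_path g w ->
  {within unit_square, continuous (fun st : R * R => phi st.1 st.2)} ->
  (forall s t, unit_itv s -> unit_itv t -> unit_itv (phi s t)) ->
  (forall s t, unit_itv s -> unit_itv t -> 0 < t -> 0 < phi s t) ->
  (forall s, unit_itv s -> 0 < phi s 0) \/
  ((forall s, unit_itv s -> phi s 0 = 0) /\
   exists2 C : R, 0 < C & forall s t, unit_itv s -> unit_itv t -> phi s t <= C * t) ->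
  framed_family (fun s t => g (phi s t)) (fun s t => w (phi s t)).
Proof.
move=> fg cphi phiI phi0 h0; have cg := framed_path_cont fg.
have [h1 h2 h3 h4 h5] := fg; split.
- by apply: (@within_comp _ _ _ _ unit_itv (fun st : R * R => phi st.1 st.2) g) => // st [s1 t1]; exact: phiI.
- by move=> s t s1 t1; apply: (h2 0); [exact: unit_itv0|exact: phiI].
- move=> i; have cw := framed_path_vec (i := i) fg.
  apply: (@within_comp _ _ _ _ _ (fun st : R * R => phi st.1 st.2) _ _ cw).
    by apply: continuous_subspaceW cphi => st [].
  by move=> st [[s1 t1] dd]; split=> //; exact: phiI.
- move=> s t s1 t1 t0; apply: (h4 0); [exact: unit_itv0|exact: phiI|exact: phi0].
- case: h0 => [hp|[hz [C C0 hC]]].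
    left=> s s1; apply: (h4 0); [exact: unit_itv0|apply: phiI => //; exact: unit_itv0|exact: hp].
  case: h5 => [hn|[p pp [hp h5]]]; [left=> s s1|right; exists p => //; split=> [s s1|]].
  + by rewrite hz //; apply: (hn 0); exact: unit_itv0.
  + by rewrite hz //; apply: (hp 0); exact: unit_itv0.
  + move=> i di e e0; have [r r0 hr] := h5 i di e e0.
    exists (r / C); first by rewrite divr_gt0.
    move=> s t s1 /andP[t0 tr] t1; have tI : unit_itv t by rewrite /unit_itv /= ltW.
    rewrite hz //; apply: (hr 0); [exact: unit_itv0| |by case/andP: (phiI s t s1 tI)].
    rewrite phi0 //= (le_lt_trans (hC _ _ s1 tI)) // mulrC -ltr_pdivlMr //.
Qed.

Lemma square_cst (f : R -> R) : continuous f -> {within unit_square, continuous (fun st : R * R => f st.2)}.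
Proof.
move=> cf; apply: continuous_subspaceT => st; apply: continuous_comp; [exact: cvg_snd|exact: cf].
Qed.

Lemma framed_sub (g : R -> S) w (u v : R) : framed_path g w -> 0 <= u -> 0 < v -> u + v <= 1 ->
  framed_path (fun t => g (u + v * t)) (fun t => w (u + v * t)).
Proof.
move=> fg u0 v0 uv; apply: (@framed_reparam g w (fun _ t => u + v * t)) => //.
- apply: (@square_cst (fun t => u + v * t)) => t; apply: cvgD; first exact: cvg_cst.
  by apply: cvgM; [exact: cvg_cst|exact: cvg_id].
- by move=> s t _ /andP[t0 t1]; rewrite /unit_itv /=; apply/andP; split; nra.
- by move=> s t _ _ t0; nra.
- have [u0'|u0'] := ltP 0 u; [left=> s _; nra|right].
  have -> : u = 0 by apply/eqP; rewrite eq_le u0 u0'.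
  split=> [s _|]; first by rewrite mulr0 addr0.
  by exists v => // s t _ _; rewrite add0r.
Qed.

Context {K : flavour} {k : nat} (z : moduli_point S K k).

Lemma hol_split (g : R -> S) w (u : R) : framed_path g w -> 0 < u < 1 ->
  hol z g w = hol z (fun t => g (0 + u * t)) (fun t => w (0 + u * t)) *m
              hol z (fun t => g (u + (1 - u) * t)) (fun t => w (u + (1 - u) * t)).
Proof.
move=> fg /andP[u0 u1].
(* The piecewise linear map of [0, 1] which sends 1/2 to u, since [hol_cat] joins paths at 1/2.
   Interpolation with the identity gives the homotopy. *)
pose q (t : R) := t + Num.min t (1 - t) * (2 * u - 1).
have q1 t : unit_itv t -> q (t / 2) = 0 + u * t.
  move=> /andP[t0 t1]; rewrite /q; have -> : Num.min (t / 2) (1 - t / 2) = t / 2.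
    by apply/min_idPl; lra.
  by field.
have q2 t : unit_itv t -> q ((1 + t) / 2) = u + (1 - u) * t.
  move=> /andP[t0 t1]; rewrite /q; have -> : Num.min ((1 + t) / 2) (1 - (1 + t) / 2) = (1 - t) / 2.
    have -> : 1 - (1 + t) / 2 = (1 - t) / 2 by field.
    by rewrite minC; apply/min_idPl; lra.
  by field.
have qc (t : R) : unit_itv t -> (exists2 s : R, unit_itv s & t = s / 2) \/ (exists2 s : R, unit_itv s & t = (1 + s) / 2).
  move=> /andP[t0 t1]; have [th|th] := leP t (1 / 2); [left|right].
    exists (2 * t); last by field.
    by rewrite /unit_itv /=; apply/andP; split; lra.
  exists (2 * t - 1); last by field.
  by rewrite /unit_itv /=; apply/andP; split; lra.
have qb t : unit_itv t -> [/\ u * t <= q t, q t <= 2 * t & unit_itv (q t)].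
  move=> t1; case: (qc t t1) => -[s /andP[s0 s1] e]; rewrite e.
    have sI : unit_itv s by rewrite /unit_itv /= s0.
    by rewrite q1 // add0r; split; [nra|nra|rewrite /unit_itv /=; apply/andP; split; nra].
  have sI : unit_itv s by rewrite /unit_itv /= s0.
  by rewrite q2 //; split; [nra|nra|rewrite /unit_itv /=; apply/andP; split; nra].
pose phi s t := (1 - s) * q t + s * t.
have phib s t : unit_itv s -> unit_itv t -> [/\ u * t <= phi s t, phi s t <= 2 * t & unit_itv (phi s t)].
  move=> /andP[s0 s1] t1; have [h1 h2 /andP[h3 h4]] := qb t t1; case/andP: t1 => t0 t1.
  have ut : u * t <= t by nra.
  rewrite /phi; split; [nra|nra|rewrite /unit_itv /=; apply/andP; split].
    by rewrite addr_ge0 // mulr_ge0 // subr_ge0.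
  have : (1 - s) * q t <= 1 - s by rewrite -[leRHS]mulr1 ler_wpM2l // subr_ge0.
  have : s * t <= s by rewrite -[leRHS]mulr1 ler_wpM2l.
  lra.
have cq : continuous q.
  move=> t; apply: cvgD; first exact: cvg_id; apply: cvgM; last exact: cvg_cst.
  apply: (@continuous_min _ _ (fun t : R => t) (fun t : R => 1 - t)); first exact: cvg_id.
  by apply: cvgB; [exact: cvg_cst|exact: cvg_id].
have q00 : q 0 = 0 by have := q1 0 unit_itv0; rewrite mul0r mulr0 addr0.
have q11 : q 1 = 1.
  have := q2 1 unit_itv1; have -> : (1 + 1) / 2 = 1 :> R by field.
  by rewrite mulr1 addrC subrK.
have ff : framed_family (fun s t => g (phi s t)) (fun s t => w (phi s t)).
  apply: framed_reparam => //.
  - apply: continuous_subspaceT => st; apply: cvgD; apply: cvgM.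
    + by apply: cvgB; [exact: cvg_cst|exact: cvg_fst].
    + by apply: (continuous_comp (f := snd) (g := q)); [exact: cvg_snd|exact: cq].
    + exact: cvg_fst.
    + exact: cvg_snd.
  - by move=> s t s1 t1; case: (phib s t s1 t1).
  - move=> s t s1 t1 t0; case: (phib s t s1 t1) => h _ _; apply: lt_le_trans h; exact: mulr_gt0.
  - right; split; first by move=> s _; rewrite /phi q00 !mulr0 addr0.
    by exists 2 => // s t s1 t1; case: (phib s t s1 t1).
have fq : framed_path (fun t => g (q t)) (fun t => w (q t)).
  apply: (@framed_reparam g w (fun _ t => q t)) => //.
  - exact: (square_cst cq).
  - by move=> s t _ t1; case: (qb t t1).
  - by move=> s t _ t1 t0; case: (qb t t1) => h _ _; apply: lt_le_trans h; exact: mulr_gt0.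
  - right; split=> // ; exists 2 => // s t _ t1; by case: (qb t t1).
have e1 : hol z g w = hol z (fun t => g (q t)) (fun t => w (q t)).
  have := hol_homotopy z ff.
  have -> : (fun t => g (phi 0 t)) = (fun t => g (q t)) by apply/funext => t; rewrite /phi subr0 mul1r mul0r addr0.
  have -> : (fun t => w (phi 0 t)) = (fun t => w (q t)) by apply/funext => t; rewrite /phi subr0 mul1r mul0r addr0.
  have -> : (fun t => g (phi 1 t)) = g by apply/funext => t; rewrite /phi subrr mul1r mul0r add0r.
  have -> : (fun t => w (phi 1 t)) = w by apply/funext => t; rewrite /phi subrr mul1r mul0r add0r.
  move=> -> // s s1; have p0 s' : phi s' 0 = 0 by rewrite /phi q00 !mulr0 addr0.
  have p1 s' : phi s' 1 = 1 by rewrite /phi q11 !mulr1 subrK.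
  by rewrite !p0 !p1.
rewrite e1; apply: hol_cat => //.
- by apply: framed_sub; rewrite ?add0r // ltW.
- by apply: framed_sub; rewrite ?subr_gt0 // ?(ltW u0) // addrC subrK.
- by move=> t t1; rewrite q1.
- by move=> t t1; rewrite q2.
Qed.
End FramedPath.

Lemma polar_decomp (R : realType) (v : 'rV[R]_2) : v != 0 ->
  exists al rho, 0 < rho /\ v = rot al (mkv rho 0).
Proof.
move=> v0; set N := vx v ^+ 2 + vy v ^+ 2.
have N0 : 0 < N.
  rewrite lt_neqAle addr_ge0 ?sqr_ge0 // andbT eq_sym paddr_eq0 ?sqr_ge0 // !sqrf_eq0.
  by apply: contra v0 => /andP[/eqP h1 /eqP h2]; apply/eqP/rv2P; rewrite ?h1 ?h2 ?vx0 ?vy0.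
set rho := Num.sqrt N; have r0 : 0 < rho by rewrite sqrtr_gt0.
have r2 : rho ^+ 2 = N by rewrite sqr_sqrtr // ltW.
set c := vx v / rho; have hc : -1 <= c <= 1.
  rewrite -ler_norml -(ler_pXn2r (n := 2)) ?nnegrE // expr1n real_normK ?num_real //.
  by rewrite expr_div_n r2 ler_pdivrMr // mul1r /N lerDl sqr_ge0.
have sq : Num.sqrt (1 - c ^+ 2) = `|vy v| / rho.
  have -> : 1 - c ^+ 2 = (`|vy v| / rho) ^+ 2.
    rewrite /c !expr_div_n real_normK ?num_real // r2 /N; field.
    by rewrite -/N gt_eqF.
  by rewrite sqrtr_sqr ger0_norm // divr_ge0 // ltW.
have [y0|y0] := leP 0 (vy v).
  exists (acos c), rho; split=> //; apply: rv2P; rewrite !v2E mul0r ?subr0 ?addr0.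
    by rewrite acosK ?in_itv //= /c mulrC divfK // gt_eqF.
  by rewrite sin_acos // sq ger0_norm // mulrC divfK // gt_eqF.
exists (- acos c), rho; split=> //; apply: rv2P; rewrite !v2E mul0r ?subr0 ?addr0.
  by rewrite cosN acosK ?in_itv //= /c mulrC divfK // gt_eqF.
by rewrite sinN sin_acos // sq ltr0_norm // mulNr opprK mulrC divfK // gt_eqF.
Qed.

Lemma rot_atan (R : realType) (x y : R) : 0 < x ->
  rot (atan (y / x)) (mkv (Num.sqrt (x ^+ 2 + y ^+ 2)) 0) = mkv x y.
Proof.
move=> x0; set q := y / x.
have hs : Num.sqrt (x ^+ 2 + y ^+ 2) = x * Num.sqrt (1 + q ^+ 2).
  have -> : x ^+ 2 + y ^+ 2 = x ^+ 2 * (1 + q ^+ 2) by rewrite /q; field; rewrite gt_eqF.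
  by rewrite sqrtrM ?sqr_ge0 // sqrtr_sqr gtr0_norm.
have s0 : 0 < Num.sqrt (1 + q ^+ 2) by rewrite sqrtr_gt0 ltr_wpDr // sqr_ge0.
have hc : cos (atan q) = (Num.sqrt (1 + q ^+ 2))^-1 by rewrite cos_atan.
have c0 : cos (atan q) != 0 by rewrite hc invr_eq0 gt_eqF.
have hn : sin (atan q) = q * (Num.sqrt (1 + q ^+ 2))^-1.
  by rewrite -hc -{2}(atanK q) /tan divfK.
apply: rv2P; rewrite !v2E mul0r ?subr0 ?addr0 hs.
  by rewrite hc mulfK // gt_eqF.
rewrite hn; set d := Num.sqrt (1 + q ^+ 2) in s0 *.
by rewrite /q; field; rewrite !gt_eqF.
Qed.

(** * Lifting paths that issue from a puncture *)

Section Lift.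
Context {R : realType} {S : marked_surface R} (p : S) (i0 : chart_ix S).
Hypotheses (dp : dom i0 p) (pp : puncture p).
Let x0 := chart i0 p.
Variable r0 : R.
Hypothesis r0_gt0 : 0 < r0.
Hypothesis disc : forall x, `|x - x0| < r0 ->
  0 < vy x /\ exists2 y, dom i0 y & chart i0 y = x.

(** [plift_path] is stated for every [u] so that a leg may be cut at any time up to [ts]. *)
Record polar_lift (g : R -> S) (w : R -> frame S) (ts : R) (a : R -> @param R) : Prop := {
  plift0 : initial (a 0);
  plift_dir : w 0 i0 = rot (pang (a 0)) (mkv (pm1 (a 0)) 0);
  plift_dom : forall t, 0 <= t <= ts -> dom i0 (g t);
  plift_reg : forall t, 0 < t <= ts -> regular r0 (a t);
  plift_pt : forall t, 0 <= t <= ts -> Pt p i0 (a t) = g t /\ same_vec (g t) (w t) (Fr p i0 (a t));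
  plift_path : forall u, 0 < u <= ts -> ipath r0 (fun t => a (0 + u * t)) }.

Lemma near_p_disc d : 0 < d -> \forall y \near p, dom i0 y /\ `|chart i0 y - x0| < d.
Proof.
move=> d0; near=> y; split.
  by near: y; apply: open_nbhs_nbhs; split => //; exact: dom_open.
by near: y; have /cvgrPdist_lt/(_ d d0) := chart_continuous dp; apply: filterS => y; rewrite distrC.
Unshelve. all: by end_near. Qed.

(** The path leaves [p] in a direction [al], so at first it stays in a cone around this direction,
    where the angle is [al] plus an arctangent. Narrower cones at smaller times give the continuity
    of the angle at 0. *)
Lemma polar_lift_exists g w : framed_path g w -> g 0 = p ->
  exists2 ts0, 0 < ts0 & exists a, forall ts, 0 < ts <= ts0 -> polar_lift g w ts a.
Proof.
move=> fg g0; have cg := framed_path_cont fg.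
have [_ h2 _ _ h5] := fg.
have v0 : w 0 i0 != 0.
  have [_ h] := h2 0 0 unit_itv0 unit_itv0; apply/eqP; apply: h; by rewrite g0.
have [al [rho [rho0 ev]]] := polar_decomp v0.
have {}h5 : forall e : R, 0 < e -> exists2 r : R, 0 < r & forall t, 0 < t < r -> t <= 1 ->
    exists2 c : R, 0 < c & `|chart i0 (g t) - x0 - c *: w 0 i0| <= e * c.
  case: h5 => [/(_ 0 unit_itv0)|[p' pp' [/(_ 0 unit_itv0) ep h5]]].
    by rewrite g0.
  have ep' : p = p' by rewrite -g0 -ep.
  rewrite -ep' in h5; move=> e e0; have [r rp hr] := h5 i0 dp e e0.
  by exists r => // t tr t1; exact: (hr 0 t unit_itv0).
pose zf t := rot (- al) (chart i0 (g t) - x0).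
pose q t := vy (zf t) / vx (zf t).
have cone e : 0 < e -> exists2 r : R, 0 < r & forall t, 0 < t < r -> t <= 1 ->
    0 < vx (zf t) /\ `|vy (zf t)| <= e * vx (zf t).
  move=> e0; have m0 : 0 < Num.min 1 e by rewrite lt_min ltr01.
  have m1 : Num.min 1 e <= 1 by rewrite ge_min lexx.
  have m2 : Num.min 1 e <= e by rewrite ge_min lexx orbT.
  set m := Num.min 1 e in m0 m1 m2.
  (* The rotation may double the error, and the resulting rho / 2 keeps the first coordinate above
     half of its expected value. *)
  have [|r rp hr] := h5 (rho / 4 * m); first by rewrite mulr_gt0 // divr_gt0.
  exists r => // t tr t1; have [c c0 hc] := hr t tr t1.
  have hz : `|zf t - c *: mkv rho 0| <= rho / 2 * m * c.
    have -> : zf t - c *: mkv rho 0 = rot (- al) (chart i0 (g t) - x0 - c *: w 0 i0).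
      by rewrite ev [RHS]rotB rotZ rotvK.
    apply: (le_trans (norm2_rot _ _)); have := ler_wpM2l (ler0n R 2) hc; lra.
  move: hz; rewrite norm2_le vxD vyD vxN vyN vxZ vyZ mkvx mkvy mulr0 subr0 ler_norml => /andP[/andP[k1 k2] k3].
  have cr : 0 < c * rho by rewrite mulr_gt0.
  have k4 : c * rho / 2 <= vx (zf t) by nra.
  have mr : rho / 2 * m * c <= e * (c * rho / 2).
    have -> : rho / 2 * m * c = m * (c * rho / 2) by ring.
    by apply: ler_wpM2r => //; rewrite divr_ge0 // ltW.
  split; first by apply: lt_le_trans k4; rewrite divr_gt0.
  by apply: (le_trans k3); apply: (le_trans mr); rewrite ler_pM2l.
have [d1 d10 hd1] : exists2 d : R, 0 < d & forall t, unit_itv t -> t < d ->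
    dom i0 (g t) /\ `|chart i0 (g t) - x0| < r0 / 2.
  apply: (near0_within (U := fun y => dom i0 y /\ `|chart i0 y - x0| < r0 / 2)) cg _.
  by rewrite g0; apply: near_p_disc; rewrite divr_gt0.
have [d2 d20 hd2] := cone 1 ltr01.
pose ts1 := Num.min (Num.min d1 d2) 1 / 2.
have ts10 : 0 < ts1 by rewrite divr_gt0 // !lt_min d10 d20 ltr01.
have tsP t : 0 <= t <= ts1 -> [/\ unit_itv t, t < d1 & t < d2].
  have mm : 0 < Num.min (Num.min d1 d2) 1 by rewrite !lt_min d10 d20 ltr01.
  have lt1 : ts1 < Num.min (Num.min d1 d2) 1 by rewrite /ts1 ltr_pdivrMr // mulr_natr mulr2n ltrDl.
  move=> /andP[t0 /le_lt_trans/(_ lt1)]; rewrite !lt_min => /andP[/andP[h1' h2'] h3'].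
  by split=> //; rewrite /unit_itv /= t0 ltW.
pose J := [set t : R | 0 <= t <= ts1].
pose th t := al + atan (q t).
pose r t := Num.sqrt (vx (zf t) ^+ 2 + vy (zf t) ^+ 2).
pose m t := rot (- th t) (w t i0).
pose a t : @param R := (r t, th t, vx (m t), vy (m t)).
have zf0 : zf 0 = 0.
  by rewrite /zf g0 subrr; apply: rv2P; rewrite !v2E; ring.
have q0 : q 0 = 0 by rewrite /q zf0 !v2E mul0r.
have JI : J `<=` unit_itv by move=> t /tsP[].
have cz t : J t -> zf t' @[t' --> within J (nbhs t)] --> zf t.
  move=> Jt; have [t1 td1 _] := tsP t Jt; have [dt _] := hd1 t t1 td1.
  apply: cvg_rot; first exact: cvg_cst.
  apply: cvgB; last exact: cvg_cst.
  have cgJ : g t' @[t' --> within J (nbhs t)] --> g t.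
    by move/withinP: (continuous_subspaceW JI cg) => /(_ t Jt).
  exact: (cvg_comp _ _ cgJ (chart_continuous dt)).
have cq t : J t -> q t' @[t' --> within J (nbhs t)] --> q t.
  move=> Jt; have [t1 _ td2] := tsP t Jt; case/andP: (Jt) => t0 tts.
  move: t0; rewrite le_eqVlt => /orP[/eqP t0|t0]; last first.
    have [x1 _] := hd2 t ltac:(by rewrite t0) ltac:(by case/andP: t1).
    apply: cvgM; first exact: cvg_vy (cz t Jt).
    by apply: cvgV; [rewrite gt_eqF|exact: cvg_vx (cz t Jt)].
  rewrite -t0 q0; apply/cvgrPdist_le => e e0; have [rr rr0 hrr] := cone e e0.
  rewrite /prop_near1 /= /within /=; apply: (ball_nbhs rr0) => s; rewrite subr0 => sr Js.
  rewrite sub0r normrN; case/andP: (Js) => s0 _; have [s1 _ _] := tsP s Js.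
  move: s0; rewrite le_eqVlt => /orP[/eqP <-|s0]; first by rewrite q0 normr0 ltW.
  rewrite (gtr0_norm s0) in sr.
  have [x1 x2] := hrr s ltac:(by rewrite s0) ltac:(by case/andP: s1).
  by rewrite /q normrM normfV (gtr0_norm x1) ler_pdivrMr.
have cth t : J t -> th t' @[t' --> within J (nbhs t)] --> th t.
  move=> Jt; apply: cvgD; first exact: cvg_cst.
  exact: (cvg_comp _ _ (cq t Jt) (@continuous_atan R _)).
have cr t : J t -> r t' @[t' --> within J (nbhs t)] --> r t.
  move=> Jt; have h : vx (zf t') ^+ 2 + vy (zf t') ^+ 2 @[t' --> within J (nbhs t)] --> vx (zf t) ^+ 2 + vy (zf t) ^+ 2.
    by have := cvg_vx _ (cz t Jt); have := cvg_vy _ (cz t Jt) => hy hx; apply: cvgD; apply: cvgM; [apply: hx|apply: hx|apply: hy|apply: hy].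
  exact: (cvg_comp _ _ h (@sqrt_continuous R _)).
have cm t : J t -> m t' @[t' --> within J (nbhs t)] --> m t.
  move=> Jt; apply: cvg_rot; first by apply: cvgN; exact: cth.
  have JS : J `<=` [set t | unit_itv t /\ dom i0 (g t)].
    by move=> s Js; have [s1 sd1 _] := tsP s Js; split=> //; exact: (hd1 s s1 sd1).1.
  by have /withinP := continuous_subspaceW JS (framed_path_vec (i := i0) fg); apply.
have J0 : J 0 by rewrite /J /= lexx ltW.
have th0 : th 0 = al by rewrite /th q0 atan0 addr0.
have m00 : m 0 = mkv rho 0 by rewrite /m th0 ev rotvK.
(* In the rotated frame the initial vector is (rho, 0), so its radial component stays positive for a
   short time. *)
have [d3 d30 hd3] : exists2 d : R, 0 < d & forall t, J t -> t < d -> 0 < vx (m t).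
  have c : vx (m t') @[t' --> within J (nbhs (0 : R))] --> rho.
    by rewrite -[rho](mkvx rho 0) -m00; exact: cvg_vx (cm 0 J0).
  move/cvgrPdist_lt: c => /(_ rho rho0).
  rewrite /prop_near1 /= /within /= => /nbhs_norm_lt[d d0 hd]; exists d => // t Jt td.
  have := hd t; rewrite subr0 ger0_norm; last by case/andP: Jt.
  by move=> /(_ td Jt); rewrite ltr_norml => /andP[_]; lra.
pose ts0 := Num.min ts1 (d3 / 2).
have ts00 : 0 < ts0 by rewrite lt_min ts10 divr_gt0.
have tsJ t : 0 <= t <= ts0 -> J t /\ t < d3.
  move=> /andP[t0]; rewrite le_min => /andP[h1' h2']; rewrite /J /= t0; split=> //.
  by apply: (le_lt_trans h2'); rewrite ltr_pdivrMr // mulr_natr mulr2n ltrDl.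
exists ts0 => //; exists a => ts /andP[tsp tsl].
have tsJ' t : 0 <= t <= ts -> J t /\ t < d3.
  by move=> /andP[t0 tt]; apply: tsJ; rewrite t0 (le_trans tt).
have reg t : 0 < t <= ts -> regular r0 (a t).
  move=> /andP[t0 tt]; have [Jt td3] := tsJ' t ltac:(by rewrite ltW); have [t1 td1 td2] := tsP t Jt.
  have [x1 _] := hd2 t ltac:(by rewrite t0) ltac:(by case/andP: t1).
  have [_] := hd1 t t1 td1; rewrite norm2_lt => /andP[n1 n2].
  have rt : r t < r0.
    have r0E : r0 = Num.sqrt (r0 ^+ 2) by rewrite sqrtr_sqr gtr0_norm.
    rewrite /r [ltRHS]r0E ltr_sqrt ?exprn_gt0 //.
    set d := chart i0 (g t) - x0 in n1 n2; have hh : vx (zf t) ^+ 2 + vy (zf t) ^+ 2 = vx d ^+ 2 + vy d ^+ 2.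
      exact: rot_norm2.
    rewrite hh; move: n1 n2; rewrite !ltr_norml => /andP[a1 a2] /andP[b1 b2].
    have : vx d ^+ 2 < (r0 / 2) ^+ 2 by nra.
    have : vy d ^+ 2 < (r0 / 2) ^+ 2 by nra.
    have := sqr_ge0 r0; nra.
  split; last exact: hd3.
  rewrite /prad /= rt andbT sqrtr_gt0 ltr_wpDr ?sqr_ge0 // exprn_gt0 //.
have ia : initial (a 0).
  split; rewrite /prad /pm1 /pm2 /= ?m00 ?mkvx ?mkvy //.
  by rewrite /r zf0 !v2E expr0n /= addr0 sqrtr0.
split=> //.
- by rewrite /pang /pm1 /= m00 mkvx th0.
- by move=> t /tsJ'[Jt _]; have [t1 td1 _] := tsP t Jt; case: (hd1 t t1 td1).
- move=> t tt; have [Jt _] := tsJ' t tt; have [t1 td1 td2] := tsP t Jt.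
  have [dt _] := hd1 t t1 td1.
  have eP : Pt p i0 (a t) = g t.
    rewrite /Pt -[RHS](psi_chart p dt); congr psi; rewrite /plane_pt -/x0.
    suff -> : rot (pang (a t)) (mkv (prad (a t)) 0) = chart i0 (g t) - x0 by rewrite addrC subrK.
    rewrite /pang /prad /= /th rotvD.
    case/andP: tt; rewrite le_eqVlt => /orP[/eqP <-|t0 tts].
      by rewrite /r q0 zf0 atan0 rotv0 !v2E expr0n /= addr0 sqrtr0 g0 subrr => _; apply: rv2P; rewrite !v2E; ring.
    have [x1 _] := hd2 t ltac:(by rewrite t0) ltac:(by case/andP: t1).
    rewrite /r /q rot_atan //.
    by rewrite mkv_eta /zf rotvNK.
  split=> // i di; have [td _] := h2 0 t unit_itv0 t1.
  rewrite /Fr eP (tangent_frame_at dt td di); congr (frame_at i0 (g t) _ i).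
  by rewrite /pm1 /pm2 /= mkv_eta /pang /= /m rotvNK.
- move=> u /andP[u0 uu].
  have uJ t : unit_itv t -> J (0 + u * t).
    move=> /andP[t0 t1]; apply: (tsJ' _ _).1; rewrite add0r; apply/andP; split; nra.
  have cu : {within unit_itv, continuous (fun t : R => 0 + u * t)}.
    apply: continuous_subspaceT => t; apply: cvgD; first exact: cvg_cst.
    by apply: cvgM; [exact: cvg_cst|exact: cvg_id].
  have comp (f : R -> R) : (forall t, J t -> f t' @[t' --> within J (nbhs t)] --> f t) ->
      {within unit_itv, continuous (fun t => f (0 + u * t))}.
    move=> cf; apply: (@within_comp _ _ _ unit_itv J (fun t => 0 + u * t) f cu _ uJ).
    by apply/withinP.
  split.
  + split; [exact: (comp r cr)|exact: (comp th cth)| |].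
      by apply: (comp (fun t => vx (m t))) => t Jt; exact: cvg_vx (cm t Jt).
    by apply: (comp (fun t => vy (m t))) => t Jt; exact: cvg_vy (cm t Jt).
  + by rewrite mulr0 addr0.
  + move=> t /andP[_ t1] t0; apply: reg; rewrite add0r mulr_gt0 //=; nra.
Qed.

(** The conclusion bounds the angle between position and velocity by 45 degrees: for small t both
    are close to positive multiples of the initial velocity. *)
Lemma vel_cone (c : R -> S) (v : R -> frame S) : c 0 = p ->
  {within unit_itv, continuous c} ->
  (forall eps : R, 0 < eps -> exists2 r : R, 0 < r & forall t', unit_itv t' -> `|t' - 0| < r ->
     `|chart i0 (c t') - chart i0 (c 0) - (t' - 0) *: v 0 i0| <= eps * `|t' - 0|) ->
  {within [set t | unit_itv t /\ dom i0 (c t)], continuous (fun t => v t i0)} ->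
  v 0 i0 <> 0 ->
  exists2 ts, 0 < ts & forall t, 0 < t <= ts -> t <= 1 ->
    let z := chart i0 (c t) - x0 in let y := v t i0 in
    `|vx z * vy y - vy z * vx y| < vx z * vx y + vy z * vy y.
Proof.
move=> c0 cc hv cv /eqP v0; set w := v 0 i0 in hv v0 *.
have n0 : 0 < `|w| by rewrite normr_gt0.
(* By [hN] the scalar product of [w] with itself is at least n^2; relative errors of 1/16 keep the
   determinant below the scalar product. *)
set n := `|w| in n0 *; have e0 : 0 < n / 16 by rewrite divr_gt0.
have [r1 r10 hr1] := hv _ e0.
have [d1 d10 hd1] : exists2 d : R, 0 < d & forall t, unit_itv t -> t < d -> dom i0 (c t).
  apply: (near0_within (U := fun y => dom i0 y)) cc _.
  by rewrite c0; apply: open_nbhs_nbhs; split => //; exact: dom_open.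
have [d2 d20 hd2] : exists2 d : R, 0 < d & forall t, unit_itv t -> t < d -> dom i0 (c t) ->
    `|w - v t i0| < n / 16.
  have S0 : [set t | unit_itv t /\ dom i0 (c t)] 0 by split; [exact: unit_itv0|rewrite /= c0].
  move/withinP: cv => /(_ 0 S0) /cvgrPdist_lt /(_ _ e0).
  rewrite /prop_near1 /= /within /= => /nbhs_norm_lt[d dd hd]; exists d => // t t1 td dt.
  by apply: hd => //; rewrite subr0 ger0_norm //; case/andP: t1.
exists (Num.min (Num.min r1 d1) d2 / 2); first by rewrite divr_gt0 // !lt_min r10 d10 d20.
move=> t /andP[t0 tt] t1; have tI : unit_itv t by rewrite /unit_itv /= ltW.
have : t < Num.min (Num.min r1 d1) d2.
  by apply: (le_lt_trans tt); rewrite ltr_pdivrMr // mulr_natr mulr2n ltrDl !lt_min r10 d10 d20.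
rewrite !lt_min => /andP[/andP[tr1 td1] td2].
set z := chart i0 (c t) - x0; set y := v t i0.
have : `|z - t *: w| <= n / 16 * t.
  by have := hr1 t tI; rewrite c0 subr0 (gtr0_norm t0) => /(_ tr1).
rewrite norm2_le vxD vyD vxN vyN vxZ vyZ !ler_norml => /andP[/andP[a1 a2] /andP[a3 a4]].
have := hd2 t tI td2 (hd1 t tI td1); rewrite norm2_lt -/y.
rewrite vxD vyD vxN vyN !ltr_norml => /andP[/andP[b1 b2] /andP[b3 b4]].
have hn : `|vx w| <= n /\ `|vy w| <= n by split; [exact: vx_le|exact: vy_le].
have hN : n ^+ 2 <= vx w ^+ 2 + vy w ^+ 2.
  have : ~~ (`|w| < n) by rewrite ltxx.
  rewrite norm2_lt negb_and -!leNgt => /orP[h|h].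
    by have := sqr_ge0 (vy w); rewrite -[vx w ^+ 2]real_normK ?num_real //; nra.
  by have := sqr_ge0 (vx w); rewrite -[vy w ^+ 2]real_normK ?num_real //; nra.
pose ax := vx z / t - vx w; pose ay := vy z / t - vy w; pose bx := vx y - vx w; pose by_ := vy y - vy w.
have ezx : vx z = t * (vx w + ax) by rewrite /ax; field; rewrite gt_eqF.
have ezy : vy z = t * (vy w + ay) by rewrite /ay; field; rewrite gt_eqF.
have eyx : vx y = vx w + bx by rewrite /bx; ring.
have eyy : vy y = vy w + by_ by rewrite /by_; ring.
have eax : ax * t = vx z - t * vx w by rewrite /ax; field; rewrite gt_eqF.
have eay : ay * t = vy z - t * vy w by rewrite /ay; field; rewrite gt_eqF.
have hax : `|ax| <= n / 16 by rewrite -(ler_pM2r t0) -[X in _ * X <= _](gtr0_norm t0) -normrM eax ler_norml a1.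
have hay : `|ay| <= n / 16 by rewrite -(ler_pM2r t0) -[X in _ * X <= _](gtr0_norm t0) -normrM eay ler_norml a3.
have hbx : `|bx| <= n / 16 by rewrite /bx ler_norml; apply/andP; split; lra.
have hby : `|by_| <= n / 16 by rewrite /by_ ler_norml; apply/andP; split; lra.
have bnd (x1 x2 c1 c2 : R) : `|x1| <= c1 -> `|x2| <= c2 -> - (c1 * c2) <= x1 * x2 <= c1 * c2.
  by move=> q1 q2; rewrite -ler_norml normrM; apply: ler_pM.
have [hwx hwy] := hn.
have /andP[p1 p1'] := bnd _ _ _ _ hwx hbx; have /andP[p2 p2'] := bnd _ _ _ _ hwx hby.
have /andP[p3 p3'] := bnd _ _ _ _ hwy hbx; have /andP[p4 p4'] := bnd _ _ _ _ hwy hby.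
have /andP[p5 p5'] := bnd _ _ _ _ hwx hax; have /andP[p6 p6'] := bnd _ _ _ _ hwx hay.
have /andP[p7 p7'] := bnd _ _ _ _ hwy hax; have /andP[p8 p8'] := bnd _ _ _ _ hwy hay.
have /andP[u1 u1'] := bnd _ _ _ _ hax hbx; have /andP[u2 u2'] := bnd _ _ _ _ hax hby.
have /andP[u3 u3'] := bnd _ _ _ _ hay hbx; have /andP[u4 u4'] := bnd _ _ _ _ hay hby.
have nn : 0 < n ^+ 2 by rewrite exprn_gt0.
rewrite /= ezx ezy eyx eyy.
have -> : t * (vx w + ax) * (vy w + by_) - t * (vy w + ay) * (vx w + bx) =
  t * ((vx w + ax) * (vy w + by_) - (vy w + ay) * (vx w + bx)) by ring.
have -> : t * (vx w + ax) * (vx w + bx) + t * (vy w + ay) * (vy w + by_) =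
  t * ((vx w + ax) * (vx w + bx) + (vy w + ay) * (vy w + by_)) by ring.
rewrite normrM (gtr0_norm t0) ltr_pM2l // ltr_norml.
by apply/andP; split; lra.
Qed.
End Lift.

(** * Legs near a puncture *)

Lemma finite_min (R : realType) (F : finType) (Q : F -> R -> Prop) :
  (forall e, exists2 t0, 0 < t0 & forall t, 0 < t <= t0 -> Q e t) ->
  exists2 t0, 0 < t0 & forall e t, 0 < t <= t0 -> Q e t.
Proof.
move=> h.
suff [t0 p0 ht] : exists2 t0, 0 < t0 & forall e t, e \in enum F -> 0 < t <= t0 -> Q e t.
  by exists t0 => // e t; apply: ht; rewrite mem_enum.
elim: (enum F) => [|e s [t0 p0 ht]]; first by exists 1.
have [t1 p1 ht1] := h e; exists (Num.min t0 t1); first by rewrite lt_min p0.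
move=> e' t; rewrite inE => /orP[/eqP ->|es] /andP[tp]; rewrite le_min => /andP[tt0 tt1].
  by apply: ht1; rewrite tp.
by apply: ht => //; rewrite tp.
Qed.

Lemma finite_set_gt (R : realType) (A : set R) : finite_set A -> (forall x, A x -> 0 < x) ->
  exists2 d, 0 < d & forall x, A x -> d < x.
Proof.
move=> /finite_seqP[s ->]; elim: s => [|x s IH] h; first by exists 1.
have [d d0 hd] : exists2 d, 0 < d & forall x, [set` s] x -> d < x.
  by apply: IH => y ys; apply: h; rewrite /= inE (ys : y \in s) orbT.
have x0 : 0 < x by apply: h; rewrite /= inE eqxx.
exists (Num.min d (x / 2)); first by rewrite lt_min d0 divr_gt0.
move=> y; rewrite /= inE => /orP[/eqP ->|ys]; rewrite gt_min.
  by apply/orP; right; rewrite ltr_pdivrMr // mulr_natr mulr2n ltrDl.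
by apply/orP; left; exact: hd.
Qed.

Lemma finite_isolated (T : topologicalType) (K C : set T) : compact K -> C `<=` K ->
  (forall x, K x -> \forall y \near x, C y -> y = x) -> finite_set C.
Proof.
move=> cK CK iso; apply: contrapT => infC.
(* The sets containing all but finitely many points of [C]. If [C] were infinite, this proper filter
   would have a cluster point in [K], against isolation. *)
pose F : set_system T := [set X | finite_set (C `\` X)].
have FF : ProperFilter F.
  split.
    by rewrite /F /= classical_sets.setD0.
  split.
  - by rewrite /F /= classical_sets.setDT; exact: finite_set0.
  - move=> X Y FX FY; rewrite /F /= classical_sets.setDIr finite_setU; by split.
  - move=> X Y XY FX; apply: sub_finite_set FX => x [Cx nY]; split => // Xx; exact: nY (XY _ Xx).
have FK : F K.
  rewrite /F /=; have -> : C `\` K = classical_sets.set0.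
    by apply/seteqP; split => // x [/CK].
  exact: finite_set0.
have [x [Kx clx]] := cK F FF FK.
have FX : F (C `\ x).
  apply: sub_finite_set (finite_set1 x) => y [Cy nCy] /=.
  by apply: contrapT => yx; apply: nCy.
have [y [[Cy yx] hy]] := clx _ _ FX (iso x Kx).
by apply: yx; exact: hy.
Qed.

Section Clean.
Context {R : realType} {S : marked_surface R} {K : flavour} {k : nat}.
Variables (T : diagram S K k) (vp : vertex T).
Hypothesis pp : puncture (pos vp).
Let p := pos vp.

Lemma puncture_kind : kind vp = Marked.
Proof.
apply: contrapT => h; have [_ nm] := pos_unmarked h; exact: nm pp.1.
Qed.

Lemma puncture_tgt (e : edge T) : tgt e <> vp.
Proof.
move=> h; have := vertex_rule vp; rewrite puncture_kind => iv.
by have := mem_ins vp e; rewrite iv h eqxx.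
Qed.

(** [r0] bounds the disc that carries the polar coordinates. Within [R1] the diagram consists only
    of the puncture and of parts of its legs before the time [ts]; up to this time the legs are
    nearly radial, have polar lifts and no crossings. *)
Record clean_disc (i0 : chart_ix S) (r0 R1 ts : R) : Prop := {
  cl_dom : dom i0 p;
  cl_r0 : 0 < r0;
  cl_disc : forall x, `|x - chart i0 p| < r0 -> 0 < vy x /\ exists2 y, dom i0 y & chart i0 y = x;
  cl_marked : forall x, `|x - chart i0 p| < r0 -> marked S (psi p i0 x) -> x = chart i0 p;
  cl_R1 : 0 < R1 <= r0;
  cl_ts : 0 < ts < 1;
  cl_near : forall (e : edge T) t, unit_itv t -> dom i0 (curve e t) ->
    `|chart i0 (curve e t) - chart i0 p| < R1 -> src e = vp /\ t < ts;
  cl_cone : forall (e : edge T) t, src e = vp -> 0 < t <= ts ->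
    let z := chart i0 (curve e t) - chart i0 p in let y := vel e t i0 in
    `|vx z * vy y - vy z * vx y| < vx z * vx y + vy z * vy y;
  cl_cross : forall (e : edge T) t q, src e = vp -> 0 < t <= ts -> ~ crossing ((e, t), q);
  cl_vertex : forall v : vertex T, dom i0 (pos v) -> `|chart i0 (pos v) - chart i0 p| < R1 -> v = vp;
  cl_lift : forall e : edge T, src e = vp ->
    exists a, polar_lift p i0 r0 (curve e) (tlift e) ts a }.

Lemma vertex_away : \forall y \near p, forall v : vertex T, v <> vp -> pos v <> y.
Proof.
have cl1 (x : S) : closed [set x] by apply: compact_closed; [exact: surf_hausdorff|exact: compact_set1].
have h (v : vertex T) : \forall y \near p, v <> vp -> pos v <> y.
  have [->|nv] := pselect (v = vp); first exact: nearW.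
  have : open_nbhs p (~` [set pos v]).
    by split; [apply: closed_openC; exact: cl1|move=> /= h; exact: nv (esym (pos_inj h))].
  by move=> /open_nbhs_nbhs; apply: filterS => y /= h _ e; apply: h.
exact: (@filter_forall _ _ (fun v y => v <> vp -> pos v <> y) (nbhs p) _ h).
Qed.

Lemma chart_nbhs i0 r0 (P : set S) : dom i0 p -> 0 < r0 ->
  (forall x, `|x - chart i0 p| < r0 -> 0 < vy x /\ exists2 y, dom i0 y & chart i0 y = x) ->
  (\forall y \near p, P y) -> exists2 R1, 0 < R1 <= r0 &
    forall y, dom i0 y -> `|chart i0 y - chart i0 p| < R1 -> P y.
Proof.
move=> dp r00 disc nP.
have c : psi p i0 x @[x --> chart i0 p] --> p.
  by have := psi_continuous disc (x := chart i0 p); rewrite subrr normr0 psi_chart // => /(_ r00).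
have [d d0 hd] := nbhs_norm_lt (cvg_near c nP).
exists (Num.min d r0); first by rewrite lt_min d0 r00 ge_min lexx orbT.
move=> y dy; rewrite lt_min => /andP[yd yr].
by have := hd _ yd; rewrite psi_chart.
Qed.

Lemma clean_exists : exists i0 r0 R1 ts, clean_disc i0 r0 R1 ts.
Proof.
have np : ~ bdry S p := pp.2.
have [i0 dp] := dom_cover p.
have [r1 r10 disc1] := disc_exists dp np.
have [r0 /andP[r00 r0r1] hv] := chart_nbhs dp r10 disc1 vertex_away.
have disc x : `|x - chart i0 p| < r0 -> 0 < vy x /\ exists2 y, dom i0 y & chart i0 y = x.
  by move=> xr; apply: disc1; exact: lt_le_trans r0r1.
have dm x : `|x - chart i0 p| < r0 -> marked S (psi p i0 x) -> x = chart i0 p.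
  move=> xr mx; have [v _ ev] := marked_vertex T mx.
  have [dx ex] := psiP disc xr.
  have [vv|nv] := pselect (v = vp); first by rewrite -ex -ev vv.
  by case: (hv _ dx _ v nv); rewrite ?ex.
have hts (e : edge T) : exists2 t0, 0 < t0 & forall ts, 0 < ts <= t0 -> src e = vp -> ts < 1 /\
    (let z := chart i0 (curve e ts) - chart i0 p in let y := vel e ts i0 in
    `|vx z * vy y - vy z * vx y| < vx z * vx y + vy z * vy y) /\
    (forall q, ~ crossing ((e, ts), q)) /\
    (exists a, polar_lift p i0 r0 (curve e) (tlift e) ts a).
  have [se|nse] := pselect (src e = vp); last by exists 1.
  have c0 : curve e 0 = p by rewrite curve_src se.
  have [ta ta0 [a ha]] := polar_lift_exists dp pp r00 (lift_framed e) c0.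
  have [tb tb0 hb] : exists2 tb, 0 < tb & forall t, 0 < t <= tb -> t <= 1 ->
      let z := chart i0 (curve e t) - chart i0 p in let y := vel e t i0 in
      `|vx z * vy y - vy z * vx y| < vx z * vx y + vy z * vy y.
    apply: (vel_cone dp c0).
    - exact: curve_continuous.
    - move=> eps eps0; apply: curve_vel => //; first exact: unit_itv0.
      by rewrite c0.
    - exact: vel_continuous.
    - by have [_ h] := curve_immersed e unit_itv0; apply: h; rewrite c0.
  have [tc tc0 hc] : exists2 tc, 0 < tc & forall t, 0 < t <= tc -> forall q, ~ crossing ((e, t), q).
    have fA : finite_set [set q.1.2 | q in [set q | @crossing _ _ _ _ T q]].
      by apply: finite_image; exact: crossing_finite.
    have [|d d0 hd] := finite_set_gt fA; first by move=> x [q [/andP[h _] _ _ _] <-].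
    exists d => // t /andP[t0 td] q cq; have hdt : d < t by apply: hd; exists ((e, t), q).
    by rewrite ltNge td in hdt.
  exists (Num.min (Num.min ta tb) (Num.min tc (1 / 2))).
    by rewrite !lt_min ta0 tb0 tc0 divr_gt0.
  move=> ts /andP[ts0]; rewrite !le_min => /andP[/andP[h1 h2] /andP[h3 h4]] _.
  have ts1 : ts < 1 by lra.
  split=> //; split; first by apply: hb; rewrite ?ts0 // ltW.
  split; first by apply: hc; rewrite ts0.
  by exists a; apply: ha; rewrite ts0.
have [t0 t00 ht0] := finite_min hts.
pose ts := Num.min t0 (1 / 2).
have ts0 : 0 < ts by rewrite lt_min t00 divr_gt0.
have tst : ts <= t0 by rewrite ge_min lexx.
have ts1 : ts < 1 by rewrite gt_min; apply/orP; right; lra.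
(* [R1] is chosen after [ts]: the other edges and the legs from the time [ts] on are compact sets
   missing [p]. *)
have away : \forall y \near p, forall e : edge T, forall t, unit_itv t -> (src e = vp -> ts <= t) -> curve e t <> y.
  have h (e : edge T) : \forall y \near p, forall t, unit_itv t -> (src e = vp -> ts <= t) -> curve e t <> y.
    pose l := if src e == vp then ts else 0.
    have l01 : 0 <= l <= 1 by rewrite /l; case: (src e =P vp) => _; rewrite ?lexx ?ler01 // !ltW.
    have sI : `[l, 1] `<=` unit_itv.
      move=> t; rewrite /= in_itv /= => /andP[lt t1]; rewrite /unit_itv /= t1 andbT.
      by case/andP: l01 => l0 _; exact: le_trans lt.
    have cl : closed [set curve e t | t in `[l, 1]].
      apply: compact_closed; first exact: surf_hausdorff.
      apply: (@continuous_compact _ _ (curve e)); last exact: segment_compact.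
      by apply: (continuous_subspaceW (B := unit_itv)); [exact: sI|exact: curve_continuous].
    have np' : ~ [set curve e t | t in `[l, 1]] p.
      move=> [t]; rewrite /= in_itv /= => /andP[lt t1] ct.
      have [t1'|t1'] := ltP t 1; last first.
        have e1 : t = 1 by apply/eqP; rewrite eq_le t1.
        by rewrite e1 curve_tgt in ct; exact: puncture_tgt (pos_inj ct).
      have t0' : 0 <= t by case/andP: l01 => l0 _; exact: le_trans lt.
      move: t0'; rewrite le_eqVlt => /orP[/eqP t0'|t0'].
        move: ct lt; rewrite -t0' curve_src => /pos_inj ss; rewrite /l; case: (src e =P vp) => // _.
        by rewrite leNgt ts0.
      have [_ h] := curve_interior e (t := t) ltac:(by rewrite t0'); exact: h ct.
    have : open_nbhs p (~` [set curve e t | t in `[l, 1]]) by split=> //; exact: closed_openC.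
    move=> /open_nbhs_nbhs; apply: filterS => y /= ny t t1 tl e1; apply: ny.
    exists t => //; rewrite /= in_itv /=; case/andP: t1 => t0' t1; rewrite t1 andbT /l.
    by case: (src e =P vp) => // h; exact: tl.
  exact: (@filter_forall _ _ (fun (e : edge T) y => forall t, unit_itv t -> (src e = vp -> ts <= t) -> curve e t <> y) (nbhs p) _ h).
have [R1 R1r hR1] := chart_nbhs dp r00 disc (filterI away vertex_away).
exists i0, r0, R1, ts; split => //.
- by rewrite ts0.
- move=> e t t1 dt xt; have [h _] := hR1 _ dt xt.
  have ns : src e = vp /\ t < ts; last by [].
  apply: contrapT => hn; apply: (h e t t1) => // se; rewrite leNgt; apply/negP => tt; exact: hn.
- by move=> e t se /andP[t0' tt]; have [_ []] := ht0 e t ltac:(by rewrite t0' (le_trans tt)) se.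
- by move=> e t q se /andP[t0' tt]; have [_ [_ []]] := ht0 e t ltac:(by rewrite t0' (le_trans tt)) se.
- move=> v dv xv; apply: contrapT => nv; have [_ h] := hR1 _ dv xv; exact: (h v nv).
- by move=> e se; have [_ [_ [_ ?]]] := ht0 e ts ltac:(by rewrite ts0 tst) se.
Qed.
End Clean.

(** * The hook *)

Section Calculus.
Context {R : realType}.

Lemma derive_approx (f : R -> R) (t df : R) : is_derive t (1 : R) f df -> forall e : R, 0 < e ->
  exists2 d : R, 0 < d & forall t', `|t' - t| < d -> `|f t' - f t - (t' - t) * df| <= e * `|t' - t|.
Proof.
move=> [fd dfe] e e0.
have c : h^-1 *: ((f \o shift t) (h *: (1 : R)) - f t) @[h --> (0 : R)^'] --> df.
  by rewrite -dfe; exact: fd.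
move/cvgrPdist_le: c => /(_ e e0).
rewrite /prop_near1 /= /dnbhs /within /= => /nbhs_norm_lt[d d0 hd]; exists d => // t' td.
have [->|nt] := eqVneq t' t; first by rewrite !subrr mul0r subrr normr0 mulr0.
have h0 : t' - t != 0 by rewrite subr_eq0.
have := hd (t' - t); rewrite subr0 => /(_ td h0); rewrite /shift /= scaler1 subrK.
have -> : f t' - f t - (t' - t) * df = - ((t' - t) * (df - (t' - t)^-1 * (f t' - f t))).
  by field.
by rewrite normrN normrM mulrC => h; apply: ler_wpM2r.
Qed.

Lemma affine_trig_derive (trig trig' : R -> R) (u a b c d t : R) :
  (forall x : R, is_derive x (1 : R) trig (trig' x)) ->
  is_derive t (1 : R) (fun t : R => u + ((1 - t) * a + t * b) * trig ((1 - t) * c + t * d))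
    (((1 - t) * a + t * b) * (trig' ((1 - t) * c + t * d) * (d - c)) +
     (b - a) * trig ((1 - t) * c + t * d)).
Proof.
move=> ht.
have aff (x y : R) : is_derive t (1 : R) (fun t : R => (1 - t) * x + t * y) (y - x).
  have -> : (fun t : R => (1 - t) * x + t * y) = (cst x + id * cst (y - x)).
    by apply/funext => z; rewrite !fctE /cst /=; ring.
  apply: is_derive_eq.
  by rewrite scaler0 !add0r /cst /GRing.scale /= mulr1.
have comp : is_derive t (1 : R) (trig \o (fun t : R => (1 - t) * c + t * d)) (trig' ((1 - t) * c + t * d) * (d - c)).
  exact: is_derive1_comp.
have -> : (fun t : R => u + ((1 - t) * a + t * b) * trig ((1 - t) * c + t * d)) =
   cst u + (fun t : R => (1 - t) * a + t * b) * (trig \o (fun t : R => (1 - t) * c + t * d)).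
  by apply/funext.
apply: is_derive_eq.
by rewrite add0r; congr (_ + _); rewrite /GRing.scale /= mulrC.
Qed.

Lemma row_free2 (v w : 'rV[R]_2) : vx v * vy w - vy v * vx w != 0 -> row_free (col_mx v w).
Proof.
move=> D0; apply: inj_row_free => u.
rewrite -(hsubmxK u) mul_row_col => h.
set a := lsubmx u in h *; set b := rsubmx u in h *.
have ea (M : 'M[R]_(1, 2)) (x : 'M[R]_1) : x *m M = x ord0 ord0 *: M.
  by apply/rowP => j; rewrite !mxE big_ord1; congr (_ * _); rewrite ?(ord1 ord0).
have hx := congr1 vx h; have hy := congr1 vy h.
move: hx hy; rewrite !ea !v2E => hx hy.
set al := a ord0 ord0 in hx hy; set be := b ord0 ord0 in hx hy.
have a0 : al * (vx v * vy w - vy v * vx w) = 0.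
  transitivity ((al * vx v + be * vx w) * vy w - (al * vy v + be * vy w) * vx w); first by ring.
  by rewrite hx hy !mul0r subrr.
have b0 : be * (vx v * vy w - vy v * vx w) = 0.
  transitivity ((al * vy v + be * vy w) * vx v - (al * vx v + be * vx w) * vy v); first by ring.
  by rewrite hx hy !mul0r subrr.
move/eqP: a0; rewrite mulf_eq0 (negbTE D0) orbF => /eqP a0.
move/eqP: b0; rewrite mulf_eq0 (negbTE D0) orbF => /eqP b0.
have -> : a = 0 by apply/matrixP => i j; rewrite !ord1 [in RHS]mxE; exact: a0.
have -> : b = 0 by apply/matrixP => i j; rewrite !ord1 [in RHS]mxE; exact: b0.
by rewrite row_mx0.
Qed.

(** Quantitative isolation of a transverse crossing: [x] and [y] are displacements along two curves
    with velocities [v] and [w]. If they coincide, [s *: v - t *: w] is small relative to |s| + |t|,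
    whereas the determinant bounds it from below. *)
Lemma isolated_crossing (v w : 'rV[R]_2) : vx v * vy w - vy v * vx w != 0 ->
  exists2 e : R, 0 < e & forall (x y : 'rV[R]_2) (s t : R),
    `|x - s *: v| <= e * `|s| -> `|y - t *: w| <= e * `|t| -> x = y -> s = 0 /\ t = 0.
Proof.
move=> D0; set D := vx v * vy w - vy v * vx w in D0 *.
set N := `|v| + `|w| + 1; have N0 : 0 < N by rewrite ltr_wpDl // addr_ge0.
have D1 : 0 < `|D| by rewrite normr_gt0.
(* With the factor 8, the estimate bounds (|s| + |t|) |D| by half of itself. *)
exists (`|D| / (8 * N)); first by rewrite divr_gt0 // mulr_gt0.
set e := `|D| / (8 * N) => x y s t hx hy xy.
have eN : e * (8 * N) = `|D| by rewrite /e divfK // gt_eqF // mulr_gt0.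
have e0 : 0 < e by rewrite divr_gt0 // mulr_gt0.
have hq : `|s *: v - t *: w| <= e * (`|s| + `|t|).
  have -> : s *: v - t *: w = (y - t *: w) - (x - s *: v).
    by rewrite xy; apply/rowP => j; rewrite !mxE; ring.
  by apply: (le_trans (ler_normB _ _)); rewrite mulrDr addrC lerD.
set q := s *: v - t *: w in hq.
have b1 := le_trans (vx_le q) hq; have b2 := le_trans (vy_le q) hq.
have n1 := vx_le v; have n2 := vy_le v; have n3 := vx_le w; have n4 := vy_le w.
set M := e * (`|s| + `|t|) in b1 b2.
have M0 : 0 <= M by rewrite mulr_ge0 ?addr_ge0 // ltW.
have vN : `|v| <= N by rewrite /N; have := normr_ge0 w; lra.
have wN : `|w| <= N by rewrite /N; have := normr_ge0 v; lra.
have prodb (z1 z2 c1 c2 : R) : `|z1| <= c1 -> `|z2| <= c2 -> `|z1 * z2| <= c1 * c2.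
  by move=> q1 q2; rewrite normrM; apply: ler_pM.
have hs : `|s| * `|D| <= 2 * M * N.
  have -> : `|s| * `|D| = `|vx q * vy w - vy q * vx w|.
    by rewrite -normrM; congr `|_|; rewrite /q /D !v2E; ring.
  apply: (le_trans (ler_normB _ _)).
  have := prodb _ _ _ _ b1 (le_trans n4 wN); have := prodb _ _ _ _ b2 (le_trans n3 wN); lra.
have htt : `|t| * `|D| <= 2 * M * N.
  have -> : `|t| * `|D| = `|vx q * vy v - vy q * vx v|.
    by rewrite -normrM; congr `|_|; rewrite /q /D !v2E; ring.
  apply: (le_trans (ler_normB _ _)).
  have := prodb _ _ _ _ b1 (le_trans n2 vN); have := prodb _ _ _ _ b2 (le_trans n1 vN); lra.
have s0 := normr_ge0 s; have t0 := normr_ge0 t.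
have key : (`|s| + `|t|) * `|D| <= (`|s| + `|t|) * `|D| / 2.
  have -> : (`|s| + `|t|) * `|D| / 2 = 4 * M * N.
    by rewrite -eN /M; field.
  rewrite mulrDl; lra.
have sum0 : `|s| + `|t| = 0.
  apply/eqP; rewrite eq_le addr_ge0 // andbT -(ler_pM2r D1) mul0r; lra.
split; apply/eqP; rewrite -normr_eq0; apply/eqP; lra.
Qed.
End Calculus.

(** * The hook as a spiral arc *)

Section Spiral.
Context {R : realType} {S : marked_surface R} {K : flavour} {k : nat}.
Variables (T : diagram S K k) (vp : vertex T).
Hypothesis pp : puncture (pos vp).
Let p := pos vp.
Variables (i0 : chart_ix S) (r0 R1 ts : R).
Hypothesis cd : clean_disc vp i0 r0 R1 ts.
Let dp := cl_dom cd. Let r00 := cl_r0 cd. Let disc := cl_disc cd. Let dm := cl_marked cd.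
Let x0 := chart i0 p.
Variables aq aw : @param R.
Hypotheses (raq : regular r0 aq) (raw : regular r0 aw) (rwq : prad aw < prad aq) (rqR : prad aq < R1).
Hypothesis gentle : prad aq - prad aw < prad aw * (pang aw - pang aq).

Definition hook t := Pt p i0 (lin aq aw t).
Definition hook_frame t := Fr p i0 (lin aq aw t).
Definition hook_plane t := plane_pt p i0 (lin aq aw t).
(** The velocity in polar coordinates, with radial part r' and angular part r theta'. *)
Definition hook_vel0 t := rot (pang (lin aq aw t))
  (mkv (prad aw - prad aq) (prad (lin aq aw t) * (pang aw - pang aq))).
Definition hook_vel t := frame_at i0 (hook t) (hook_vel0 t).

Lemma hook_reg t : unit_itv t -> regular r0 (lin aq aw t).
Proof. by move=> t1; apply: regular_lin. Qed.

Lemma hook_framed : framed_path hook hook_frame.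
Proof. by apply: (path_framed dp pp r00 disc dm); left; exact: rpath_lin. Qed.

Lemma hook_cont : {within unit_itv, continuous hook}.
Proof. exact: framed_path_cont hook_framed. Qed.

Lemma hook_norm t : unit_itv t -> `|hook_plane t - x0| < r0.
Proof. by move=> t1; apply: regular_norm; exact: hook_reg. Qed.

Lemma hook_rad t : unit_itv t -> prad aw <= prad (lin aq aw t) <= prad aq.
Proof.
move=> /andP[t0 t1]; have -> : prad (lin aq aw t) = (1 - t) * prad aq + t * prad aw by [].
by apply/andP; split; have := rwq; nra.
Qed.

Lemma hook_normR t : unit_itv t -> `|hook_plane t - x0| < R1.
Proof.
move=> t1; have /andP[_ h] := hook_rad t1; have [/andP[h0 _] _] := hook_reg t1.
rewrite /hook_plane /plane_pt addrC addKr norm2_lt !v2E !mul0r subr0 addr0 !normrM (gtr0_norm h0).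
by apply/andP; split; apply: le_lt_trans rqR; apply: le_trans h; rewrite ler_piMr ?cos_max ?sin_max // ltW.
Qed.

Lemma hook_dom t : unit_itv t -> dom i0 (hook t) /\ chart i0 (hook t) = hook_plane t.
Proof. by move=> t1; exact: (psiP disc (hook_norm t1)). Qed.

(** The distance to the puncture decreases strictly along the hook. *)
Lemma hook_inj s t : unit_itv s -> unit_itv t -> hook s = hook t -> s = t.
Proof.
move=> s1 t1 e; have [/andP[rs _] _] := hook_reg s1; have [/andP[rt _] _] := hook_reg t1.
have e2 : hook_plane s = hook_plane t by rewrite -(hook_dom s1).2 -(hook_dom t1).2 e.
move: e2; rewrite /hook_plane /plane_pt => /addrI e2.
have := rot_norm2 (pang (lin aq aw s)) (mkv (prad (lin aq aw s)) 0).
rewrite e2 rot_norm2 !mkvx !mkvy !expr0n /= !addr0 => /eqP.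
rewrite eqrXn2 ?(ltW rs) ?(ltW rt) // => /eqP; rewrite /prad /= -/(prad aw) -/(prad aq) => h.
have : (t - s) * (prad aq - prad aw) = 0 by lra.
move/eqP; rewrite mulf_eq0 => /orP[|]; rewrite subr_eq0 => /eqP // h2.
by have := rwq; rewrite h2 ltxx.
Qed.

Lemma hook_inner t : unit_itv t -> ~ bdry S (hook t) /\ forall v : vertex T, hook t <> pos v.
Proof.
move=> t1; split; first by apply: (psi_nbdry disc); exact: hook_norm.
move=> v e; have [dt et] := hook_dom t1.
have vv : v = vp by apply: (cl_vertex cd); rewrite -e // et; exact: hook_normR.
have := regular_neq (p := p) (i0 := i0) (hook_reg t1); apply.
by rewrite -/(hook_plane t) -et e vv.
Qed.

Lemma hook_vel_tangent t : unit_itv t -> nonzero_tangent (hook t) (hook_vel t).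
Proof.
move=> t1; apply: (frame_at_tangent disc); first exact: hook_norm.
apply/eqP => /rot_eq0/(congr1 vy); rewrite mkvy vy0 => /eqP.
have [/andP[h0 _] _] := hook_reg t1; have [/andP[h1 _] _] := raw.
rewrite mulf_eq0 gt_eqF //= subr_eq0 => /eqP h; have := gentle; rewrite h subrr mulr0.
by have := rwq; lra.
Qed.

Lemma hook_plane_diff t (e : R) : 0 < e -> exists2 d : R, 0 < d & forall t', `|t' - t| < d ->
  `|hook_plane t' - hook_plane t - (t' - t) *: hook_vel0 t| <= e * `|t' - t|.
Proof.
move=> e0.
have fx := affine_trig_derive (trig := @cos R) (vx x0) (prad aq) (prad aw) (pang aq) (pang aw) t (@is_derive_cos R).
have fy := affine_trig_derive (trig := @sin R) (vy x0) (prad aq) (prad aw) (pang aq) (pang aw) t (@is_derive_sin R).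
have [d1 d10 h1] := derive_approx fx e0; have [d2 d20 h2] := derive_approx fy e0.
exists (Num.min d1 d2); first by rewrite lt_min d10.
move=> t'; rewrite lt_min => /andP[td1 td2].
rewrite norm2_le; apply/andP; split.
  apply: le_trans (h1 t' td1); rewrite le_eqVlt; apply/orP; left; apply/eqP; congr `|_|.
  by rewrite /hook_plane /hook_vel0 /plane_pt /lin /prad /pang /= !v2E /=; ring.
apply: le_trans (h2 t' td2); rewrite le_eqVlt; apply/orP; left; apply/eqP; congr `|_|.
by rewrite /hook_plane /hook_vel0 /plane_pt /lin /prad /pang /= !v2E /=; ring.
Qed.

Lemma hook_diff t i : unit_itv t -> dom i (hook t) -> forall eps : R, 0 < eps ->
  exists2 r : R, 0 < r & forall t', unit_itv t' -> `|t' - t| < r ->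
    `|chart i (hook t') - chart i (hook t) - (t' - t) *: hook_vel t i| <= eps * `|t' - t|.
Proof.
move=> t1 di eps eps0; set D := dtrans i0 i (hook t); set V := hook_vel0 t.
have C0 : 0 < `|V| + 1 by rewrite ltr_wpDl.
have e10 : 0 < eps / (2 * (`|V| + 1)) by rewrite divr_gt0 // mulr_gt0.
have [d1 d10 h1] := nbhs_norm_lt (psi_diff disc (hook_norm t1) di e10).
have E0 : 0 < 4 * `|D| + 1 by rewrite ltr_wpDl // mulr_ge0.
have e20 : 0 < Num.min 1 (eps / (4 * `|D| + 1)) by rewrite lt_min ltr01 divr_gt0.
have [d2 d20 h2] := hook_plane_diff t e20.
exists (Num.min d2 (d1 / (`|V| + 1))); first by rewrite lt_min d20 divr_gt0.
move=> t' t1'; rewrite lt_min ltr_pdivlMr // => /andP[td2 td1].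
have k2 := h2 t' td2; set m := Num.min 1 _ in e20 k2.
have m1 : m <= 1 by rewrite ge_min lexx.
have m2 : m <= eps / (4 * `|D| + 1) by rewrite ge_min lexx orbT.
have n0 := normr_ge0 (t' - t); have V0 := normr_ge0 V; have D0 := normr_ge0 D.
have xb : `|hook_plane t' - hook_plane t| <= (`|V| + 1) * `|t' - t|.
  rewrite -(subrK ((t' - t) *: V) (hook_plane t' - hook_plane t)).
  by apply: (le_trans (ler_normD _ _)); rewrite normrZ; nra.
have [_ k1] := h1 (hook_plane t') ltac:(by apply: (le_lt_trans xb); rewrite mulrC).
have -> : chart i (hook t') - chart i (hook t) - (t' - t) *: hook_vel t i =
   (chart i (hook t') - chart i (hook t) - (hook_plane t' - hook_plane t) *m D) +
   (hook_plane t' - hook_plane t - (t' - t) *: V) *m D.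
  rewrite (mulmxBl (hook_plane t' - hook_plane t) ((t' - t) *: V)) -scalemxAl /hook_vel /frame_at -/D -/V.
  by rewrite addrA subrK.
apply: (le_trans (ler_normD _ _)).
have l1 : eps / (2 * (`|V| + 1)) * `|hook_plane t' - hook_plane t| <= eps / 2 * `|t' - t|.
  apply: (le_trans (ler_wpM2l (ltW e10) xb)).
  by rewrite mulrA le_eqVlt; apply/orP; left; apply/eqP; congr (_ * _); field; rewrite gt_eqF.
have l2 : `|(hook_plane t' - hook_plane t - (t' - t) *: V) *m D| <= eps / 2 * `|t' - t|.
  apply: (le_trans (norm2_mulmx _ _)).
  have q1 : 2 * m * `|D| <= eps / 2.
    have := ler_wpM2r (ltW E0) m2; rewrite divfK ?gt_eqF // => q; nra.
  have q2 := ler_wpM2r D0 k2; nra.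
by have := k1; lra.
Qed.

Lemma hook_vel_cont i :
  {within [set t | unit_itv t /\ dom i (hook t)], continuous (fun t => hook_vel t i)}.
Proof.
set A := [set t | _].
have AI : A `<=` unit_itv by move=> t [].
apply/withinP => t At; have [t1 dt] := At.
have aff (u v : R) : (fun x : R => (1 - x) * u + x * v) x @[x --> within A (nbhs t)] --> (1 - t) * u + t * v.
  have c := continuous_subspaceW AI (@cont_aff R u v).
  by move/withinP: c => /(_ t At).
have c : hook x @[x --> within A (nbhs t)] --> hook t.
  have c := continuous_subspaceW AI (@hook_cont).
  by move/withinP: c => /(_ t At).
apply: cvg_mulmx2.
- apply: cvg_rot; first exact: aff.
  apply: cvg_rv2; [under eq_fun do rewrite mkvx; rewrite mkvx|under eq_fun do rewrite mkvy; rewrite mkvy].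
    exact: cvg_cst.
  by apply: cvgM; [exact: aff|exact: cvg_cst].
- exact: (cvg_comp _ _ c (dtrans_continuous (hook_dom t1).1 dt)).
Qed.

(** The hook stays within the radius [R1], so [cl_near] applies, and it avoids the puncture. *)
Lemma hook_meets (e : edge T) s t : unit_itv s -> unit_itv t -> hook s = curve e t ->
  src e = vp /\ 0 < t < ts.
Proof.
move=> s1 t1 est; have [ds es] := hook_dom s1.
have [se tts] := cl_near cd (e := e) (t := t) t1 ltac:(by rewrite -est) ltac:(by rewrite -est es; exact: hook_normR).
split=> //; rewrite tts andbT lt_neqAle; case/andP: t1 => -> _; rewrite andbT eq_sym.
apply/eqP => t0; have [_ h] := hook_inner s1; apply: (h vp).
by rewrite est t0 curve_src se.
Qed.

(* Legs leave p almost radially, by [cl_cone], and the hook turns around p more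
   than it approaches p, by [gentle]. *)
Lemma hook_det (e : edge T) s t : unit_itv s -> unit_itv t -> hook s = curve e t ->
  vx (hook_vel0 s) * vy (vel e t i0) - vy (hook_vel0 s) * vx (vel e t i0) != 0.
Proof.
move=> s1 t1 est; have [se /andP[t0 tts]] := hook_meets s1 t1 est.
have := cl_cone cd (e := e) (t := t) se ltac:(by rewrite t0 ltW); rewrite /= -est (hook_dom s1).2.
set y := vel e t i0; set th := pang (lin aq aw s); set r := prad (lin aq aw s).
have [/andP[r1 r2] _] := hook_reg s1; rewrite -/r in r1 r2.
have -> : hook_plane s - chart i0 (pos vp) = rot th (mkv r 0) by rewrite /hook_plane /plane_pt addrC addKr.
rewrite -(rotvNK th y); set y' := rot (- th) y; rewrite /hook_vel0 -/th -/r.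
have det a (v w : 'rV[R]_2) : vx (rot a v) * vy (rot a w) - vy (rot a v) * vx (rot a w) = vx v * vy w - vy v * vx w.
  rewrite !rotx !roty; transitivity ((vx v * vy w - vy v * vx w) * (cos a ^+ 2 + sin a ^+ 2)); first by ring.
  by rewrite cos2Dsin2 mulr1.
have dot a (v w : 'rV[R]_2) : vx (rot a v) * vx (rot a w) + vy (rot a v) * vy (rot a w) = vx v * vx w + vy v * vy w.
  rewrite !rotx !roty; transitivity ((vx v * vx w + vy v * vy w) * (cos a ^+ 2 + sin a ^+ 2)); first by ring.
  by rewrite cos2Dsin2 mulr1.
rewrite !det dot !mkvx !mkvy !mul0r subr0 addr0 normrM (gtr0_norm r1) ltr_pM2l // => hc.
have /andP[rr _] := hook_rad s1; rewrite -/r in rr.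
have [/andP[w0 _] _] := raw.
have De : 0 < pang aw - pang aq by have := gentle; have := rwq; nra.
have k1 : prad aq - prad aw < r * (pang aw - pang aq) by apply: (lt_le_trans gentle); rewrite ler_pM2r.
set P := r * _ in k1 *; set q := prad aw - prad aq.
have qn : q < 0 by rewrite /q subr_lt0.
move: hc; rewrite -!/(vx _) -!/(vy _); set y1 := _ + _ * cos _; set y2 := _ * cos _ - _ => hc.
have c0 : 0 < y2 by apply: le_lt_trans hc.
move: hc; rewrite ltr_norml => /andP[h1 h2].
have Pq : 0 < P + q by rewrite /q; lra.
have z1 : q * (y1 + y2) < 0 by rewrite nmulr_rlt0 //; lra.
have z2 : 0 < (P + q) * y2 by rewrite mulr_gt0.
by apply: ltr0_neq0; lra.
Qed.

Lemma hook_transverse (e : edge T) s t i : unit_itv s -> unit_itv t -> hook s = curve e t -> dom i (hook s) ->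
  row_free (col_mx (hook_vel s i) (vel e t i)) /\ row_free (col_mx (vel e t i) (hook_vel s i)).
Proof.
move=> s1 t1 est di; have [ds es] := hook_dom s1.
have [tv _] := curve_immersed e t1; rewrite -est in tv.
set D := dtrans i0 i (hook s).
have uD : row_free D by rewrite row_free_unit unitmxE unitfE gt_eqF // dtrans_oriented.
have h := hook_det s1 t1 est.
have e1 : hook_vel s i = hook_vel0 s *m D by [].
have e2 : vel e t i = vel e t i0 *m D by rewrite (tv i0 i).
rewrite e1 e2 -!mul_col_mx /row_free !mxrankMfree // -!/(row_free _); split; apply: row_free2 => //.
by rewrite -oppr_eq0 opprB mulrC [X in _ - X]mulrC.
Qed.

(** Coincidences are isolated by transversality, and around parameters with distinct images there
    are none by Hausdorff separation; the unit square being compact, they are finite in number. *)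
Lemma hook_finite (e : edge T) :
  finite_set [set st : R * R | [/\ unit_itv st.1, unit_itv st.2 & hook st.1 = curve e st.2]].
Proof.
have cI : compact (@unit_itv R).
  have -> : @unit_itv R = `[0, 1] by apply/seteqP; split => t; rewrite /= in_itv.
  exact: segment_compact.
apply: (finite_isolated (compact_setX cI cI)); first by move=> [s t] [].
move=> [s t] [/= s1 t1].
have c1 := @hook_cont; have c2 := @curve_continuous _ _ _ _ T e.
have [est|nst] := pselect (hook s = curve e t).
  have det := hook_det s1 t1 est.
  have [eps eps0 iso] := isolated_crossing det.
  have [ds es] := hook_dom s1; have dt : dom i0 (curve e t) by rewrite -est.
  have [d1 d10 h1] := hook_plane_diff s eps0.
  have [d2 d20 h2] := curve_vel t1 dt eps0.
  have n1 : \forall x \near ((s, t) : R * R), `|x.1 - s| < d1 /\ `|x.2 - t| < d2.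
    exists ([set s' | `|s' - s| < d1], [set t' | `|t' - t| < d2]) => /=.
      by split; [apply: (ball_nbhs d10)|apply: (ball_nbhs d20)].
    by move=> [s' t'] [].
  apply: filterS n1 => -[s' t'] /= [k1 k2] [s1' t1' est'].
  have [z1 z2] := iso _ _ _ _ (h1 s' k1) (h2 t' t1' k2) ltac:(by rewrite -(hook_dom s1').2 -(hook_dom s1).2 /= est' est).
  by congr pair; apply/eqP; rewrite -subr_eq0 ?z1 ?z2.
have := @surf_hausdorff _ S; rewrite open_hausdorff => /(_ (hook s) (curve e t)) [|[A B] /= [sA tB] [oA oB AB]].
  exact/eqP.
have nA : \forall s' \near s, unit_itv s' -> A (hook s').
  by apply: (proj1 (withinP _ _) c1 s s1); apply: open_nbhs_nbhs; split=> //; exact: set_mem.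
have nB : \forall t' \near t, unit_itv t' -> B (curve e t').
  by apply: (proj1 (withinP _ _) c2 t t1); apply: open_nbhs_nbhs; split=> //; exact: set_mem.
exists ([set s' | unit_itv s' -> A (hook s')], [set t' | unit_itv t' -> B (curve e t')]) => //.
move=> [s' t'] /= [hA hB] [/= s1' t1' est'].
have : (A `&` B) (hook s') by split; [exact: hA|rewrite est'; exact: hB].
by rewrite (eqP AB).
Qed.
End Spiral.

(** * Surgery on diagrams *)

Lemma row_free_scale (R : realType) n (v w : R) (X Y : 'rV[R]_n) : v != 0 -> w != 0 ->
  row_free (col_mx X Y) -> row_free (col_mx (v *: X) (w *: Y)).
Proof.
move=> v0 w0 h; apply: inj_row_free => u.
rewrite -(hsubmxK u) mul_row_col -!scalemxAr !scalemxAl -mul_row_col.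
rewrite -(mul0mx _ (col_mx X Y)) => /(row_free_inj h)/eqP.
by rewrite row_mx_eq0 !scaler_eq0 (negbTE v0) (negbTE w0) /= => /andP[/eqP-> /eqP->]; rewrite row_mx0.
Qed.

Lemma connect_last (V : finType) (r : rel V) x y : connect r x y -> x = y \/ exists z, r z y.
Proof.
case/connectP => p; case/lastP: p => [|p y'] /=; first by move=> _ ->; left.
by rewrite rcons_path last_rcons => /andP[_ h] ->; right; exists (last x p).
Qed.

Lemma affine_within (R : realType) (u v : R) : 0 <= u -> 0 < v -> u + v <= 1 ->
  forall t, unit_itv t -> unit_itv (u + v * t).
Proof. by move=> u0 v0 uv t /andP[t0 t1]; rewrite /unit_itv /=; apply/andP; split; nra. Qed.

Section Surgery.
Context {R : realType} {S : marked_surface R} {K : flavour} {k : nat}.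
Variables (T : diagram S K k) (vp : vertex T).
Hypothesis pp : puncture (pos vp).
Variables e e' : edge T.
Hypotheses (se : src e = vp) (se' : src e' = vp) (ee' : e != e').
Variables (i0 : chart_ix S) (r0 R1 ts : R).
Hypothesis cd : clean_disc vp i0 r0 R1 ts.
Variables (t0 t1 : R).
Hypotheses (ht0 : 0 < t0 <= ts) (ht1 : 0 < t1 <= ts).
Variables aq aw : @param R.
Hypotheses (raq : regular r0 aq) (raw : regular r0 aw) (rwq : prad aw < prad aq) (rqR : prad aq < R1).
Hypothesis gentle : prad aq - prad aw < prad aw * (pang aw - pang aq).
Hypotheses (Pq : Pt (pos vp) i0 aq = curve e' t0) (Pw : Pt (pos vp) i0 aw = curve e t1).
Hypotheses (Fq : same_vec (curve e' t0) (tlift e' t0) (Fr (pos vp) i0 aq))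
           (Fw : same_vec (curve e t1) (tlift e t1) (Fr (pos vp) i0 aw)).
Hypothesis wtk : (wt e' < k)%N.

Let dp := cl_dom cd. Let r00 := cl_r0 cd. Let disc := cl_disc cd. Let dm := cl_marked cd.
Let ht0' : 0 < t0 < 1.
Proof. by case/andP: ht0 => -> /le_lt_trans; apply; case/andP: (cl_ts cd). Qed.
Let ht1' : 0 < t1 < 1.
Proof. by case/andP: ht1 => -> /le_lt_trans; apply; case/andP: (cl_ts cd). Qed.
Let sp := hook vp i0 aq aw.
Let svel := hook_vel vp i0 aq aw.
Let sfr := hook_frame vp i0 aq aw.

(* [inr true] is the black vertex on e', [inr false] the white vertex on e.
   [inl e] and [inl e'] are the outer pieces of e and e'; [ehook] joins the new
   vertices, [einner'] is the inner piece of e' and [einner _] that of e, which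
   is absent when its weight would be 0. *)
Definition svertex : finType := (vertex T + bool)%type.
Definition sedge : finType := (edge T + (bool + 'I_(nat_of_bool (1 < wt e)%N)))%type.
Definition ehook : sedge := inr (inl false).
Definition einner' : sedge := inr (inl true).
Definition einner j : sedge := inr (inr j).

Definition ssrc (d : sedge) : svertex := match d with
  | inl x => if x == e then inr false else if x == e' then inr true else inl (src x)
  | inr (inl false) => inr true
  | inr _ => inl vp end.
Definition stgt (d : sedge) : svertex := match d with
  | inl x => inl (tgt x)
  | inr (inl true) => inr true
  | inr _ => inr false end.
Definition swt (d : sedge) : nat := match d with
  | inl x => wt x
  | inr (inl true) => (wt e').+1
  | inr (inl false) => 1
  | inr (inr _) => (wt e).-1 end.
Definition skind (v : svertex) : vertex_kind := match v with
  | inl x => kind x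
  | inr b => if b then Black else White end.
Definition spos (v : svertex) : S := match v with
  | inl x => pos x
  | inr b => if b then curve e' t0 else curve e t1 end.
(** The value 0 makes an untouched edge its own outer piece. *)
Definition cutpoint (x : edge T) : R := if x == e then t1 else if x == e' then t0 else 0.
(** [Some (x, u, v)] is the piece of the old edge [x] parametrized by u + v t. All pieces inherit
    their properties through this affine change of parameter, and [None] singles out the hook. *)
Definition sorig (d : sedge) : option (edge T * R * R) := match d with
  | inl x => Some (x, cutpoint x, 1 - cutpoint x)
  | inr (inl true) => Some (e', 0, t0)
  | inr (inl false) => None
  | inr (inr _) => Some (e, 0, t1) end.
Definition scurve (d : sedge) (t : R) : S := match sorig d with
  | Some (x, u, v) => curve x (u + v * t)
  | None => sp t end.
Definition sveloc (d : sedge) (t : R) : frame S := match sorig d with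
  | Some (x, u, v) => fun i => v *: vel x (u + v * t) i
  | None => svel t end.
Definition stlift (d : sedge) (t : R) : frame S := match sorig d with
  | Some (x, u, v) => tlift x (u + v * t)
  | None => sfr t end.
Definition sref (v : svertex) : frame S := match v with
  | inl x => ref x
  | inr b => if b then tlift e' t0 else tlift e t1 end.
Definition splace (d : sedge) (t : R) : option (edge T * R) := match sorig d with
  | Some (x, u, v) => Some (x, u + v * t)
  | None => None end.

Lemma sorig_itv d x u v : sorig d = Some (x, u, v) -> [/\ 0 <= u, 0 < v & u + v <= 1].
Proof.
case: d => [y|[[|]|j]] //= [_ <- <-].
- have [c0 c1] : 0 <= cutpoint y /\ cutpoint y < 1.
    rewrite /cutpoint; case: ifP => _; first by case/andP: ht1' => /ltW.
    by case: ifP => _; [case/andP: ht0' => /ltW|].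
  by split=> //; lra.
- by case/andP: ht0' => q1 q2; split=> //; lra.
- by case/andP: ht1' => q1 q2; split=> //; lra.
Qed.

Lemma splace_itv d t x s : splace d t = Some (x, s) -> 0 < t < 1 -> 0 < s < 1.
Proof.
rewrite /splace; case E : (sorig d) => [[[y u] v]|] // [_ <-] /andP[q0 q1].
by have [u0 v0 uv] := sorig_itv E; apply/andP; split; nra.
Qed.

Lemma splace_curve d t : scurve d t = if splace d t is Some (x, s) then curve x s else sp t.
Proof. by rewrite /scurve /splace; case: (sorig d) => [[[]]|]. Qed.

Lemma splace_none d t : splace d t = None -> d = ehook.
Proof. by case: d => [y|[[|]|j]]. Qed.

(** The pieces overlap at most at their ends, so a crossing of two pieces is a crossing of the old
    diagram. *)
Lemma splace_inj d t d2 s q : 0 < t < 1 -> 0 < s < 1 ->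
  splace d t = Some q -> splace d2 s = Some q -> (d, t) = (d2, s).
Proof.
move=> /andP[q1 q2] /andP[q3 q4]; have /andP[q5 q6] := ht0'; have /andP[q7 q8] := ht1'.
have c0 y : cutpoint y < 1 by rewrite /cutpoint; case: ifP => _ //; case: ifP.
have ce : cutpoint e = t1 by rewrite /cutpoint eqxx.
have ce' : cutpoint e' = t0 by rewrite /cutpoint eq_sym (negbTE ee') eqxx.
have ee2 : e = e' -> False by move=> h; move: ee'; rewrite h eqxx.
case: d => [y|[[|]|j]] //; case: d2 => [y2|[[|]|j2]] // [<-] [].
- by move=> <- h; have h2 := c0 y2; have -> : t = s by nra.
- by move=> h1; rewrite -h1 ce' => h2; exfalso; nra.
- by move=> h1; rewrite -h1 ce => h2; exfalso; nra.
- by move=> -> h2; rewrite ce' in h2; exfalso; nra.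
- by move=> h2; have -> : t = s by nra.
- by move=> h; case: ee2.
- by move=> -> h2; rewrite ce in h2; exfalso; nra.
- by move=> h; case: ee2.
- move=> h2; have -> : t = s by nra.
  suff -> : j = j2 by []; apply/val_inj; case: j j2 => [j hj] [j2 hj2] /=.
  by move: hj hj2; case: (1 < wt e)%N => //; case: j => //; case: j2.
Qed.

Lemma no_cross y s x t : src x = vp -> 0 < t <= ts -> 0 < s < 1 -> curve y s = curve x t -> (y, s) = (x, t).
Proof.
move=> sx /andP[q0 q1] hs h; apply: contrapT => n.
apply: (cl_cross cd (e := x) (t := t) (q := (y, s)) sx); first by rewrite q0.
by split=> //=; [rewrite q0 (le_lt_trans q1) //; case/andP: (cl_ts cd)|move=> q; exact: n].
Qed.

(** Sending the new vertices to [vp] projects a cycle through an outer piece to a cycle of the old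
    diagram. The inner pieces issue from [vp], which no edge enters; and a path from the white
    vertex to the black one would have to pass through [vp]. *)
Lemma sacyclic d : ~~ connect
  (fun v v' => [exists f, (ssrc f == v) && (stgt f == v')]) (stgt d) (ssrc d).
Proof.
set r := (fun v v' : svertex => _).
pose pr (v : svertex) : vertex T := if v is inl x then x else vp.
have into f : stgt f = inl vp -> False.
  by case: f => [y|[[|]|j]] //= [] h; exact: (puncture_tgt pp h).
have prc v v' : connect r v v' -> connect (fun v v' => [exists f, (src f == v) && (tgt f == v')]) (pr v) (pr v').
  case/connectP => p; elim: p v => [|x p IH] v /=; first by move=> _ ->; exact: connect0.
  case/andP => /existsP[f /andP[/eqP <- /eqP <-]] hp hl.
  have {hp hl} := IH _ hp hl; apply: connect_trans.
  case: f => [y|[[|]|j]] /=; try exact: connect0.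
  apply: connect1; apply/existsP; exists y; rewrite eqxx andbT; apply/eqP.
  by case: eqP => [->|_]; [rewrite se|case: eqP => [->|_]; rewrite ?se'].
apply/negP => h; case: d h => [y|[[|]|j]] /= h.
- have := acyclic y; move/prc: h => /=.
  suff -> : pr (if y == e then inr false else if y == e' then inr true else inl (src y)) = src y by move=> ->.
  by case: eqP => [->|_]; [rewrite se|case: eqP => [->|_]; rewrite ?se'].
- by case: (connect_last h) => // -[v /existsP[f /andP[_ /eqP]]]; exact: into.
- have : forall v', connect r (inr false) v' -> v' <> inr true.
    move=> v' /connectP[p]; elim/last_ind: p v' => [|p x IH] v' /=; first by move=> _ ->.
    rewrite rcons_path last_rcons => /andP[hp /existsP[f2 /andP[/eqP s2 /eqP u2]]] -> x1.
    have n : last (inr false) p = inl vp.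
      by rewrite -s2; move: u2; rewrite x1; case: (f2) => [y|[[|]|j]].
    have : connect r (inr false) (inl vp) by apply/connectP; exists p.
    by case/connect_last => // -[v2 /existsP[f3 /andP[_ /eqP]]]; exact: into.
  by move=> /(_ _ h).
- by case: (connect_last h) => // -[v /existsP[f /andP[_ /eqP]]]; exact: into.
Qed.

Lemma inl_inj (A B : Type) : injective (@inl A B). Proof. by move=> x y []. Qed.
Lemma einner_inj : injective einner. Proof. by move=> x y []. Qed.

Definition outer (s : seq (edge T)) : seq sedge := [seq inl y | y <- s].
Definition inners : seq sedge := [seq einner j | j <- enum 'I_(nat_of_bool (1 < wt e)%N)].

Lemma mem_outer s d : (d \in outer s) = if d is inl y then y \in s else false.
Proof.
case: d => [y|d]; first by rewrite (mem_map (@inl_inj _ _)).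
by apply/negP => /mapP[].
Qed.

Lemma mem_inners d : (d \in inners) = if d is inr (inr _) then true else false.
Proof.
case: d => [y|[b|j]]; try by apply/negP => /mapP[].
by rewrite (mem_map einner_inj) mem_enum.
Qed.

Lemma outer_uniq s : uniq (outer s) = uniq s.
Proof. by rewrite (map_inj_uniq (@inl_inj _ _)). Qed.

Lemma inners_uniq : uniq inners.
Proof. by rewrite (map_inj_uniq einner_inj) enum_uniq. Qed.

Definition sins (v : svertex) : seq sedge := match v with
  | inl x => outer (ins x)
  | inr true => [:: einner']
  | inr false => rcons inners ehook end.
Definition souts (v : svertex) : seq sedge := match v with
  | inl x => (if x == vp then einner' :: inners else [::])
     ++ outer [seq y <- outs x | (y != e) && (y != e')]
  | inr true => [:: inl e'; ehook]
  | inr false => [:: inl e] end.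

Lemma sins_uniq v : uniq (sins v).
Proof.
case: v => [x|[|]] //=; first by rewrite outer_uniq ins_uniq.
by rewrite rcons_uniq inners_uniq mem_inners.
Qed.

Lemma mem_sins v d : (d \in sins v) = (stgt d == v).
Proof.
case: v => [x|[|]] /=.
- by rewrite mem_outer; case: d => [y|[[|]|j]] //; rewrite mem_ins.
- by rewrite inE; case: d => [y|[[|]|j]].
- by rewrite mem_rcons inE mem_inners; case: d => [y|[[|]|j]].
Qed.

Lemma souts_uniq v : uniq (souts v).
Proof.
case: v => [x|[|]] //=.
rewrite cat_uniq outer_uniq filter_uniq ?outs_uniq // andbT.
case: eqP => _ /=; last by apply/hasP => -[].
rewrite inners_uniq mem_inners /=; apply/hasPn => d.
by rewrite mem_outer inE mem_inners; case: d => [y|[[|]|j]].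
Qed.

Lemma mem_souts v d : (d \in souts v) = (ssrc d == v).
Proof.
case: v => [x|[|]] /=.
- rewrite mem_cat mem_outer.
  have -> : (d \in (if x == vp then einner' :: inners else [::])) =
      (x == vp) && (if d is inr z then z != inl false else false).
    by case: eqP => //= _; rewrite inE mem_inners; case: d => [y|[[|]|j]].
  case: d => [y|[[|]|j]] /=; rewrite ?andbF ?andbT ?orbF ?orFb //.
  + rewrite mem_filter mem_outs.
    by case: eqP => //= _; case: eqP => //= _; rewrite ?andbF.
  + by apply/eqP/eqP => [->|[]].
  + by apply/eqP/eqP => [->|[]].
- rewrite !inE; case: d => [y|[[|]|j]] //=; rewrite orbF.
  have -> : (inl y == inl e' :> sedge) = (y == e') by [].
  by case: (eqVneq y e) => [->|n]; [rewrite (negbTE ee')|case: (eqVneq y e')].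
- rewrite !inE; case: d => [y|[[|]|j]] //=.
  have -> : (inl y == inl e :> sedge) = (y == e) by [].
  by case: (eqVneq y e) => // n; case: ifP.
Qed.

Lemma swt_range d : (0 < swt d <= k)%N.
Proof.
case: d => [y|[[|]|j]] /=; first exact: wt_range.
- by rewrite wtk.
- by rewrite (leq_trans _ wtk) ?ltnS.
have := wt_range e; case: j => j; case E : (1 < wt e)%N => // _ /andP[q1 q2].
by rewrite -subn1 subn_gt0 E leq_subLR (leq_trans q2) // leq_addl.
Qed.

Let new_inner b : ~ bdry S (spos (inr b)) /\ forall v : vertex T, spos (inr b) <> pos v.
Proof. by case: b; exact: curve_interior. Qed.

Let new_unmarked b : ~ marked S (spos (inr b)).
Proof. by move=> h; have [v _ ev] := marked_vertex T h; exact: (new_inner b).2 (esym ev). Qed.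

Let new_neq : curve e' t0 <> curve e t1.
Proof. by move=> /(no_cross se ht1 ht0')[h _]; move: ee'; rewrite h eqxx. Qed.

Lemma swt_boundary d : K = AVectors -> marked_boundary (spos (ssrc d)) -> swt d = 1%N.
Proof.
move=> KA; have nn b : ~ marked_boundary (spos (inr b)) by move=> [h _]; exact: new_unmarked h.
case: d => [y|[[|]|j]] //=; try by move=> [_ h]; case: pp.
case: ifP => _; first by move/(nn false).
case: ifP => _; first by move/(nn true).
by move=> h; exact: wt_boundary.
Qed.

Lemma svertex_rule v : match skind v with
    | Marked => sins v = [::]
    | White => exists2 f, souts v = [:: f] & swt f = (\sum_(d <- sins v) swt d)%N
    | Black => exists2 f, sins v = [:: f] & swt f = (\sum_(d <- souts v) swt d)%N
    | Coevaluation => sins v = [::] /\ exists2 f, souts v = [:: f] & swt f = k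
    | Evaluation => souts v = [::] /\ exists2 f, sins v = [:: f] & swt f = k
    end.
Proof.
case: v => [x|[|]] /=.
- have ho : kind x <> Marked -> souts (inl x) = outer (outs x).
    move=> kx; have nx : x != vp by apply/eqP => h; apply: kx; rewrite h; exact: puncture_kind.
    rewrite /= (negbTE nx) /=; congr outer; apply/all_filterP/allP => y.
    rewrite mem_outs => /eqP sy; apply/andP; split; apply/eqP => h; move/eqP: nx; apply.
      by rewrite -sy h.
    by rewrite -sy h.
  move: ho; rewrite /=; have := vertex_rule x; case: (kind x).
  + by move=> ->.
  + by move=> [f h1 h2] ->; rewrite // h1; exists (inl f); rewrite // big_map.
  + by move=> [f h1 h2] ->; rewrite // h1; exists (inl f); rewrite // big_map.
  + by move=> [h [f h1 h2]] ->; rewrite // h h1; split=> //; exists (inl f).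
  + by move=> [h [f h1 h2]] ->; rewrite // h h1; split=> //; exists (inl f).
- by exists einner' => //; rewrite !big_cons big_nil /= addn0 addn1.
- exists (inl e) => //; rewrite -cats1 big_cat big_seq1 /= big_map big_enum /= sum_nat_const card_ord.
  have := wt_range e.
  by case: (wt e) => [|[|n]] //= _; rewrite mul1n addn1.
Qed.

Lemma spos_inj : injective spos.
Proof.
have nn b v : spos (inr b) <> pos v := (new_inner b).2 v.
move=> [x|b] [y|b'] h; first by congr inl; exact: pos_inj.
- by case: (nn b' x).
- by case: (nn b y).
by case: b b' h => [] [] //= h; case: new_neq.
Qed.

Lemma spos_marked v : skind v = Marked -> marked S (spos v).
Proof. by case: v => [x|[|]] //=; exact: pos_marked. Qed.

Lemma spos_unmarked v : skind v <> Marked -> ~ bdry S (spos v) /\ ~ marked S (spos v).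
Proof.
case: v => [x|b] /=; first exact: pos_unmarked.
by move=> _; split; [exact: (new_inner b).1|exact: new_unmarked].
Qed.

Lemma smarked_vertex p : marked S p -> exists2 v, skind v = Marked & spos v = p.
Proof. by move=> /(marked_vertex T)[v kv pv]; exists (inl v). Qed.

Lemma sp0 : sp 0 = curve e' t0. Proof. by rewrite /sp /hook lin0. Qed.
Lemma sp1 : sp 1 = curve e t1. Proof. by rewrite /sp /hook lin1. Qed.

Lemma scurve_src d : scurve d 0 = spos (ssrc d).
Proof.
case: d => [y|[[|]|j]]; rewrite /scurve /=.
- rewrite mulr0 addr0 /cutpoint; case: eqP => [->|_] //=; case: eqP => [->|_] //=; exact: curve_src.
- by rewrite mulr0 addr0 curve_src se'.
- exact: sp0.
- by rewrite mulr0 addr0 curve_src se.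
Qed.

Lemma scurve_tgt d : scurve d 1 = spos (stgt d).
Proof.
case: d => [y|[[|]|j]]; rewrite /scurve /=.
- by rewrite mulr1 addrC subrK curve_tgt.
- by rewrite mulr1 add0r.
- exact: sp1.
- by rewrite mulr1 add0r.
Qed.

Let spi (t : R) : 0 < t < 1 -> unit_itv t.
Proof. by case/andP => q1 q2; rewrite /unit_itv /= !ltW. Qed.

Lemma scurve_interior d t : 0 < t < 1 -> ~ bdry S (scurve d t) /\ forall v, scurve d t <> spos v.
Proof.
move=> ht; rewrite splace_curve; case E : (splace d t) => [[x s]|].
  have hs := splace_itv E ht; have [h1 h2] := curve_interior x hs; split=> // -[v|b] //=.
  have cc y v : src y = vp -> 0 < v <= ts -> v = cutpoint y -> 0 < v -> curve x s = curve y v -> False.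
    move=> sy hv vc v0 /(no_cross sy hv hs)[xy sv]; move: E; rewrite xy sv /splace.
    have /andP[q1 q2] := ht; have /andP[q3 q4] := ht0'; have /andP[q5 q6] := ht1'.
    have ce : cutpoint e = t1 by rewrite /cutpoint eqxx.
    have ce' : cutpoint e' = t0 by rewrite /cutpoint eq_sym (negbTE ee') eqxx.
    case: (d) => [z|[[|]|j]] //= [] zy; first by rewrite zy -vc => ?; nra.
      by rewrite vc -zy ce' => ?; nra.
    by rewrite vc -zy ce => ?; nra.
  case: b; [apply: (cc _ _ se' ht0)|apply: (cc _ _ se ht1)]; rewrite /cutpoint ?eqxx //.
  + by rewrite eq_sym (negbTE ee').
  + by case/andP: ht0.
  + by case/andP: ht1.
have [h1 h2] := hook_inner cd raq raw rwq rqR (spi ht); split; first exact: h1.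
move=> [v|b]; first exact: h2.
have inj := hook_inj cd raq raw rwq.
case: b => h.
  have : t = 0 by apply: inj; [exact: spi|exact: unit_itv0|rewrite -/sp sp0].
  by case/andP: ht => q _ q2; rewrite q2 ltxx in q.
have : t = 1 by apply: inj; [exact: spi|exact: unit_itv1|rewrite -/sp sp1].
by case/andP: ht => _ q q2; rewrite q2 ltxx in q.
Qed.

Let aff_within u v : {within unit_itv, continuous (fun t : R => u + v * t)}.
Proof.
apply: continuous_subspaceT => t; apply: cvgD; first exact: cvg_cst.
by apply: cvgM; [exact: cvg_cst|exact: cvg_id].
Qed.

Lemma scurve_continuous d : {within unit_itv, continuous (scurve d)}.
Proof.
rewrite /scurve; case E : (sorig d) => [[[x u] v]|]; last exact: (@hook_cont _ _ _ _ _ _ pp _ _ _ _ cd _ _ raq raw).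
have [u0 v0 uv] := sorig_itv E.
by apply: (@within_comp _ _ _ unit_itv unit_itv (fun t => u + v * t) (curve x));
  [exact: aff_within|exact: curve_continuous|exact: affine_within].
Qed.

Lemma scurve_immersed d t : unit_itv t -> nonzero_tangent (scurve d t) (sveloc d t).
Proof.
rewrite /scurve /sveloc; case E : (sorig d) => [[[x u] v]|] ht; last exact: (hook_vel_tangent cd raq raw rwq gentle ht).
have [u0 v0 uv] := sorig_itv E.
have [h1 h2] := curve_immersed x (affine_within u0 v0 uv ht); split.
  by move=> i j di dj; rewrite -scalemxAl; congr (_ *: _); exact: h1.
by move=> i di /eqP; rewrite scaler_eq0 (gt_eqF v0) /= => /eqP; exact: h2.
Qed.

Lemma scurve_vel d t i : unit_itv t -> dom i (scurve d t) ->
    forall eps : R, 0 < eps -> exists2 r : R, 0 < r & forall t', unit_itv t' ->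
      `|t' - t| < r ->
      `|chart i (scurve d t') - chart i (scurve d t) - (t' - t) *: sveloc d t i|
        <= eps * `|t' - t|.
Proof.
rewrite /scurve /sveloc; case E : (sorig d) => [[[x u] v]|] ht di; last exact: (hook_diff cd raq raw ht di).
have [u0 v0 uv] := sorig_itv E => eps eps0.
have [r r00' hr] := curve_vel (affine_within u0 v0 uv ht) di (divr_gt0 eps0 v0).
exists (r / v); first exact: divr_gt0.
move=> t' ht'; rewrite ltr_pdivlMr // => tt.
have eq1 : u + v * t' - (u + v * t) = v * (t' - t) by ring.
have := hr _ (affine_within u0 v0 uv ht'); rewrite eq1 normrM (gtr0_norm v0) mulrC => /(_ tt).
by rewrite scalerA [(t' - t) * v]mulrC -mulrA [`|_| * v]mulrC (mulrA v^-1) mulVf ?gt_eqF // mul1r.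
Qed.

Lemma sveloc_continuous d i :
    {within [set t | unit_itv t /\ dom i (scurve d t)],
     continuous (fun t => sveloc d t i)}.
Proof.
rewrite /scurve /sveloc; case E : (sorig d) => [[[x u] v]|]; last exact: (@hook_vel_cont _ _ _ _ _ _ pp _ _ _ _ cd _ _ raq raw i).
have [u0 v0 uv] := sorig_itv E.
set A := [set t | _].
have c : {within A, continuous ((fun t => vel x t i) \o (fun t => u + v * t))}.
  apply: (@within_comp _ _ _ _ [set t | unit_itv t /\ dom i (curve x t)]).
  - by apply: continuous_subspaceW (@aff_within u v) => t [].
  - exact: vel_continuous.
  - by move=> t [ht dt]; split=> //; exact: affine_within.
apply/withinP => t At; move/withinP: c => /(_ t At) c.
exact: cvgZl_tmp c.
Qed.

Definition scrossing (q : (sedge * R) * (sedge * R)) :=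
    [/\ 0 < q.1.2 < 1, 0 < q.2.2 < 1, q.1 <> q.2 &
        scurve q.1.1 q.1.2 = scurve q.2.1 q.2.2].

Lemma scrossing_cases d t d2 s : scrossing ((d, t), (d2, s)) ->
  match splace d t, splace d2 s with
  | Some q1, Some q2 => crossing (q1, q2)
  | None, Some q => sp t = curve (d := T) q.1 q.2 /\ 0 < q.2 < 1
  | Some q, None => sp s = curve q.1 q.2 /\ 0 < q.2 < 1
  | None, None => False end.
Proof.
move=> [/= ht hs ne]; rewrite !splace_curve.
case E : (splace d t) => [[x u]|]; case E2 : (splace d2 s) => [[y v]|] h.
- split=> //=; [exact: splace_itv E ht|exact: splace_itv E2 hs|].
  by move=> h2; apply: ne; apply: (splace_inj ht hs E); rewrite h2.
- by split=> //=; exact: splace_itv E ht.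
- by split=> //=; exact: splace_itv E2 hs.
- apply: ne; rewrite (splace_none E) (splace_none E2); congr (_, _).
  by apply: (hook_inj cd raq raw rwq) => //; exact: spi.
Qed.

(** The hook meets the old edges only on parts of legs without crossings, so it creates no triple
    point. *)
Lemma spiral_place t (q q2 : edge T * R) : 0 < t < 1 -> sp t = curve (d := T) q.1 q.2 -> 0 < q.2 < 1 -> 0 < q2.2 < 1 ->
  sp t = curve q2.1 q2.2 -> q2 = q.
Proof.
case: q q2 => [x s] [y s'] ht /= h hs hs' h2.
have [sx /andP[q1 q2]] := hook_meets cd raq raw rwq rqR (spi ht) (spi hs) h.
by apply: no_cross => //; [rewrite q1 ltW|rewrite -h2].
Qed.

Lemma scrossing_double a b c : scrossing (a, b) -> scrossing (a, c) -> b = c.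
Proof.
case: a b c => [d t] [d2 s] [d3 s'] h1 h2.
have [/= ht hs _ _] := h1; have [/= _ hs' _ _] := h2.
have := scrossing_cases h1; have := scrossing_cases h2.
case E : (splace d t) => [q|]; case E3 : (splace d3 s') => [q3|] //; case E2 : (splace d2 s) => [q2|] //.
- move=> c1 c2; have q23 := crossing_double c2 c1.
  by apply: (splace_inj hs hs' E2); rewrite q23.
- move=> c1 [sq hq]; have [_ hq3 nq c] := c1; case: nq.
  by apply/esym; apply: (spiral_place hs sq hq hq3); rewrite sq.
- move=> [sq hq] c1; have [_ hq2 nq c] := c1; case: nq.
  by apply/esym; apply: (spiral_place hs' sq hq hq2); rewrite sq.
- move=> [sq hq] [sq2 _]; rewrite (splace_none E2) (splace_none E3); congr (_, _).
  by apply: (hook_inj cd raq raw rwq); [exact: spi|exact: spi|rewrite -/sp sq sq2].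
- move=> [sq3 hq3] [sq2 hq2]; apply: (splace_inj hs hs' E2); rewrite E3; congr Some.
  exact: (spiral_place ht sq2 hq2 hq3 sq3).
Qed.

Lemma scrossing_transverse q : scrossing q -> forall i, dom i (scurve q.1.1 q.1.2) ->
  row_free (col_mx (sveloc q.1.1 q.1.2 i) (sveloc q.2.1 q.2.2 i)).
Proof.
case: q => [[d t] [d2 s]] h i /=; have [/= ht hs _ es] := h; have := scrossing_cases h.
move: es; rewrite /scurve /sveloc /splace; case E : (sorig d) => [[[x u] v]|]; case E2 : (sorig d2) => [[[y u'] v']|] //=.
- move=> es c di; have [_ v0 _] := sorig_itv E; have [_ v0' _] := sorig_itv E2.
  by apply: row_free_scale; rewrite ?gt_eqF //; exact: (crossing_transverse c di).
- move=> es [c hc] di; have [_ v0 _] := sorig_itv E.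
  have := hook_transverse cd raq raw rwq rqR gentle (spi hs) (spi hc) c ltac:(by rewrite -/sp -es; exact: di).
  move=> [_ h2]; rewrite -[X in col_mx _ X]scale1r; apply: row_free_scale; rewrite ?gt_eqF //; exact: h2.
- move=> es [c hc] di; have [_ v0' _] := sorig_itv E2.
  have [h2 _] := hook_transverse cd raq raw rwq rqR gentle (spi ht) (spi hc) c di.
  by rewrite -[X in col_mx X _]scale1r; apply: row_free_scale; rewrite ?gt_eqF.
Qed.

Lemma scrossing_finite : finite_set [set q | scrossing q].
Proof.
pose A (dd : sedge * sedge) := [set st : R * R | scrossing ((dd.1, st.1), (dd.2, st.2))].
have -> : [set q | scrossing q] = \bigcup_dd ((fun st : R * R => ((dd.1, st.1), (dd.2, st.2))) @` A dd).
  apply/seteqP; split=> [[[d t] [d2 s]] h|q [dd _ [st h <-]]] //.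
  by exists (d, d2) => //; exists (t, s).
apply: bigcup_finite; first exact: finite_finset.
move=> [d d2] _; apply: finite_image.
have fin (B : set (R * R)) (u v u' v' : R) : 0 < v -> 0 < v' -> finite_set B ->
    A (d, d2) `<=` (fun st : R * R => (u + v * st.1, u' + v' * st.2)) @^-1` B -> finite_set (A (d, d2)).
  move=> v0 v0' fB AB; apply: sub_finite_set AB _; apply: finite_preimage => // -[q1 q2] [q3 q4] _ _ /= [].
  by move=> /addrI /(mulfI (lt0r_neq0 v0)) -> /addrI /(mulfI (lt0r_neq0 v0')) ->.
case E : (sorig d) => [[[x u] v]|]; case E2 : (sorig d2) => [[[y u'] v']|].
- have [_ v0 _] := sorig_itv E; have [_ v0' _] := sorig_itv E2.
  apply: (fin [set st : R * R | crossing (((x, st.1), (y, st.2)) : (edge T * R) * (edge T * R))] u v u' v') => //.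
    move: (crossing_finite T); apply: (@finite_preimage _ _ _ (fun st : R * R => ((x, st.1), (y, st.2)) : (edge T * R) * (edge T * R))).
    by move=> [q1 q2] [q3 q4] _ _ [-> ->].
  by move=> [t s] /scrossing_cases; rewrite /splace E E2.
- have [_ v0 _] := sorig_itv E.
  apply: (fin ((fun st => (st.2, st.1)) @^-1` [set st : R * R | [/\ unit_itv st.1, unit_itv st.2 & sp st.1 = curve x st.2]]) u v 0 1) => //.
    apply: finite_preimage; first by move=> [q1 q2] [q3 q4] _ _ [-> ->].
    exact: (hook_finite pp cd raq raw rwq rqR gentle x).
  move=> [t s] h; have [/= _ hs _ _] := h; have := scrossing_cases h; rewrite /splace E E2 /=.
  by rewrite add0r mul1r => -[h1 h2]; split=> //; exact: spi.
- have [_ v0' _] := sorig_itv E2.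
  apply: (fin [set st : R * R | [/\ unit_itv st.1, unit_itv st.2 & sp st.1 = curve y st.2]] 0 1 u' v') => //.
    exact: (hook_finite pp cd raq raw rwq rqR gentle y).
  move=> [t s] h; have [/= ht _ _ _] := h; have := scrossing_cases h; rewrite /splace E E2 /=.
  by rewrite add0r mul1r => -[h1 h2]; split=> //; exact: spi.
- rewrite (_ : A _ = classical_sets.set0);  [exact: finite_set0|]; apply/seteqP; split=> // -[t s] /scrossing_cases.
  by rewrite /splace E E2.
Qed.

Lemma stlift_framed d : framed_path (scurve d) (stlift d).
Proof.
rewrite /scurve /stlift; case E : (sorig d) => [[[x u] v]|]; last exact: (hook_framed pp cd raq raw).
by have [u0 v0 uv] := sorig_itv E; apply: framed_sub => //; exact: lift_framed.
Qed.

Lemma slift_src d : skind (ssrc d) <> Marked -> same_vec (scurve d 0) (stlift d 0) (sref (ssrc d)).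
Proof.
case: d => [y|[[|]|j]]; rewrite /scurve /stlift /=; try by rewrite (puncture_kind pp).
  rewrite /cutpoint mulr0 addr0; case: eqP => [->|_] //=; case: eqP => [->|_] //=; exact: lift_src.
by rewrite -/sp /sfr /hook_frame lin0 sp0 => _ i di; rewrite Fq.
Qed.

Lemma slift_marked d : skind (ssrc d) = Marked -> pointing (scurve d 0) (stlift d 0).
Proof.
case: d => [y|[[|]|j]]; rewrite /scurve /stlift //= ?mulr0 ?addr0.
- rewrite /cutpoint; case: eqP => [->|_] //=; case: eqP => [->|_] //=; exact: lift_marked.
- by move=> _; apply: lift_marked; rewrite se'; exact: puncture_kind.
- by move=> _; apply: lift_marked; rewrite se; exact: puncture_kind.
Qed.

Lemma slift_tgt d : same_vec (scurve d 1) (stlift d 1) (sref (stgt d)).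
Proof.
case: d => [y|[[|]|j]]; rewrite /scurve /stlift /= ?mulr1 ?add0r //.
  by rewrite addrC subrK; exact: lift_tgt.
by rewrite -/sp /sfr /hook_frame lin1 sp1 => i di; rewrite Fw.
Qed.

Definition surgery : diagram S K k :=
  @Diagram R S K k svertex sedge ssrc stgt swt skind sins souts spos scurve sveloc sref stlift
    sacyclic sins_uniq mem_sins souts_uniq mem_souts swt_range swt_boundary svertex_rule
    spos_inj spos_marked spos_unmarked smarked_vertex scurve_src scurve_tgt scurve_interior
    scurve_continuous scurve_immersed scurve_vel sveloc_continuous
    scrossing_finite scrossing_transverse scrossing_double
    stlift_framed slift_src slift_marked slift_tgt.
End Surgery.

(** * The invariant of the surgered diagram *)

Section Split.
Context {R : realType} {S : marked_surface R} {K : flavour} {k : nat}.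
Variables (T : diagram S K k) (vp : vertex T) (phi : edge T -> {set 'I_k}) (z : moduli_point S K k).

Lemma vertex_weight_eq (s s' : state T) v :
  (forall x, x \in ins v -> (s x).2 = (s' x).2) ->
  (forall x, x \in outs v -> (s x).1 = (s' x).1) ->
  vertex_weight phi z s v = vertex_weight phi z s' v.
Proof.
move=> hi ho; rewrite /vertex_weight; case: (kind v).
- by apply: eq_big_seq => x /ho ->.
- rewrite (_ : [seq (s x).2 | x <- ins v] = [seq (s' x).2 | x <- ins v]); last exact/eq_in_map.
  by apply: eq_big_seq => x /ho ->.
- rewrite (_ : [seq (s x).1 | x <- outs v] = [seq (s' x).1 | x <- outs v]); last exact/eq_in_map.
  by apply: eq_big_seq => x /hi ->.
- by apply: eq_big_seq => x /ho ->.
- by apply: eq_big_seq => x /hi ->.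
Qed.

Hypothesis pp : puncture (pos vp).
Variables e e' : edge T.
Hypotheses (se : src e = vp) (se' : src e' = vp) (ee' : e != e').

Definition hole (x : edge T) := hol z (curve x) (tlift x).

(* The factors of the state sum which depend on the legs e and e' only through
   the basis tensors at their targets. *)
Definition rest (s : state T) : R[i] :=
  (\prod_(x | (x != e) && (x != e')) edge_coef (hole x) (wt x) (s x)) *
  ((\prod_(x | (src x == vp) && (x != e) && (x != e')) source_tensor phi z x (s x).1) *
   \prod_(v | v != vp) vertex_weight phi z s v).

Lemma rest_upd s d I : (d == e) || (d == e') -> rest (ffun_upd s d I) = rest s.
Proof.
move=> hd; have sd : src d = vp by case/orP: hd => /eqP ->.
have dn x : (x != e) && (x != e') -> (x == d) = false.
  by move=> /andP[n1 n2]; apply/negbTE; case/orP: hd => /eqP ->.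
rewrite /rest; congr (_ * (_ * _)).
- by apply: eq_bigr => x nx; rewrite ffunE dn.
- by apply: eq_bigr => x /andP[/andP[_ n1] n2]; rewrite ffunE dn // n1.
- apply: eq_bigr => v nv; apply: vertex_weight_eq => x hx; rewrite ffunE; case: eqP => // xd.
  by move: hx; rewrite mem_outs xd sd eq_sym (negbTE nv).
Qed.

Lemma invariant_split : diagram_invariant phi z = \sum_s
  rest s * (source_tensor phi z e (s e).1 * edge_coef (hole e) (wt e) (s e)) *
           (source_tensor phi z e' (s e').1 * edge_coef (hole e') (wt e') (s e')).
Proof.
have ne' : e' != e by rewrite eq_sym.
have hv (F : edge T -> R[i]) : \prod_(x <- outs vp) F x =
    F e * (F e' * \prod_(x | (src x == vp) && (x != e) && (x != e')) F x).
  rewrite (big_uniq _ (outs_uniq vp)) (bigD1 e) /= ?mem_outs ?se //; congr (_ * _).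
  rewrite (bigD1 e') /= ?mem_outs ?se' ?eqxx //; congr (_ * _).
  by apply: eq_bigl => x; rewrite mem_outs.
rewrite diagram_invariantE; apply: eq_bigr => s _.
rewrite (bigD1 e) //= (bigD1 e') //= (bigD1 vp) //=.
rewrite {1}/vertex_weight (puncture_kind pp) hv /rest /hole; ring.
Qed.
End Split.

Section SurgeryInvariant.
Context {R : realType} {S : marked_surface R} {K : flavour} {k : nat}.
Variables (T : diagram S K k) (vp : vertex T).
Hypothesis pp : puncture (pos vp).
Variables e e' : edge T.
Hypotheses (se : src e = vp) (se' : src e' = vp) (ee' : e != e').
Variables (i0 : chart_ix S) (r0 R1 ts : R).
Hypothesis cd : clean_disc vp i0 r0 R1 ts.
Variables (t0 t1 : R).
Hypotheses (ht0 : 0 < t0 <= ts) (ht1 : 0 < t1 <= ts).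
Variables aq aw : @param R.
Hypotheses (raq : regular r0 aq) (raw : regular r0 aw) (rwq : prad aw < prad aq) (rqR : prad aq < R1).
Hypothesis gentle : prad aq - prad aw < prad aw * (pang aw - pang aq).
Hypotheses (Pq : Pt (pos vp) i0 aq = curve e' t0) (Pw : Pt (pos vp) i0 aw = curve e t1).
Hypotheses (Fq : same_vec (curve e' t0) (tlift e' t0) (Fr (pos vp) i0 aq))
           (Fw : same_vec (curve e t1) (tlift e t1) (Fr (pos vp) i0 aw)).
Hypothesis wtk : (wt e' < k)%N.

Let D := surgery pp se se' ee' cd ht0 ht1 raq raw rwq rqR gentle Pq Pw Fq Fw wtk.

Variables (phi : edge T -> {set 'I_k}) (i : 'I_k) (z : moduli_point S K k).

Definition stag (d : sedge e) : {set 'I_k} := match d with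
  | inl x => phi x
  | inr (inl true) => (i |: phi e')%SET
  | inr (inl false) => finset.set0
  | inr (inr _) => (phi e :\ i)%SET end.

Let psi : edge D -> {set 'I_k} := stag.

Let d0 := tlift e 0.
Let d0' := tlift e' 0.
Definition inner_hol (x : edge T) (t : R) :=
  hol z (fun s => curve x (0 + t * s)) (fun s => tlift x (0 + t * s)).
Definition outer_hol (x : edge T) (t : R) :=
  hol z (fun s => curve x (t + (1 - t) * s)) (fun s => tlift x (t + (1 - t) * s)).
Definition hook_hol := hol z (hook vp i0 aq aw) (hook_frame vp i0 aq aw).
Let ten := tagged_step (mono z (pos vp) d0) (flag z (pos vp) d0) (wt e).-1 (phi e :\ i)%SET.
Let ten' := tagged_step (mono z (pos vp) d0') (flag z (pos vp) d0') (wt e').+1 (i |: phi e')%SET.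

Hypothesis hten : homogeneous (wt e).-1 ten.
Hypothesis hten' : homogeneous (wt e').+1 ten'.

Lemma surgery_source (x : edge T) : x != e -> x != e' ->
  source_tensor psi z (inl x : edge D) = source_tensor phi z x.
Proof.
move=> n1 n2; rewrite /source_tensor /= (negbTE n1) (negbTE n2) /=.
have -> : stlift vp e' i0 t0 t1 aq aw (inl x : sedge e) 0 = tlift x 0.
  by rewrite /stlift /= mulr0 addr0 /cutpoint (negbTE n1) (negbTE n2).
by [].
Qed.

Lemma surgery_source1 j : source_tensor psi z (einner j : edge D) = ten.
Proof.
rewrite /source_tensor /= (asboolT pp).
have -> : stlift vp e' i0 t0 t1 aq aw (einner j) 0 = tlift e 0 by rewrite /stlift /= mulr0 addr0.
by [].
Qed.

Lemma surgery_source2 : source_tensor psi z (einner' e : edge D) = ten'.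
Proof.
rewrite /source_tensor /= (asboolT pp).
have -> : stlift vp e' i0 t0 t1 aq aw (einner' e) 0 = tlift e' 0 by rewrite /stlift /= mulr0 addr0.
by [].
Qed.

Lemma surgery_vertex (s : {ffun edge T -> {set 'I_k} * {set 'I_k}}) t v : v != vp ->
  vertex_weight psi z (ffun_join s t : state D) (inl v) = vertex_weight phi z s v.
Proof.
move=> nv; have no x : x \in outs v -> (x != e) && (x != e').
  rewrite mem_outs => /eqP sx; apply/andP; split; apply/eqP => h; move/eqP: nv; apply.
    by rewrite -sx h.
  by rewrite -sx h.
have ho : souts vp e e' (inl v) = outer e (outs v).
  by rewrite /= (negbTE nv) /=; congr outer; apply/all_filterP/allP.
have hm1 : [seq ((ffun_join s t : state D) d).1 | d <- outer e (outs v)] = [seq (s x).1 | x <- outs v].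
  by rewrite -map_comp; apply: eq_map => x; rewrite /= ffunE.
have hm2 : [seq ((ffun_join s t : state D) d).2 | d <- outer e (ins v)] = [seq (s x).2 | x <- ins v].
  by rewrite -map_comp; apply: eq_map => x; rewrite /= ffunE.
have fj x : (ffun_join s t : state D) (inl x) = s x by rewrite ffunE.
have eo : outs (d := D) (inl v) = outer e (outs v) by exact: ho.
have ei : ins (d := D) (inl v) = outer e (ins v) by [].
have ek : kind (d := D) (inl v) = kind v by [].
rewrite /vertex_weight eo ei ek hm1 hm2; case: (kind v); rewrite big_map.
- by apply: eq_big_seq => x /no/andP[n1 n2]; rewrite surgery_source // fj.
- by apply: eq_bigr => x _; rewrite fj.
- by apply: eq_bigr => x _; rewrite fj.
- by apply: eq_bigr => x _; rewrite fj.
- by apply: eq_bigr => x _; rewrite fj.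
Qed.

Lemma surgery_edge (x : edge T) : x != e -> x != e' ->
  hol z (curve (d := D) (inl x)) (tlift (inl x : edge D)) = hole z x.
Proof.
move=> n1 n2; rewrite /hole; congr (hol z _ _); apply/funext => s.
  by rewrite /= /scurve /= /cutpoint (negbTE n1) (negbTE n2) subr0 mul1r add0r.
by rewrite /= /stlift /= /cutpoint (negbTE n1) (negbTE n2) subr0 mul1r add0r.
Qed.

Lemma surgery_edge1 : hol z (curve (d := D) (inl e)) (tlift (inl e : edge D)) = outer_hol e t1.
Proof.
by rewrite /outer_hol; congr (hol z _ _); apply/funext => s; rewrite /= /scurve /stlift /= /cutpoint eqxx.
Qed.

Lemma surgery_edge2 : hol z (curve (d := D) (inl e')) (tlift (inl e' : edge D)) = outer_hol e' t0.
Proof.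
by rewrite /outer_hol; congr (hol z _ _); apply/funext => s;
  rewrite /= /scurve /stlift /= /cutpoint eq_sym (negbTE ee') eqxx.
Qed.

(** The value given by [sum_inner] for the part of the diagram between the puncture and the cut
    points; when e has weight 1, its missing inner piece contributes the unit. *)
Definition inner_value (I I' : {set 'I_k}) : R[i] :=
  wedge (if (1 < wt e)%N then ext_map (inner_hol e t1) ten else ext_one)
    (ext_vec (iota_vec I' (ext_map (inner_hol e' t0) ten') *m hook_hol)) I.

Lemma surgery_vertex0 (s : {ffun edge T -> {set 'I_k} * {set 'I_k}})
    (t : {ffun (bool + 'I_(nat_of_bool (1 < wt e)%N))%type -> {set 'I_k} * {set 'I_k}}) :
  vertex_weight psi z (ffun_join s t : state D) (inl vp) =
  (ten' (t (inl true)).1 * \prod_(j <- enum 'I_(nat_of_bool (1 < wt e)%N)) ten (t (inr j)).1) *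
  \prod_(x | (src x == vp) && (x != e) && (x != e')) source_tensor phi z x (s x).1.
Proof.
have fi x : (ffun_join s t : state D) (inl x) = s x by rewrite ffunE.
have fj x : (ffun_join s t : state D) (inr x) = t x by rewrite ffunE.
have ek : kind (d := D) (inl vp) = Marked by exact: (puncture_kind pp).
have eo : outs (d := D) (inl vp) = (einner' e :: inners e) ++ outer e [seq y <- outs vp | (y != e) && (y != e')].
  by rewrite /= eqxx.
rewrite /vertex_weight ek eo big_cat big_cons !big_map; congr (_ * _ * _).
- by rewrite surgery_source2 fj.
- by apply: eq_bigr => j _; rewrite surgery_source1 fj.
- rewrite big_uniq ?filter_uniq ?outs_uniq //=; apply: eq_big => [x|x].
    by rewrite mem_filter mem_outs andbC andbA.
  by rewrite mem_filter => /andP[/andP[n1 n2] _]; rewrite surgery_source // fi.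
Qed.

Lemma surgery_vertex1 (s : {ffun edge T -> {set 'I_k} * {set 'I_k}})
    (t : {ffun (bool + 'I_(nat_of_bool (1 < wt e)%N))%type -> {set 'I_k} * {set 'I_k}}) :
  vertex_weight psi z (ffun_join s t : state D) (inr true) =
  wedge_coef [:: (s e').1; (t (inl false)).1] (t (inl true)).2.
Proof.
have fi x : (ffun_join s t : state D) (inl x) = s x by rewrite ffunE.
have fj x : (ffun_join s t : state D) (inr x) = t x by rewrite ffunE.
by rewrite /vertex_weight /= big_seq1 fi !fj.
Qed.

Lemma surgery_vertex2 (s : {ffun edge T -> {set 'I_k} * {set 'I_k}})
    (t : {ffun (bool + 'I_(nat_of_bool (1 < wt e)%N))%type -> {set 'I_k} * {set 'I_k}}) :
  vertex_weight psi z (ffun_join s t : state D) (inr false) =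
  wedge_coef (rcons [seq (t (inr j)).2 | j <- enum 'I_(nat_of_bool (1 < wt e)%N)] (t (inl false)).2) (s e).1.
Proof.
have fi x : (ffun_join s t : state D) (inl x) = s x by rewrite ffunE.
have fj x : (ffun_join s t : state D) (inr x) = t x by rewrite ffunE.
rewrite /vertex_weight /= big_seq1 fi map_rcons fj -map_comp; congr (wedge_coef (rcons _ _) _).
by apply: eq_map => j /=; rewrite fj.
Qed.

Lemma surgery_edges (s : {ffun edge T -> {set 'I_k} * {set 'I_k}})
    (t : {ffun (bool + 'I_(nat_of_bool (1 < wt e)%N))%type -> {set 'I_k} * {set 'I_k}}) :
  \prod_(d : edge D) edge_coef (hol z (curve d) (tlift d)) (wt d) ((ffun_join s t : state D) d) =
  (edge_coef (outer_hol e t1) (wt e) (s e) * (edge_coef (outer_hol e' t0) (wt e') (s e') *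
   \prod_(x | (x != e) && (x != e')) edge_coef (hole z x) (wt x) (s x))) *
  (edge_coef (inner_hol e' t0) (wt e').+1 (t (inl true)) * edge_coef hook_hol 1 (t (inl false)) *
   \prod_j edge_coef (inner_hol e t1) (wt e).-1 (t (inr j))).
Proof.
have fi x : (ffun_join s t : state D) (inl x) = s x by rewrite ffunE.
have fj x : (ffun_join s t : state D) (inr x) = t x by rewrite ffunE.
have ne' : e' != e by rewrite eq_sym.
rewrite big_sumType big_sumType big_bool /=; congr (_ * (_ * _ * _)).
- rewrite (bigD1 e) //= (bigD1 e') //=; congr (_ * (_ * _)).
  + by rewrite surgery_edge1 fi.
  + by rewrite surgery_edge2 fi.
  + by apply: eq_bigr => x /andP[n1 n2]; rewrite surgery_edge // fi.
- by rewrite fj.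
- by rewrite fj.
- by apply: eq_bigr => j _; rewrite fj.
Qed.

(** Summing over the states of the new edges leaves a sum over states of the old diagram, in which
    only [inner_value] depends on the hook. *)
Lemma surgery_invariant : diagram_invariant psi z = \sum_s
  rest vp phi z e e' s * inner_value (s e).1 (s e').1 *
    (edge_coef (outer_hol e t1) (wt e) (s e) * edge_coef (outer_hol e' t0) (wt e') (s e')).
Proof.
rewrite diagram_invariantE.
rewrite (sum_ffun_sum (A := edge T) (B := (bool + 'I_(nat_of_bool (1 < wt e)%N))%type)).
apply: eq_bigr => s _.
rewrite /inner_value -(sum_inner (1 < wt e)%N (inner_hol e t1) (inner_hol e' t0) hook_hol (s e).1 (s e').1 hten hten').
rewrite mulr_sumr mulr_suml; apply: eq_bigr => t _.
rewrite surgery_edges big_sumType big_bool (bigD1 vp) //=.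
rewrite surgery_vertex0 surgery_vertex1 surgery_vertex2.
have -> : \prod_(v | v != vp) vertex_weight psi z (ffun_join s t : state D) (inl v) =
    \prod_(v | v != vp) vertex_weight phi z s v.
  by apply: eq_bigr => v nv; exact: surgery_vertex.
rewrite /rest; ring.
Qed.
End SurgeryInvariant.

(** * The exchange relation *)

Lemma tagged_step_homog (R : realType) k (u : 'M[R[i]]_k) F a (A : {set 'I_k}) : (0 < k)%N ->
  affine_flag F -> (forall l, (l <= k)%N -> ext_map u (F l) = F l) ->
  (forall l, (l.+1 < k)%N -> simple_defined u l F) -> #|A| = a ->
  homogeneous a (tagged_step u F a A).
Proof.
move=> k0 aF fF sF cA; have [v [lam reg]] := affine_regular k0 aF fF sF.
have ak : (a <= k)%N by rewrite -cA -[X in (_ <= X)%N]card_ord max_card.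
rewrite (tagged_stepE reg cA) => I; rewrite ext_scaleE mulf_eq0 negb_or => /andP[_].
exact: (aflag_homog aF ak).
Qed.

(** The simple reflections never touch the step 0. A leg of weight 0 would thus carry the unit,
    which is why it can be left out of the surgery. *)
Lemma tagged_step0 (R : realType) k (u : 'M[R[i]]_k) F (A : {set 'I_k}) :
  tagged_step u F 0 A = F 0%N.
Proof.
rewrite /tagged_step /weyl_act; move: (xget [::] _) => s.
by elim: s F => //= i s IH F; rewrite IH.
Qed.

Lemma natr_gt (R : realType) (x : R) : exists n : nat, x < n%:R.
Proof.
exists (Num.bound `|x|); apply: le_lt_trans (ler_norm x) _.
exact: archi_boundP.
Qed.

(** * Legs and complexity after surgery *)

Section SurgeryLegs.
Context {R : realType} {S : marked_surface R} {K : flavour} {k : nat}.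

Definition complexity (T : diagram S K k) : nat :=
  \sum_(x : edge T | `[< leg x >]) (wt x * (k - wt x))%N.

Variables (T : diagram S K k) (vp : vertex T).
Hypothesis pp : puncture (pos vp).
Variables e e' : edge T.
Hypotheses (se : src e = vp) (se' : src e' = vp) (ee' : e != e').
Variables (i0 : chart_ix S) (r0 R1 ts : R).
Hypothesis cd : clean_disc vp i0 r0 R1 ts.
Variables (t0 t1 : R).
Hypotheses (ht0 : 0 < t0 <= ts) (ht1 : 0 < t1 <= ts).
Variables aq aw : @param R.
Hypotheses (raq : regular r0 aq) (raw : regular r0 aw) (rwq : prad aw < prad aq) (rqR : prad aq < R1).
Hypothesis gentle : prad aq - prad aw < prad aw * (pang aw - pang aq).
Hypotheses (Pq : Pt (pos vp) i0 aq = curve e' t0) (Pw : Pt (pos vp) i0 aw = curve e t1).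
Hypotheses (Fq : same_vec (curve e' t0) (tlift e' t0) (Fr (pos vp) i0 aq))
           (Fw : same_vec (curve e t1) (tlift e t1) (Fr (pos vp) i0 aw)).
Hypothesis wtk : (wt e' < k)%N.

Let D := surgery pp se se' ee' cd ht0 ht1 raq raw rwq rqR gentle Pq Pw Fq Fw wtk.

Let no_leg b : ~ puncture (pos (d := D) (inr b)).
Proof.
by move=> [h _]; have [|_] := @pos_unmarked _ _ _ _ D (inr b); [case: b {h}|apply].
Qed.

Lemma surgery_leg_outer x : `[< leg (inl x : edge D) >] = [&& `[< leg x >], x != e & x != e'].
Proof.
have h : leg (inl x : edge D) <-> puncture (pos (d := D) (ssrc vp e' (inl x : sedge e))) by [].
apply/asboolP/and3P.
- move/h => /=; case: eqP => [_ /(no_leg (b := false))|ne] //.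
  by case: eqP => [_ /(no_leg (b := true))|ne' lx] //; split=> //; apply/asboolP.
- by move=> [/asboolP lx /negbTE n1 /negbTE n2]; apply/h; rewrite /= n1 n2.
Qed.

Lemma surgery_leg_hook : ~ leg (ehook e : edge D).
Proof. exact: (no_leg (b := true)). Qed.

Lemma surgery_pseudotagging (phi : edge T -> {set 'I_k}) i : pseudotagging phi ->
  i \in phi e -> i \notin phi e' -> pseudotagging (T := D) (stag e' phi i).
Proof.
move=> hphi ie ie'; have le : leg e by rewrite /leg se.
have le' : leg e' by rewrite /leg se'.
case=> [x|[[|]|j]].
- by move/asboolP; rewrite surgery_leg_outer => /and3P[/asboolP lx _ _]; exact: hphi.
- by move=> _; rewrite /= cardsU1 ie' hphi.
- by move/surgery_leg_hook.
- by move=> _; have := cardsD1 i (phi e); rewrite /= ie hphi // => ->.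
Qed.

(** By concavity of w (k - w), moving the two weights apart lowers the sum, here by 2 (wt e' - wt e
    + 1); a missing inner piece counts as weight 0. *)
Lemma surgery_complexity : (wt e <= wt e')%N -> (complexity D < complexity T)%N.
Proof.
move=> ab; have le : leg e by rewrite /leg se.
have le' : leg e' by rewrite /leg se'.
have ne' : e' != e by rewrite eq_sym.
rewrite /complexity big_mkcond big_sumType big_sumType big_bool /=.
have -> : `[< leg (inr (inl true) : edge D) >] by apply/asboolP.
have -> : `[< leg (inr (inl false) : edge D) >] = false by apply/asboolP; exact: surgery_leg_hook.
rewrite -big_mkcond /= (eq_bigl _ _ surgery_leg_outer).
rewrite [X in (_ + (_ + X) < _)%N](_ : _ = (nat_of_bool (1 < wt e)%N * ((wt e).-1 * (k - (wt e).-1)))%N); last first.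
  by rewrite sum_nat_const card_ord.
rewrite [X in (_ < X)%N](bigD1 e) /=; last exact/asboolP.
rewrite [X in (_ < _ + X)%N](bigD1 e') /=; last by rewrite ne' andbT; exact/asboolP.
rewrite (eq_bigl (fun x => `[< leg x >] && (x != e) && (x != e'))); last by move=> x; rewrite andbA.
set X := (\sum_(x | _) _)%N; have := wt_range e.
case: (wt e) ab => [|[|w]] //= ab _; first by nia.
by nia.
Qed.
End SurgeryLegs.

(** * The sum over the winding numbers of the hook *)

Section Exchange.
Context {R : realType} {S : marked_surface R} {K : flavour} {k : nat}.

Variables (T : diagram S K k) (vp : vertex T).
Hypothesis pp : puncture (pos vp).
Variables e e' : edge T.
Hypotheses (se : src e = vp) (se' : src e' = vp) (ee' : e != e').

Lemma small_rad i0 r0 g w ts (a : R -> @param R) rho : 0 < ts -> polar_lift (S := S) (pos vp) i0 r0 g w ts a ->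
  0 < rho -> exists2 t, 0 < t <= ts & prad (a t) < rho.
Proof.
move=> ts0 pl rho0; have [[cr _ _ _] _ _] := plift_path pl (u := ts) ltac:(by rewrite ts0 lexx).
have [d d0 hd] := within0 cr rho0.
have m0 : 0 < Num.min (d / 2) 1 by rewrite lt_min ltr01 andbT divr_gt0.
have m1 : Num.min (d / 2) 1 <= 1 by rewrite ge_min lexx orbT.
have md : Num.min (d / 2) 1 < d.
  by apply: (@le_lt_trans _ _ (d / 2)); [rewrite ge_min lexx|rewrite ltr_pdivrMr // ltr_pMr // ltr1n].
exists (ts * Num.min (d / 2) 1); first by rewrite mulr_gt0 //= ler_piMr // ltW.
have := hd (Num.min (d / 2) 1) ltac:(by rewrite /unit_itv /= (ltW m0)) md.
rewrite add0r mulr0 addr0; have [-> _ _] := plift0 pl; rewrite subr0.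
exact: le_lt_trans (ler_norm _).
Qed.

Section Generic.
Variables (phi : edge T -> {set 'I_k}) (z : moduli_point S K k) (gen : generic z).
Variables (i0 : chart_ix S) (r0 R1 ts : R).
Hypothesis cd : clean_disc vp i0 r0 R1 ts.
Let p := pos vp.
Let dp := cl_dom cd. Let r00 := cl_r0 cd. Let disc := cl_disc cd. Let dm := cl_marked cd.

Lemma leg_pointing x : src x = vp -> pointing p (tlift x 0).
Proof.
by move=> sx; rewrite /p -sx -curve_src; apply: lift_marked; rewrite sx; exact: puncture_kind.
Qed.

(** The lift of the inner piece and the segment with the same ends are homotopic by
    interpolation. *)
Lemma inner_holE x a t : src x = vp -> polar_lift p i0 r0 (curve x) (tlift x) ts a -> 0 < t <= ts ->
  inner_hol z x t = Hol p i0 z (a 0) (a t).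
Proof.
move=> sx pl ht; have pa := plift_path pl ht.
have /andP[t0 tts] := ht; have /andP[_ ts1] := cl_ts cd.
have ra : regular r0 (a t) by exact: (plift_reg pl ht).
transitivity (holp p i0 z (fun s => a (0 + t * s))).
  apply: hol_ext.
    by apply: framed_sub => //; [exact: lift_framed|rewrite add0r; lra].
  move=> s /andP[s0 s1]; have [h1 h2] := plift_pt pl (t := 0 + t * s) ltac:(by apply/andP; split; nra).
  by split.
rewrite /Hol; apply: (holp_eq dp pp r00 disc dm).
- by right; split=> //; apply: ipath_lin => //; exact: plift0 pl.
- by rewrite lin0 mulr0 addr0.
- by rewrite lin1 mulr1 add0r.
Qed.

Variables (a a' : R -> @param R) (t0 t1 : R) (N0 : nat) (i : 'I_k).
Hypotheses (pl : polar_lift p i0 r0 (curve e) (tlift e) ts a)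
           (pl' : polar_lift p i0 r0 (curve e') (tlift e') ts a').
Hypotheses (ht0 : 0 < t0 <= ts) (ht1 : 0 < t1 <= ts).
Hypotheses (ab : (wt e <= wt e')%N) (ce : #|phi e| = wt e) (ce' : #|phi e'| = wt e').
Hypotheses (ie : i \in phi e) (ie' : i \notin phi e').

Let aq := a' t0.
Let aw j := turn (N0 + j) (a t1).

Lemma leg_source x : src x = vp -> source_tensor phi z x =
  tagged_step (mono z p (tlift x 0)) (flag z p (tlift x 0)) (wt x) (phi x).
Proof. by move=> sx; rewrite /source_tensor sx (asboolT pp). Qed.

Lemma inner_values I I' :
  \sum_(j < ((wt e').+1 - wt e).+1) ((-1) ^+ ((wt e').+1 - wt e - j) *+ 'C((wt e').+1 - wt e, j)) *
    inner_value vp e e' i0 t0 t1 aq (aw j) phi i z I I' =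
  ext_map (inner_hol z e t1) (source_tensor phi z e) I *
  ext_map (inner_hol z e' t0) (source_tensor phi z e') I'.
Proof.
have k0 : (0 < k)%N by apply: leq_ltn_trans (ltn_ord i).
have ra1 : regular r0 (a t1) := plift_reg pl ht1.
have raq : regular r0 aq := plift_reg pl' ht0.
have io := plift0 pl; have io' := plift0 pl'.
have pd := leg_pointing se; have pd' := leg_pointing se'.
have ed := plift_dir pl; have ed' := plift_dir pl'.
have Hcat := Hol_cat dp pp r00 disc dm z; have Hun := Hol_unit dp pp r00 disc dm z.
set u := mono z p (tlift e 0); set u' := mono z p (tlift e' 0).
set F := flag z p (tlift e 0); set F' := flag z p (tlift e' 0).
have fl (x : edge T) : src x = vp -> [/\ affine_flag (flag z p (tlift x 0)),
    (forall l, (l <= k)%N -> ext_map (mono z p (tlift x 0)) (flag z p (tlift x 0) l) = flag z p (tlift x 0) l) &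
    (forall l, (l.+1 < k)%N -> simple_defined (mono z p (tlift x 0)) l (flag z p (tlift x 0)))].
  move=> sx; have px := leg_pointing sx; split.
  - by apply: flag_affine => //; left.
  - by move=> l lk; apply: mono_stab.
  - exact: gen.
have [aF fF sF] := fl e se; have [aF' fF' sF'] := fl e' se'.
set o := a 0 in io ed; set o' := a' 0 in io' ed'.
pose P := Hol p i0 z o (a t1); pose Q := Hol p i0 z o' (a t1).
pose U := Hol p i0 z (a t1) (turn 1 (a t1)).
have QU : u' *m Q = Q *m U.
  by rewrite /u' /Q /U (mono_Hol dp pp r00 disc dm z io' ra1 pd' ed') -Hcat //; right.
have PU : u *m P = P *m U.
  by rewrite /u /P /U (mono_Hol dp pp r00 disc dm z io ra1 pd ed) -Hcat //; right.
have QUn n : u' ^+ n *m Q = Q *m U ^+ n.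
  elim: n => [|n IH]; first by rewrite !expr0 mul1mx mulmx1.
  by rewrite exprS -mulmxE -mulmxA IH mulmxA QU -mulmxA mulmxE -exprS.
pose Sj j := Hol p i0 z aq (aw j).
(* [aw j] is the end [a t1] after N0 + j turns: the same point of the surface, but another point of
   the half-plane. The inner piece of e' followed by the hook is therefore worth any lifted path to
   [aw j]. *)
have HS j : Hol p i0 z o' aq *m Sj j = Q *m U ^+ (N0 + j).
  by rewrite -QUn /Q (mono_Hol_iter dp pp r00 disc dm z _ io' ra1 pd' ed') -Hcat //; right.
have PQ l : (l <= k)%N -> ext_map P (F l) = ext_map Q (F' l).
  exact: (flag_Hol dp pp r00 disc dm z io io' ra1 pd ed pd' ed').
have uP : P \in unitmx by apply: Hun => //; right.
have uQ : Q \in unitmx by apply: Hun => //; right.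
have := @exchange_identity _ _ u F u' F' U P Q (Hol p i0 z o' aq) Sj N0 (wt e) (wt e')
  (phi e) (phi e') i I I' aF fF sF aF' fF' sF' uP uQ PU QU PQ HS ce ce' ab ie ie'.
rewrite (leg_source se) (leg_source se') -/u -/u' -/F -/F'.
rewrite (inner_holE se pl ht1) (inner_holE se' pl' ht0) -/o -/o' -/aq -/P => <-.
apply: eq_bigr => j _; congr (_ * _); rewrite /inner_value.
rewrite (inner_holE se pl ht1) (inner_holE se' pl' ht0) -/p -/u -/u' -/F -/F' -/o -/o' -/aq -/P.
congr (wedge _ (ext_vec _) I).
case: ltnP => // we; have -> : (wt e).-1 = 0%N by move: we; case: (wt e) => [|[]].
have F0 : F 0%N = ext_one := aflag0 aF.
by rewrite tagged_step0 F0 ext_map_one.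
Qed.

(** Cutting both legs where the hook is to be attached gives the old state sum the shape of
    [surgery_invariant]. *)
Lemma invariant_resum : diagram_invariant phi z = \sum_s
  rest vp phi z e e' s *
    (ext_map (inner_hol z e t1) (source_tensor phi z e) (s e).1 *
     ext_map (inner_hol z e' t0) (source_tensor phi z e') (s e').1) *
    (edge_coef (outer_hol z e t1) (wt e) (s e) * edge_coef (outer_hol z e' t0) (wt e') (s e')).
Proof.
have k0 : (0 < k)%N by apply: leq_ltn_trans (ltn_ord i).
have hom x : src x = vp -> #|phi x| = wt x -> homogeneous (wt x) (source_tensor phi z x).
  move=> sx cx; have px := leg_pointing sx; rewrite (leg_source sx).
  apply: tagged_step_homog => //; first by apply: flag_affine => //; left.
    by move=> l lk; apply: mono_stab.
  exact: gen.
have resum x t y : src x = vp -> #|phi x| = wt x -> 0 < t <= ts ->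
    \sum_I source_tensor phi z x I * edge_coef (hole z x) (wt x) (I, y) =
    \sum_I ext_map (inner_hol z x t) (source_tensor phi z x) I * edge_coef (outer_hol z x t) (wt x) (I, y).
  move=> sx cx /andP[q0 q1]; have hx := hom x sx cx.
  have q2 : t < 1 by apply: le_lt_trans q1 _; case/andP: (cl_ts cd).
  rewrite (sum_edge_coef_homog _ _ hx) (sum_edge_coef_homog _ _ (ext_map_homog hx)) ext_map_comp.
  by rewrite /hole (hol_split z (lift_framed x) (u := t)) ?q0.
have ne' : e' != e by rewrite eq_sym.
rewrite (invariant_split phi z pp se se' ee').
transitivity (\sum_s (rest vp phi z e e' s *
    (ext_map (inner_hol z e t1) (source_tensor phi z e) (s e).1 * edge_coef (outer_hol z e t1) (wt e) (s e))) *
    (source_tensor phi z e' (s e').1 * edge_coef (hole z e') (wt e') (s e'))).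
  transitivity (\sum_s (rest vp phi z e e' s *
    (source_tensor phi z e' (s e').1 * edge_coef (hole z e') (wt e') (s e'))) *
    (source_tensor phi z e (s e).1 * edge_coef (hole z e) (wt e) (s e))).
    by apply: eq_bigr => s _; rewrite mulrAC.
  rewrite (@sum_ffun_upd _ _ _ _ finset.set0 e _
    (fun q => source_tensor phi z e q.1 * edge_coef (hole z e) (wt e) q)
    (fun q => ext_map (inner_hol z e t1) (source_tensor phi z e) q.1 * edge_coef (outer_hol z e t1) (wt e) q)).
  - by apply: eq_bigr => s _; rewrite mulrAC.
  - by move=> s x; rewrite (rest_upd phi z se se') ?eqxx // ffunE (negbTE ne').
  - by move=> y; exact: resum.
rewrite (@sum_ffun_upd _ _ _ _ finset.set0 e' _
    (fun q => source_tensor phi z e' q.1 * edge_coef (hole z e') (wt e') q)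
    (fun q => ext_map (inner_hol z e' t0) (source_tensor phi z e') q.1 * edge_coef (outer_hol z e' t0) (wt e') q)).
- by apply: eq_bigr => s _; ring.
- move=> s x; rewrite (rest_upd phi z se se') ?eqxx ?orbT //.
  by have -> : ffun_upd s e' x e = s e by rewrite ffunE (negbTE ee').
- by move=> y; exact: resum.
Qed.
End Generic.

Theorem exchange (phi : edge T -> {set 'I_k}) i : pseudotagging phi -> (wt e <= wt e')%N ->
  i \in phi e -> i \notin phi e' ->
  exists (n : nat) (c : 'I_n -> R[i]) (D : 'I_n -> diagram S K k)
         (psi : forall j, edge (D j) -> {set 'I_k}),
    (forall j, pseudotagging (psi j) /\ (complexity (D j) < complexity T)%N) /\
    forall z : moduli_point S K k, generic z ->
      diagram_invariant phi z = \sum_(j < n) c j * diagram_invariant (psi j) z.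
Proof.
move=> hphi ab ie ie'.
have ce : #|phi e| = wt e by apply: hphi; rewrite /leg se.
have ce' : #|phi e'| = wt e' by apply: hphi; rewrite /leg se'.
have wtk : (wt e' < k)%N.
  rewrite -ce' -[X in (_ < X)%N]card_ord -cardsT; apply: proper_card.
  by rewrite properE subsetT /=; apply/subsetPn; exists i.
have k0 : (0 < k)%N by exact: leq_ltn_trans wtk.
have [i0 [r0 [R1 [ts cd]]]] := clean_exists pp.
have [a pl] := cl_lift cd se; have [a' pl'] := cl_lift cd se'.
have ts0 : 0 < ts by case/andP: (cl_ts cd).
(* The hook starts on e' within the radius [R1]; its end on e is then taken at a smaller radius. *)
have [t0 ht0 rqR] := small_rad ts0 pl' (proj1 (andP (cl_R1 cd))).
have raq := plift_reg pl' ht0.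
have [t1 ht1 rwq] := small_rad ts0 pl (proj1 (andP (proj1 raq))).
have ra1 := plift_reg pl ht1.
have [r1 _] := andP (proj1 ra1).
(* [gentle] solved for the number of turns; further turns only increase its right-hand side, so all
   N0 + j are admissible. *)
have [N0 hN0] := natr_gt (((prad (a' t0) - prad (a t1)) / prad (a t1) + pang (a' t0) - pang (a t1)) / (2 * pi)).
have pi0 : 0 < 2 * pi :> R by rewrite mulr_gt0 // pi_gt0.
pose aw j := turn (N0 + j) (a t1).
have gentle j : prad (a' t0) - prad (aw j) < prad (aw j) * (pang (aw j) - pang (a' t0)).
  rewrite mulrC -ltr_pdivrMr // /aw /turn /prad /pang /= -/(prad _) -/(pang _) -/(prad _) -/(pang _).
  have h : ((prad (a' t0) - prad (a t1)) / prad (a t1) + pang (a' t0) - pang (a t1)) < 2 * pi * (N0 + j)%:R.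
    rewrite -(mulrC (N0 + j)%:R) -ltr_pdivrMr //; apply: lt_le_trans hN0 _; rewrite ler_nat; exact: leq_addr.
  by move: h; rewrite /prad /pang; lra.
have [Pq Fq] := plift_pt pl' (t := t0) ltac:(by case/andP: ht0 => /ltW ->).
have [Pw0 Fw0] := plift_pt pl (t := t1) ltac:(by case/andP: ht1 => /ltW ->).
have Pw j : Pt (pos vp) i0 (aw j) = curve e t1 by rewrite Pt_turn.
have Fw j : same_vec (curve e t1) (tlift e t1) (Fr (pos vp) i0 (aw j)) by rewrite Fr_turn.
pose n := ((wt e').+1 - wt e)%N.
exists n.+1, (fun j => (-1) ^+ (n - j) *+ 'C(n, j)).
exists (fun j => surgery pp se se' ee' cd ht0 ht1 raq (ra1 : regular r0 (aw j)) (rwq : prad (aw j) < _) rqR (gentle j)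
  Pq (Pw j) Fq (Fw j) wtk), (fun j => stag e' phi i); split.
  by move=> j; split; [exact: surgery_pseudotagging|exact: surgery_complexity].
move=> z gen.
have fl (x : edge T) (A : {set 'I_k}) : src x = vp -> #|A| = #|A| ->
    homogeneous #|A| (tagged_step (mono z (pos vp) (tlift x 0)) (flag z (pos vp) (tlift x 0)) #|A| A).
  move=> sx _; have px := leg_pointing sx; apply: tagged_step_homog => //.
  - by apply: flag_affine => //; left.
  - by move=> l lk; apply: mono_stab.
  - exact: gen.
have c1 : #|(phi e :\ i)%SET| = (wt e).-1 by rewrite -ce (cardsD1 i (phi e)) ie.
have c2 : #|(i |: phi e')%SET| = (wt e').+1 by rewrite cardsU1 ie' ce'.
have h1 := fl e (phi e :\ i)%SET se erefl; rewrite c1 in h1.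
have h2 := fl e' (i |: phi e')%SET se' erefl; rewrite c2 in h2.
rewrite (invariant_resum gen cd i ht0 ht1 ce ce').
under eq_bigr => s _ do rewrite -(inner_values gen cd N0 pl pl' ht0 ht1 ab ce ce' ie ie').
under [RHS]eq_bigr => j _ do rewrite (surgery_invariant pp se se' ee' cd ht0 ht1 raq
  (ra1 : regular r0 (aw j)) (rwq : prad (aw j) < _) rqR (gentle j) Pq (Pw j) Fq (Fw j) wtk h1 h2) mulr_sumr.
rewrite exchange_big /=; apply: eq_bigr => s _.
rewrite mulr_sumr mulr_suml; apply: eq_bigr => j _; rewrite -/n; ring.
Qed.
End Exchange.

(** * Linear combinations *)

Section Spanned.
Context {R : realType} {S : marked_surface R} {K : flavour} {k : nat}.

(** Coefficients and diagrams come before [z]: a single linear combination is valid on the whole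
    generic locus. *)
Definition spanned (I : moduli_point S K k -> R[i]) : Prop :=
  exists (n : nat) (c : 'I_n -> R[i]) (D : 'I_n -> diagram S K k)
         (psi : forall j, edge (D j) -> {set 'I_k}),
    (forall j, tagging (psi j)) /\
    forall z, generic z -> I z = \sum_(j < n) c j * diagram_invariant (psi j) z.

Lemma spanned_ext I J : (forall z, generic z -> I z = J z) -> spanned J -> spanned I.
Proof.
move=> IJ [n [c [D [psi [tp h]]]]]; exists n, c, D, psi; split=> // z gz.
by rewrite IJ // h.
Qed.

Lemma spanned_tagging (T : diagram S K k) (phi : edge T -> {set 'I_k}) :
  tagging phi -> spanned (diagram_invariant phi).
Proof.
move=> tp; exists 1%N, (fun=> 1), (fun=> T), (fun=> phi); split=> // z _.
by rewrite big_ord1 mul1r.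
Qed.

Lemma spanned0 : spanned (fun=> 0).
Proof.
have f0 (P : 'I_0 -> Type) (j : 'I_0) : P j by case: j.
exists 0%N, (fun=> 0), (f0 _), (f0 _); split=> [|z _]; first by case.
by rewrite big_ord0.
Qed.

Lemma spannedZ a I : spanned I -> spanned (fun z => a * I z).
Proof.
move=> [n [c [D [psi [tp h]]]]]; exists n, (fun j => a * c j), D, psi; split=> // z gz.
by rewrite h // mulr_sumr; apply: eq_bigr => j _; rewrite mulrA.
Qed.

Lemma spannedD I J : spanned I -> spanned J -> spanned (fun z => I z + J z).
Proof.
move=> [n [c [D [psi [tp h]]]]] [n' [c' [D' [psi' [tp' h']]]]].
exists (n + n')%N, (fun j => match split j with inl l => c l | inr l => c' l end).
exists (fun j => match split j with inl l => D l | inr l => D' l end).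
exists (fun j => match split j as s return
    edge (match s with inl l => D l | inr l => D' l end) -> {set 'I_k} with
  | inl l => psi l | inr l => psi' l end); split.
  by move=> j; case: (split j).
move=> z gz; rewrite h // h' // big_split_ord /=; congr (_ + _); apply: eq_bigr => j _.
  by have := unsplitK (inl j : 'I_n + 'I_n'); rewrite /unsplit => ->.
by have := unsplitK (inr j : 'I_n + 'I_n'); rewrite /unsplit => ->.
Qed.

Lemma spanned_sum n (c : 'I_n -> R[i]) (I : 'I_n -> moduli_point S K k -> R[i]) :
  (forall j, spanned (I j)) -> spanned (fun z => \sum_(j < n) c j * I j z).
Proof.
move=> sI; apply: (@spanned_ext _ (fun z => \sum_(j <- enum 'I_n) c j * I j z)).
  by move=> z _; rewrite big_enum.
elim: (enum 'I_n) => [|j r IH].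
  by apply: spanned_ext spanned0 => z _; rewrite big_nil.
by apply: spanned_ext (spannedD (spannedZ (c j) (sI j)) IH) => z _; rewrite big_cons.
Qed.

Lemma pseudotagging_spanned (T : diagram S K k) (phi : edge T -> {set 'I_k}) :
  pseudotagging phi -> spanned (diagram_invariant phi).
Proof.
move: {2}(complexity T) (leqnn (complexity T)) => m; elim/ltn_ind: m T phi => m IH T phi cT hphi.
have [tp|ntp] := pselect (tagging phi); first exact: spanned_tagging.
have [e [e' [le [le' [see [n1 n2]]]]]] : exists e e', leg e /\ leg e' /\ src e = src e' /\
    ~~ (phi e \subset phi e') /\ ~~ (phi e' \subset phi e).
  apply: contrapT => h; apply: ntp; split=> // e e' le le' see.
  apply/negPn/negP; rewrite negb_or => /andP[n1 n2]; apply: h.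
  by exists e, e'.
(* Incomparability is symmetric, so [e] may be the lighter leg, the one which loses an element. *)
wlog ab : e e' le le' see n1 n2 / (wt e <= wt e')%N.
  by move=> h; case/orP: (leq_total (wt e) (wt e')) => ab; [apply: (h e e')|apply: (h e' e)].
have /subsetPn[i ie ie'] := n1.
have ee' : e != e' by apply/eqP => h; move: n1; rewrite h subxx.
have [n [c [D [psi [hD hI]]]]] := exchange (le : puncture (pos (src e))) erefl (esym see) ee' hphi ab ie ie'.
apply: spanned_ext hI _; apply: spanned_sum => j; have [hp hc] := hD j.
exact: (IH (complexity (D j)) (leq_trans hc cT)).
Qed.
End Spanned.

Theorem theorem9p1 (R : realType) (k : nat) (hk : (2 <= k)%N)
    (S : marked_surface R) (K : flavour)
    (T : diagram S K k) (phi : edge T -> {set 'I_k}) (hphi : pseudotagging phi) :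
  exists (n : nat) (c : 'I_n -> R[i]) (D : 'I_n -> diagram S K k)
         (psi : forall j, edge (D j) -> {set 'I_k}),
    (forall j, tagging (psi j)) /\
    forall z : moduli_point S K k, generic z ->
      diagram_invariant phi z = \sum_(j < n) c j * diagram_invariant (psi j) z.
Proof. exact: pseudotagging_spanned. Qed.
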